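(* Let $n\in\mathbb{N}$, let $[\cdot]_\beta$ be the unnormalised expectation of the $\mathbb{H}^n$ model on $\Lambda$, and let $\mathbb{E}_{i,\boldsymbol{\ell}}$ be the expectation of the vertex-reinforced jump process (VRJP) $(X_t,\boldsymbol{L}_t)$ with initial condition $(i,\boldsymbol{\ell})$. Let $g\colon\mathbb{R}^{\Lambda}\to\mathbb{R}$ be a smooth compactly supported function, let $a\in\Lambda$, and let $s\in\mathbb{R}$. Then $$\big[\, g(\theta_s\boldsymbol{z})\,\delta_{u_0}(u_a)\big]_\beta = \big[\,\mathbb{E}_{a,\boldsymbol{z}}\big(g(\boldsymbol{L}_{\tau(\cosh s)})\big)\,\delta_{u_0}(u_a)\big]_\beta,$$ where $\tau(\gamma)=\inf\{t \mid L_t^a\ge\gamma\}$ and $u_0=(1,0,\dots,0)\in\mathbb{H}^n$.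
   Context: $\Lambda$ is a finite set and $\beta=(\beta_{ij})_{i,j\in\Lambda}$ are edge weights with $\beta_{ij}=\beta_{ji}\ge 0$ such that the graph with vertex set $\Lambda$ and edge set $\{\{i,j\}\mid\beta_{ij}>0\}$ is connected. Bold symbols denote objects indexed by $\Lambda$. Hyperbolic space: $\mathbb{R}^{n,1}$ is $\mathbb{R}^{n+1}$ with points $u=(u^0,u^1,\dots,u^n)$ and inner product $u\cdot v=-u^0v^0+\sum_{\alpha=1}^n u^\alpha v^\alpha$; write $z=u^0$, $x=u^1$. $\mathbb{H}^n=\{u\in\mathbb{R}^{n,1}\mid u\cdot u=-1,\ z>0\}$, parametrised by $(u^1,\dots,u^n)\in\mathbb{R}^n$ with $z=\sqrt{1+(u^1)^2+\dots+(u^n)^2}$, and equipped with the invariant measure $du=du^1\cdots du^n/z(u)$. For $\boldsymbol{u}=(u_i)_{i\in\Lambda}\in(\mathbb{H}^n)^\Lambda$ let $H_\beta(\boldsymbol{u})=\frac14\sum_{i,j\in\Lambda}\beta_{ij}(u_i-u_j)\cdot(u_i-u_j)=\frac12\sum_{i,j\in\Lambda}\beta_{ij}(-1-u_i\cdot u_j)$. The unnormalised expectation is $[F]_\beta=\int_{(\mathbb{H}^n)^\Lambda}F(\boldsymbol{u})e^{-H_\beta(\boldsymbol{u})}\prod_{i\in\Lambda}du_i$. The notation $[F\,\delta_{u_0}(u_a)]_\beta$ means the expectation with the spin at $a$ fixed to $u_0$: $\int_{(\mathbb{H}^n)^{\Lambda\setminus\{a\}}}F(\boldsymbol{u})e^{-H_\beta(\boldsymbol{u})}\prod_{i\ne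 a}du_i$ with $u_a=u_0$. $\theta_s$ is the Lorentz boost in the $xz$-plane acting simultaneously on all spins; $\theta_s\boldsymbol{z}=(x_i\sinh s+z_i\cosh s)_{i\in\Lambda}$. VRJP: for initial vertex $v\in\Lambda$ and initial local times $\boldsymbol{L}_0\in(0,\infty)^\Lambda$, the process $(X_t)_{t\ge0}$ has $X_0=v$ and jump rates $\mathbb{P}_{v,\boldsymbol{L}_0}[X_{t+dt}=j\mid (X_s)_{s\le t},X_t=i]=\beta_{ij}L_t^j\,dt$, where $L_t^i=L_0^i+\int_0^t1_{X_s=i}\,ds$. *)

(* Defs.v *)
From HB Require Import structures.
From mathcomp Require Import all_boot all_order all_algebra.
From mathcomp Require Import all_classical all_reals all_analysis.

Set Implicit Arguments.
Unset Strict Implicit.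
Unset Printing Implicit Defensive.

Import Order.TTheory GRing.Theory Num.Theory.
Import numFieldNormedType.Exports.

Local Open Scope classical_set_scope.
Local Open Scope ring_scope.

(* The library has binary products of sigma-finite measures only; power_measure
   mu n is the n-fold product of mu, on the tuple measurable space. *)
Section power_measure.
Context d (T : measurableType d) (R : realType).
Variable mu : {sigma_finite_measure set T -> \bar R}.

Definition tcons n (p : T * n.-tuple T) : n.+1.-tuple T :=
  [tuple of p.1 :: p.2].

Lemma measurable_tcons n : measurable_fun [set: T * n.-tuple T] (@tcons n).
Proof. exact: measurable_cons. Qed.

Definition tuncons n (t : n.+1.-tuple T) : T * n.-tuple T :=
  (thead t, [tuple of behead t]).

Lemma tconsK n : cancel (@tcons n) (@tuncons n).
Proof.
by case=> x t; rewrite /tuncons /tcons theadE; congr pair; exact: val_inj.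
Qed.

Lemma measurable_tuncons n : measurable_fun [set: n.+1.-tuple T] (@tuncons n).
Proof.
apply: measurable_fun_pair; first exact: measurable_tnth.
exact: measurable_behead.
Qed.

Section cons_measure.
Variables (n : nat) (m : {sigma_finite_measure set (n.-tuple T) -> \bar R}).

Definition cons_measure : set (n.+1.-tuple T) -> \bar R :=
  pushforward (mu \x m)%E (@tcons n).

Let pf : {measure set (n.+1.-tuple T) -> \bar R} :=
  measure_function_pushforward__canonical__measure_function_Measure
    (mu \x m)%E (@measurable_tcons n).

HB.instance Definition _ := isMeasure.Build _ _ _ cons_measure
  (measure0 pf) (measure_ge0 pf) (@measure_semi_sigma_additive _ _ _ pf).

Let cons_measure_sigma_finite : sigma_finite setT cons_measure.
Proof.
have /sigma_finiteP[F [TF ndF Foo]] := sigma_finiteT mu.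
have /sigma_finiteP[G [TG ndG Goo]] := sigma_finiteT m.
exists (fun k => @tuncons n @^-1` (F k `*` G k)).
  rewrite -preimage_bigcup -(@preimage_setT _ _ (@tuncons n)); congr preimage.
  rewrite -setXTT TF TG predeqE => -[x y]; split.
    move=> [/= [i _ Fix] [j _ Gjy]]; exists (maxn i j) => //; split.
    - by move: x Fix; exact/subsetPset/ndF/leq_maxl.
    - by move: y Gjy; exact/subsetPset/ndG/leq_maxr.
  by move=> [i _ []/= ? ?]; split; exists i.
move=> k; have [mF Fk] := Foo k; have [mG Gk] := Goo k; split.
  by rewrite -[X in measurable X]setTI; apply: measurable_tuncons => //;
    exact: measurableX.
rewrite /cons_measure /pushforward -comp_preimage.
rewrite (_ : _ \o _ = id) ?preimage_id; last first.
  by apply/funext => p /=; rewrite tconsK.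
by rewrite product_measure1E// lte_mul_pinfty// ge0_fin_numE.
Qed.

HB.instance Definition _ := Measure_isSigmaFinite.Build _ _ _ cons_measure
  cons_measure_sigma_finite.

End cons_measure.

Fixpoint power_measure n : {sigma_finite_measure set (n.-tuple T) -> \bar R} :=
  match n with
  | 0 => \d_([tuple] : 0.-tuple T)
  | n'.+1 => cons_measure (power_measure n')
  end.

End power_measure.

Definition cosh (R : realType) (s : R) : R := (expR s + expR (- s)) / 2.
Definition sinh (R : realType) (s : R) : R := (expR s - expR (- s)) / 2.

Section hyperbolic_space.
Variables (R : realType) (n : nat).
Implicit Types (u v : 'rV[R]_n.+1) (y : n.-tuple R).

Definition minkowski u v : R :=
  - (u 0 0 * v 0 0) + \sum_(k < n) u 0 (lift ord0 k) * v 0 (lift ord0 k).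

Definition hyperboloid : set 'rV[R]_n.+1 :=
  [set u | minkowski u u = -1 /\ 0 < u 0 0].

Definition zcoord u : R := u 0 0.

(* u^1, the first spatial coordinate; only meaningful for 0 < n. *)
Definition xcoord u : R := u 0 (inord 1).

Definition hyp_point y : 'rV[R]_n.+1 :=
  \row_k if unlift ord0 k is Some j then tnth y j
         else Num.sqrt (1 + \sum_(j < n) tnth y j ^+ 2).

Definition hyp_origin : 'rV[R]_n.+1 := \row_k (k == ord0)%:R.

Lemma hyp_pointP : range hyp_point = hyperboloid.
Proof.
have mE u : minkowski u u =
    - u 0 0 ^+ 2 + \sum_(k < n) u 0 (lift ord0 k) ^+ 2 by [].
have hz y : hyp_point y 0 0 = Num.sqrt (1 + \sum_(j < n) tnth y j ^+ 2).
  by rewrite mxE unlift_none.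
have hs y j : hyp_point y 0 (lift ord0 j) = tnth y j by rewrite mxE liftK.
have p1 (f : 'I_n -> R) : 0 < 1 + \sum_(j < n) f j ^+ 2.
  by apply: ltr_pwDl => //; apply: sumr_ge0 => j _; exact: sqr_ge0.
apply/seteqP; split=> [_ [y _ <-]|u [uu u0]]; first split.
- rewrite mE hz sqr_sqrtr ?ltW// [X in - _ + X](eq_bigr (fun j => tnth y j ^+ 2)) => [|j _].
    by rewrite opprD subrK.
  by rewrite hs.
- by rewrite hz sqrtr_gt0.
exists [tuple u 0 (lift ord0 j) | j < n] => //; apply/rowP => k.
case: (unliftP ord0 k) => [j ->|->]; first by rewrite hs tnth_mktuple.
rewrite hz [X in 1 + X](eq_bigr (fun j => u 0 (lift ord0 j) ^+ 2)) => [|j _]; last first.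
  by rewrite tnth_mktuple.
have -> : 1 + \sum_(j < n) u 0 (lift ord0 j) ^+ 2 = u 0 0 ^+ 2.
  by move/eqP: uu; rewrite mE addrC subr_eq => /eqP ->; rewrite addrA subrr add0r.
by rewrite sqrtr_sqr ger0_norm// ltW.
Qed.

(* Lorentz boost in the xz-plane. *)
Definition boost (s : R) u : 'rV[R]_n.+1 :=
  \row_k if k == ord0 then xcoord u * sinh s + zcoord u * cosh s
         else if k == inord 1 then xcoord u * cosh s + zcoord u * sinh s
         else u 0 k.

End hyperbolic_space.

Arguments hyp_origin {R n}.

Section sigma_model.
Variables (R : realType) (L : finType) (n : nat) (beta : L -> L -> R).

Definition hamiltonian (u : L -> 'rV[R]_n.+1) : R :=
  4^-1 * \sum_i \sum_j beta i j * minkowski (u i - u j) (u i - u j).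

Variables (a : L) (u0 : 'rV[R]_n.+1).

Definition free_site : finType := {i : L | i != a}.

Definition pinned_config (y : #|free_site|.-tuple (n.-tuple R)) :
    L -> 'rV[R]_n.+1 :=
  fun i => if insub i is Some j
           then hyp_point (tnth y (enum_rank (j : free_site))) else u0.

(* [F delta_{u0}(u_a)]_beta, with du = du^1 ... du^n / z(u) at each i != a. *)
Definition pinned_expectation (F : (L -> 'rV[R]_n.+1) -> \bar R) : \bar R :=
  (\int[power_measure (power_measure lebesgue_measure n) #|free_site| ]_y
    let u := pinned_config y in
    F u * (expR (- hamiltonian u) * \prod_(i | i != a) (zcoord (u i))^-1)%:E)%E.

End sigma_model.

Section smooth.
Variable R : realType.

Fixpoint is_Ck (N k : nat) (f : 'rV[R]_N -> R) : Prop :=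
  match k with
  | 0 => continuous f
  | k'.+1 => forall i : 'I_N, (forall x, derivable f x (delta_mx 0 i)) /\
                              is_Ck k' ('D_(delta_mx 0 i) f)
  end.

(* Functions on R^L are transported to the normed space of row vectors along
   the enumeration of L. *)
Definition on_rV (L : finType) (g : (L -> R) -> R) : 'rV[R]_#|L| -> R :=
  fun x => g (fun i => x 0 (enum_rank i)).

Definition smooth (L : finType) (g : (L -> R) -> R) : Prop :=
  forall k, is_Ck k (on_rV g).

Definition compactly_supported (L : finType) (g : (L -> R) -> R) : Prop :=
  compact (closure [set x | on_rV g x != 0]).

End smooth.

Section vrjp.
Variables (R : realType) (L : finType) (d : measure_display)
  (Omega : measurableType d).
Implicit Types (X : R -> Omega -> L) (ell : L -> R).

Definition local_time X ell (t : R) (w : Omega) : L -> R :=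
  fun i => ell i + \int[lebesgue_measure]_(s in `[0, t]) ((X s w == i)%:R : R).

(* The sigma-algebra generated by X_s, 0 <= s <= t. *)
Definition past X (t : R) : set (set Omega) :=
  <<s [set A | exists s i, 0 <= s <= t /\ A = X s @^-1` [set i]] >>.

(* vrjp_rate is P[X_{t+h} = j | (X_s)_{s <= t}, X_t = i] = beta_ij L_t^j h + o(h)
   for j != i, integrated over events A of the past up to t.  The o(h) is
   uniform in A and in t <= T: pointwise in t, it would still allow jumps at
   deterministic times. *)
Record is_VRJP (beta : L -> L -> R) (v : L) ell (P : probability Omega R) X :
    Prop := {
  vrjp_measurable : forall t i, 0 <= t -> measurable (X t @^-1` [set i]) ;
  vrjp_right_continuous : forall w t, 0 <= t ->
    \forall s \near t^'+, X s w = X t w ;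
  vrjp_left_limit : forall w t, 0 < t ->
    exists i, \forall s \near t^'-, X s w = i ;
  vrjp_start : P (X 0 @^-1` [set v]) = 1%E ;
  vrjp_rate : forall T eps : R, 0 < eps -> \forall h \near 0^'+,
    forall t A i j, 0 <= t <= T -> past X t A -> i != j ->
    `| fine (P (A `&` X t @^-1` [set i] `&` X (t + h) @^-1` [set j]))
       - h * \int[P]_(w in A `&` X t @^-1` [set i])
               (beta i j * local_time X ell t w j) | <= eps * h
}.

Definition hitting_time X ell (a : L) (gamma : R) (w : Omega) : \bar R :=
  ereal_inf [set t%:E | t in [set t | 0 <= t /\ gamma <= local_time X ell t w a]].

(* g(L_tau(gamma)).  When tau is infinite, which has probability zero for the
   VRJP, the value is set to 0; this is the limit of g(L_t) as t goes to
   infinity if g is compactly supported, as the L_t^i add up to a constant plus t. *)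
Definition at_hitting_time X ell (a : L) (gamma : R) (g : (L -> R) -> R)
    (w : Omega) : R :=
  if hitting_time X ell a gamma w is t%:E then g (local_time X ell t w) else 0.

End vrjp.

(* Main.v *)
Require Import Defs.
From HB Require Import structures.
From mathcomp Require Import all_boot all_order all_algebra.
From mathcomp Require Import all_classical all_reals all_analysis.
From mathcomp Require Import measurable_realfun lra ring.

Set Implicit Arguments.
Unset Strict Implicit.
Unset Printing Implicit Defensive.

Import Order.TTheory GRing.Theory Num.Theory.
Import numFieldNormedType.Exports.

Local Open Scope classical_set_scope.
Local Open Scope ring_scope.

(* Let [w] be a probability density supported just below [cosh s], and let [f]
   solve [d f_i / d l_i + sum_j beta_ij l_j (f_j - f_i) = - 1_{i = a} w(l_a) g(l)].
   On the VRJP side, Dynkin's formula gives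
   [f_a(l) = E_{a,l} [int w(L_t^a) g(L_t) 1_{X_t = a} dt]], and since
   [dL_t^a = 1_{X_t = a} dt] this tends to [E_{a,l} g(L_tau(cosh s))] when [w]
   concentrates at [cosh s].  On the spin side, let [T_i = z_i d/dx_i + x_i d/dz_i]
   be the boost generator acting on the spin at [i].  Because
   [T_i H = sum_j beta_ij (z_j x_i - x_j z_i)], one has
   [sum_i T_i (f_i(z) e^{-H}) = - x_a w(z_a) g(z) e^{-H}].  The terms with
   [i <> a] integrate to zero by invariance of [du_i].  Moving the pinned spin
   along [theta_{s r} u_0], [0 <= r <= 1], turns the term [i = a] into a total
   derivative in [r], so that [int f_a(z) e^{-H}] at [u_a = u_0] is the average of
   [int g(z) e^{-H}] at [u_a = theta_{s r} u_0] against the density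
   [s sinh(s r) w(cosh(s r))] of [r], which concentrates at [r = 1].  Boosting the
   remaining spins then gives the left-hand side of the theorem.  The equation
   for [f] is only solved up to an arbitrarily small error, by Picard iteration. *)

(** * One-variable calculus *)

(** The family [P] is not assumed measurable in its initial condition, so even the measurability in
    the spins of the VRJP expectation has to be obtained: it is a pointwise limit of approximate
    solutions, which are bounded Lipschitz functions of z. The solutions are kept in this class
    throughout, and a quadratic remainder in direction i takes the place of smoothness. An error eps
    is affordable on both sides because every function vanishes as soon as one coordinate reaches a
    bound M. The process then has to be followed only until the total local time is at least |L| M,
    and the spins range over a box of finite measure on which e^{-H} is bounded; both constants are
    uniform in the initial local times. The same cut-off makes a truncation of the jump rates
    invisible. The VRJP is given by short-time jump probabilities on events of the past only, so
    Dynkin's formula is proved by summing increments over a time grid. The density w has to fit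
    between the initial value z_a = 1 and cosh s, which forces s <> 0; for s = 0 the hitting time is
    0. *)

Section real_line.
Context {R : realType}.
Notation mu := (@lebesgue_measure R).
Implicit Types (f F : R -> R) (a b c C : R).

Lemma bounded_on_integrable d (T : measurableType d)
    (m : {measure set T -> \bar R}) (A : set T) (f : T -> R) C :
  measurable A -> (m A < +oo)%E -> measurable_fun A f ->
  (forall x, A x -> `|f x| <= C) -> m.-integrable A (EFin \o f).
Proof.
move=> mA Afin mf fC; apply: measurable_bounded_integrable => //.
exists C; split; first by rewrite num_real.
by move=> x Cx y Ay; apply: le_trans (ltW Cx); exact: fC.
Qed.

Lemma lebesgue_itv_fin a b : (mu `[a, b]%classic < +oo)%E.
Proof. by rewrite /= lebesgue_measure_itv/=; case: ifP => // _; rewrite -EFinB ltry. Qed.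

Lemma lebesgue_itv_cc a b : a <= b -> mu `[a, b]%classic = (b - a)%:E.
Proof.
rewrite le_eqVlt => /predU1P[->|ab]; rewrite /= lebesgue_measure_itv/= lte_fin.
  by rewrite ltxx subrr.
by rewrite ab EFinB.
Qed.

Lemma continuous_itv_integrable f a b : continuous f ->
  mu.-integrable `[a, b] (EFin \o f).
Proof.
move=> cf; apply: continuous_compact_integrable; first exact: segment_compact.
exact: continuous_subspaceT.
Qed.

Lemma Rintegral_itv_split f a b c : continuous f -> a <= b -> b <= c ->
  \int[mu]_(x in `[a, c]) f x =
  \int[mu]_(x in `[a, b]) f x + \int[mu]_(x in `[b, c]) f x.
Proof.
move=> cf ab bc; have := @Rintegral_itvB _ f (BLeft a) (BRight c) b.
move=> /(_ (continuous_itv_integrable _ _ cf)); rewrite !bnd_simp => /(_ ab bc).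
rewrite Rintegral_itv_obnd_cbnd; last first.
  apply: integrableS (continuous_itv_integrable b c cf) => //.
  exact: subset_itv_oc_cc.
by move=> <-; rewrite addrC subrK.
Qed.

Lemma Rintegral_itv_bound f a b C : continuous f -> a <= b ->
  (forall x, a <= x <= b -> `|f x| <= C) ->
  `|\int[mu]_(x in `[a, b]) f x| <= C * (b - a).
Proof.
move=> cf ab fC.
apply: le_trans (le_normr_Rintegral _ (continuous_itv_integrable _ _ cf)) _ => //.
have -> : C * (b - a) = \int[mu]_(x in `[a, b]) C.
  by rewrite Rintegral_cst//; rewrite [X in _ * fine X]lebesgue_itv_cc.
apply: le_Rintegral => //.
- by apply: continuous_itv_integrable => x; apply: cvg_norm; exact: cf.
- by apply: continuous_itv_integrable; exact: cst_continuous.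
Qed.

Lemma Rintegral_itv_quadratic f a b C : continuous f -> a <= b ->
  (forall x, a <= x <= b -> `|f x - f a| <= C * (x - a)) -> 0 <= C ->
  `|\int[mu]_(x in `[a, b]) f x - (b - a) * f a| <= C * (b - a) ^+ 2.
Proof.
move=> cf ab fC C0.
have -> : (b - a) * f a = \int[mu]_(x in `[a, b]) f a.
  by rewrite Rintegral_cst//; rewrite [X in _ * fine X]lebesgue_itv_cc//= mulrC.
rewrite -RintegralB//; last 2 first.
- exact: continuous_itv_integrable.
- by apply: continuous_itv_integrable; exact: cst_continuous.
rewrite expr2 mulrA; apply: Rintegral_itv_bound => //.
  by move=> x; apply: cvgB; [exact: cf|exact: cvg_cst].
move=> x /andP[ax xb]; apply: le_trans (fC x _) _; first by rewrite ax.
by rewrite ler_wpM2l// lerB.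
Qed.

Lemma near_dist_lt (a e : R) : 0 < e -> \forall x \near a, `|x - a| < e.
Proof.
by move=> e0; apply/nbhs_ballP; exists e => // x; rewrite /ball/= distrC.
Qed.

(** The difference quotient is within [C * |x - a|] of [l], so the Caratheodory slope set to [l] at
    [a] is continuous there. This turns the quadratic remainders of the Poisson solutions and of
    [tent_cdf] into derivatives. *)
Lemma is_derive_quadratic f a (l C : R) :
  (exists2 e : R, 0 < e & forall x, `|x - a| < e -> `|f x - f a - (x - a) * l| <= C * (x - a) ^+ 2) ->
  is_derive a 1 f l.
Proof.
move=> [e e0 H]; apply/is_derive1_caratheodory.
exists (fun x => if x == a then l else (f x - f a) / (x - a)); split.
- move=> x; case: eqP => [->|/eqP xa]; first by rewrite !subrr mulr0.
  by rewrite divfK// subr_eq0.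
- have C0 : 0 <= `|C| by [].
  rewrite /prop_for /continuous_at; apply/(@cvgrPdist_le _ R) => eps eps0; rewrite eqxx; near=> x.
  case: eqP => [_|/eqP xa]; first by rewrite subrr normr0 ltW.
  have xa0 : x - a != 0 by rewrite subr_eq0.
  rewrite -(ler_pM2r (x := `|x - a|)) ?normr_gt0// -normrM mulrBl divfK//.
  rewrite distrC (mulrC l); apply: (le_trans (H x _)).
    by near: x; exact: near_dist_lt.
  rewrite -[_ ^+ 2]ger0_norm ?sqr_ge0// expr2 normrM mulrA.
  rewrite ler_wpM2r//; apply: (@le_trans _ _ ((`|C| + 1) * `|x - a|)).
    by rewrite ler_wpM2r// (le_trans (ler_norm C))// lerDl.
  rewrite -ler_pdivlMl ?ltr_wpDl//; apply: ltW; near: x.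
  by apply: near_dist_lt; rewrite mulr_gt0 ?invr_gt0 ?ltr_wpDl.
- by rewrite eqxx.
Unshelve. all: by end_near. Qed.

Lemma is_derive_continuous F f : (forall x : R, is_derive x 1 F (f x)) -> continuous F.
Proof.
by move=> dF x; apply/differentiable_continuous/derivable1_diffP; have [] := dF x.
Qed.

Lemma FTC2 F f a b : (forall x : R, is_derive x 1 F (f x)) -> continuous f ->
  a <= b -> (\int[mu]_(x in `[a, b]) (f x)%:E = (F b - F a)%:E)%E.
Proof.
move=> dF cf; rewrite le_eqVlt => /predU1P[->|ab].
  by rewrite set_itv1 integral_set1 subrr.
have cF := is_derive_continuous dF.
rewrite EFinB; apply: continuous_FTC2 => //.
- exact: continuous_subspaceT.
- split; first by move=> x _; have [] := dF x.
  + by apply: cvg_at_right_filter; exact: cF.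
  + by apply: cvg_at_left_filter; exact: cF.
- by move=> x _; rewrite derive1E; apply: (@derive_val _ _ _ _ _ _ _ (dF x)).
Qed.

End real_line.

(** * Bounded Lipschitz functions of the local times *)

Section lipschitz.
Context {R : realType} {L : finType}.
Implicit Types (F G : (L -> R) -> R) (l : L -> R) (i k : L) (C : R).

(** The distance suited to local times: along a path they move at unit speed in it
    ([local_time_dist]). *)
Definition l1dist l l' : R := \sum_k `|l k - l' k|.

Definition upd l i (y : R) : L -> R := fun k => if k == i then y else l k.

Lemma upd_same l i y : upd l i y i = y. Proof. by rewrite /upd eqxx. Qed.

Lemma upd_id l i : upd l i (l i) = l.
Proof. by apply/funext => k; rewrite /upd; case: eqP => // ->. Qed.

Lemma upd_upd l i y y' : upd (upd l i y) i y' = upd l i y'.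
Proof. by apply/funext => k; rewrite /upd; case: eqP. Qed.

Lemma l1dist_ge0 l l' : 0 <= l1dist l l'.
Proof. exact: sumr_ge0. Qed.

Lemma ler_l1dist l l' k : `|l k - l' k| <= l1dist l l'.
Proof. by rewrite /l1dist (bigD1 k)//= lerDl sumr_ge0. Qed.

Lemma l1dist_upd l i y y' : l1dist (upd l i y) (upd l i y') = `|y - y'|.
Proof.
rewrite /l1dist (bigD1 i)//= !upd_same big1 ?addr0// => k ki.
by rewrite /upd (negbTE ki) subrr normr0.
Qed.

Lemma l1dist_upd2 l l' i y : l1dist (upd l i y) (upd l' i y) <= l1dist l l'.
Proof.
apply: ler_sum => k _; rewrite /upd; case: eqP => //.
by rewrite subrr normr0.
Qed.

(** This class is stable under the Picard iteration, and it is enough for measurability along a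
    random path and for passing to pointwise limits. One constant serves for both bounds. *)
Definition lip_bounded C F :=
  (forall l, `|F l| <= C) /\ (forall l l', `|F l - F l'| <= C * l1dist l l').

Definition blip F := exists C, lip_bounded C F.

Lemma lip_bounded_ge0 C F : lip_bounded C F -> 0 <= C.
Proof. by move=> [H _]; exact: le_trans (H (fun=> 0)). Qed.

Lemma lip_bounded_le C C' F : lip_bounded C F -> C <= C' -> lip_bounded C' F.
Proof.
move=> [H1 H2] CC'; split=> [l|l l']; first exact: le_trans (H1 l) _.
by apply: le_trans (H2 l l') _; rewrite ler_wpM2r ?l1dist_ge0.
Qed.

Lemma blip_family (I : finType) (F : I -> (L -> R) -> R) :
  (forall i : I, blip (F i)) -> exists C, forall i : I, lip_bounded C (F i).
Proof.
move=> /choice[C HC]; exists (\sum_i C i) => i; apply: lip_bounded_le (HC i) _.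
by rewrite (bigD1 i)//= lerDl sumr_ge0// => j _; exact: lip_bounded_ge0 (HC j).
Qed.

Lemma blip_cst (c : R) : blip (fun=> c).
Proof.
exists `|c|; split=> [//|l l']; rewrite subrr normr0.
by rewrite mulr_ge0// l1dist_ge0.
Qed.

Lemma blipD F G : blip F -> blip G -> blip (fun l => F l + G l).
Proof.
move=> [C [F1 F2]] [D [G1 G2]]; exists (C + D); split=> [l|l l'].
  exact: le_trans (ler_normD _ _) (lerD (F1 _) (G1 _)).
rewrite opprD addrACA mulrDl.
exact: le_trans (ler_normD _ _) (lerD (F2 _ _) (G2 _ _)).
Qed.

Lemma blipN F : blip F -> blip (fun l => - F l).
Proof.
move=> [C [F1 F2]]; exists C; split=> [l|l l']; first by rewrite normrN.
by rewrite -opprD normrN.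
Qed.

Lemma blipB F G : blip F -> blip G -> blip (fun l => F l - G l).
Proof. by move=> bF bG; apply: blipD => //; exact: blipN. Qed.

Lemma blipM F G : blip F -> blip G -> blip (fun l => F l * G l).
Proof.
move=> [C [F1 F2]] [D [G1 G2]]; exists (C * D + C * D).
have C0 : 0 <= C := le_trans (normr_ge0 _) (F1 (fun=> 0)).
have D0 : 0 <= D := le_trans (normr_ge0 _) (G1 (fun=> 0)).
split=> [l|l l'].
  by rewrite normrM ler_wpDr ?mulr_ge0// ler_pM.
have -> : F l * G l - F l' * G l' = F l * (G l - G l') + (F l - F l') * G l'.
  by ring.
apply: le_trans (ler_normD _ _) _; rewrite !normrM mulrDl; apply: lerD.
  by rewrite -mulrA ler_pM.
by rewrite mulrAC ler_pM.
Qed.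

Lemma blip_sum (I : Type) (r : seq I) (F : I -> (L -> R) -> R) :
  (forall i : I, blip (F i)) -> blip (fun l => \sum_(i <- r) F i l).
Proof.
move=> bF; elim: r => [|x r IH].
  by under [X in blip X]eq_fun do rewrite big_nil; exact: blip_cst.
by under [X in blip X]eq_fun do rewrite big_cons; exact: blipD.
Qed.

Lemma blip_coord (phi : R -> R) k C D :
  (forall x, `|phi x| <= C) -> (forall x y, `|phi x - phi y| <= D * `|x - y|) ->
  0 <= D -> blip (fun l => phi (l k)).
Proof.
move=> h1 h2 D0; exists (C + D); split=> [l|l l'].
  by rewrite ler_wpDr.
apply: le_trans (h2 _ _) _.
have C0 : 0 <= C := le_trans (normr_ge0 _) (h1 0).
by rewrite ler_pM ?ler_l1dist// lerDr.
Qed.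

Lemma blip_cvg (T : Type) (A : set_system T) {FA : Filter A} F
    (Z : T -> L -> R) (z : L -> R) : blip F ->
  (forall k, Z x k @[x --> A] --> z k) -> F (Z x) @[x --> A] --> F z.
Proof.
move=> [C FC] Zz; have C0 := lip_bounded_ge0 FC; have [_ F2] := FC.
have dz : C * l1dist (Z x) z @[x --> A] --> (0 : R).
  rewrite -[X in _ --> X](mulr0 C); apply: cvgMr.
  have <- : \sum_(k : L) (0 : R) = 0 by rewrite big1.
  rewrite /l1dist.
  apply: cvg_big => [|k _]; first exact: add_continuous.
  rewrite -(@normr0 _ R) -[X in `|X|](subrr (z k)).
  by apply: cvg_norm; apply: cvgB; [exact: Zz|exact: cvg_cst].
apply/(@cvgrPdistC_le _ R) => e e0.
move/(@cvgrPdistC_le _ R) : dz => /(_ e e0); apply: filterS => x.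
rewrite subr0 ger0_norm ?mulr_ge0 ?l1dist_ge0//.
exact: le_trans (F2 _ _).
Qed.

Lemma blip_continuous (T : topologicalType) F (Z : T -> L -> R) : blip F ->
  (forall k, continuous (fun x => Z x k)) -> continuous (fun x => F (Z x)).
Proof. by move=> bF cZ x; apply: blip_cvg => // k; exact: cZ. Qed.

Lemma blip_upd_continuous F l i : blip F -> continuous (fun y : R => F (upd l i y)).
Proof.
move=> bF; apply: blip_continuous => // k; rewrite /upd.
by case: eqP => _ x; [exact: cvg_id|exact: cvg_cst].
Qed.

End lipschitz.

(** * Approximate solutions of the Poisson equation *)

Section picard.
Context {R : realType} {L : finType}.
Notation mu := (@lebesgue_measure R).
Variables (beta : L -> L -> R) (M : R).
Hypothesis M_gt0 : 0 < M.
Implicit Types (h q : L -> (L -> R) -> R) (l : L -> R) (i k : L).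

(** Truncation to [0, M]. It leaves the equation unchanged at nonnegative local times, since the
    solutions vanish once some local time reaches M. *)
Definition clamp (x : R) := Num.min (Num.max x 0) M.

Lemma clamp_itv x : 0 <= clamp x <= M.
Proof. by rewrite /clamp ge_min lexx orbT le_min le_max lexx orbT ltW. Qed.

Lemma clamp_id x : 0 <= x <= M -> clamp x = x.
Proof. by case/andP=> x0 xM; rewrite /clamp max_l// min_l. Qed.

Lemma clamp_ge x : M <= x -> clamp x = M.
Proof. by move=> Mx; rewrite /clamp max_l ?min_r// (le_trans (ltW M_gt0)). Qed.

Lemma clamp_lip x y : `|clamp x - clamp y| <= `|x - y|.
Proof.
wlog xy : x y / x <= y.
  by move=> H; have [/H//|/ltW/H] := leP x y; rewrite distrC (distrC y).
have H : 0 <= clamp y - clamp x <= y - x.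
  rewrite /clamp /Num.min /Num.max; have := M_gt0.
  case: (ltP x 0) => hx; case: (ltP y 0) => hy M0;
    repeat case: ltP => ?; lra.
by rewrite distrC (distrC x) !ger0_norm ?subr_ge0//; case/andP: H => //; rewrite subr_ge0.
Qed.

Lemma blip_clamp (k : L) : blip (fun l => clamp (l k)).
Proof.
apply: (@blip_coord _ _ clamp k M 1) => // [x|x y].
  by rewrite ger0_norm; have /andP[] := clamp_itv x.
by rewrite mul1r clamp_lip.
Qed.

(** For local times in [0, M] this solves d f_i / d l_i = - h_i with f_i = 0 at l_i = M. *)
Definition tail_integral h i l : R :=
  \int[mu]_(y in `[clamp (l i), M]) h i (upd l i y).

(* [jump h] is the jump part of the VRJP generator, with the rates truncated
   at local time [M] so that it is bounded on the whole of [L -> R]. *)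
Definition jump h i l : R := \sum_j beta i j * clamp (l j) * (h j l - h i l).

(** Used in two ways: any [k] with [m = M] gives bounded support, and [k = a] with [m = cosh s]
    removes the boundary term at the end of the pinned orbit. *)
Definition vanishes_above k (m : R) h := forall i l, m <= l k -> h i l = 0.

(** The integral moves coordinate [i] only upwards from its clamped value, and [m <= M] keeps a
    clamped coordinate above [m], so the integrand stays in the region where it vanishes. *)
Lemma vanishes_tail_integral k m h : m <= M ->
  vanishes_above k m h -> vanishes_above k m (tail_integral h).
Proof.
move=> mM hv i l ml; rewrite /tail_integral.
rewrite (@eq_Rintegral _ _ _ _ _ (fun=> 0)).
  by rewrite Rintegral_cst// mul0r.
move=> y; rewrite inE/= in_itv/= => /andP[cy _]; apply: hv.
rewrite /upd; case: eqP => // ki; apply: le_trans cy.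
by rewrite -ki /clamp le_min mM andbT le_max ml.
Qed.

Lemma vanishes_jump k m h : vanishes_above k m h -> vanishes_above k m (jump h).
Proof.
by move=> hv i l ml; rewrite /jump big1// => j _; rewrite !(hv _ l ml) subrr mulr0.
Qed.

Lemma blip_jump h i : (forall j, blip (h j)) -> blip (jump h i).
Proof.
move=> bh; apply: blip_sum => j; apply: blipM; last exact: blipB.
by apply: blipM; [exact: blip_cst|exact: blip_clamp].
Qed.

(** The cases are the positions of [M] relative to [s <= t]; whatever the clamping cuts off lies
    above [M], where [phi] is zero. *)
Lemma tail_integral_sub (phi : R -> R) (s t : R) : continuous phi ->
  (forall y, M <= y -> phi y = 0) -> 0 <= s -> s <= t ->
  \int[mu]_(y in `[clamp s, M]) phi y - \int[mu]_(y in `[clamp t, M]) phi y =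
  \int[mu]_(y in `[s, t]) phi y.
Proof.
move=> cphi phi0 s0 st.
have zero a b : M <= a -> a <= b -> \int[mu]_(y in `[a, b]) phi y = 0.
  move=> Ma ab; apply/eqP; rewrite -normr_le0 -(mul0r (b - a)).
  apply: Rintegral_itv_bound => // x /andP[ax _].
  by rewrite phi0 ?normr0// (le_trans Ma).
have [tM|Mt] := leP t M.
  rewrite !clamp_id ?s0 ?tM ?(le_trans st)// ?(le_trans s0)//.
  by rewrite (@Rintegral_itv_split _ _ s t M)// addrK.
rewrite (clamp_ge (ltW Mt)) (zero M M)// subr0.
have [sM|Ms] := leP s M.
  rewrite clamp_id ?s0// (@Rintegral_itv_split _ _ s M t)// ?(ltW Mt)//.
  by rewrite (zero M t)// ?addr0// ltW.
by rewrite (clamp_ge (ltW Ms)) (zero M M)// zero// ltW.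
Qed.

(** The factor 2 pays for the case [t < s]: there the expansion is natural at [t], and moving its
    base point to [s] costs another Lipschitz term. *)
Lemma tail_integral_quadratic C h i l s t : lip_bounded C (h i) ->
  vanishes_above i M h -> 0 <= s -> 0 <= t ->
  `|tail_integral h i (upd l i t) - tail_integral h i (upd l i s)
    + (t - s) * h i (upd l i s)| <= 2 * C * (t - s) ^+ 2.
Proof.
move=> hC hv s0 t0; have C0 := lip_bounded_ge0 hC; have [hC1 hC2] := hC.
pose phi y := h i (upd l i y).
have cphi : continuous phi by apply: blip_upd_continuous; exists C.
have phi0 y : M <= y -> phi y = 0 by move=> My; apply: hv; rewrite upd_same.
have lphi x y : `|phi x - phi y| <= C * `|x - y|.
  by apply: le_trans (hC2 _ _) _; rewrite l1dist_upd.
have E r : tail_integral h i (upd l i r) = \int[mu]_(y in `[clamp r, M]) phi y.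
  by rewrite /tail_integral upd_same; under eq_Rintegral do rewrite upd_upd.
rewrite !E -/(phi s).
have quad a b : 0 <= a -> a <= b ->
    `|\int[mu]_(y in `[a, b]) phi y - (b - a) * phi a| <= C * (b - a) ^+ 2.
  move=> a0 ab; apply: Rintegral_itv_quadratic => // x /andP[ax _].
  by apply: le_trans (lphi _ _) _; rewrite ger0_norm// subr_ge0.
have [st|/ltW ts] := leP s t.
  have := tail_integral_sub cphi phi0 s0 st; have := quad _ _ s0 st.
  move=> Q E'; rewrite -normrN; apply: le_trans (_ : C * (t - s) ^+ 2 <= _); last first.
    by rewrite ler_wpM2r ?sqr_ge0// ler_peMl// ler1n.
  by apply: le_trans Q; rewrite -E' le_eqVlt; apply/predU1l; congr (`|_|); ring.
have := tail_integral_sub cphi phi0 t0 ts; have := quad _ _ t0 ts.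
move=> Q ->; set I := \int[mu]_(y in `[t, s]) _ in Q *.
have -> : I + (t - s) * phi s =
    (I - (s - t) * phi t) + (s - t) * (phi t - phi s) by ring.
have -> : 2 * C * (t - s) ^+ 2 = C * (s - t) ^+ 2 + C * (s - t) ^+ 2 by ring.
apply: le_trans (ler_normD _ _) (lerD Q _).
rewrite normrM (ger0_norm (_ : 0 <= s - t)) ?subr_ge0//.
apply: le_trans (ler_wpM2l _ (lphi _ _)) _; first by rewrite subr_ge0.
by rewrite (distrC t) (ger0_norm (_ : 0 <= s - t)) ?subr_ge0// mulrCA expr2.
Qed.

(** The integrand varies over an interval of length at most [M], which costs [C * M]; the lower
    endpoint moves, which costs [C]. *)
Lemma blip_tail_integral h i : blip (h i) -> blip (tail_integral h i).
Proof.
move=> [C hC]; have C0 := lip_bounded_ge0 hC; have [hC1 hC2] := hC.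
have cphi l : continuous (fun y : R => h i (upd l i y)).
  by apply: blip_upd_continuous; exists C.
exists (C * M + C); split=> [l|l l'].
  have /andP[c0 cM] := clamp_itv (l i).
  apply: (@le_trans _ _ (C * (M - clamp (l i)))).
    exact: Rintegral_itv_bound.
  by rewrite ler_wpDr// ler_wpM2l// gerBl.
rewrite /tail_integral.
wlog cc : l l' / clamp (l i) <= clamp (l' i).
  move=> H; have [/H//|/ltW/H] := leP (clamp (l i)) (clamp (l' i)).
  rewrite distrC; move=> /le_trans; apply; rewrite le_eqVlt; apply/predU1l.
  by congr (_ * _); rewrite /l1dist; apply: eq_bigr => k _; rewrite distrC.
have /andP[c0 _] := clamp_itv (l i); have /andP[c0' cM'] := clamp_itv (l' i).
rewrite (@Rintegral_itv_split _ _ (clamp (l i)) (clamp (l' i)) M)//.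
rewrite -addrA; apply: le_trans (ler_normD _ _) _.
rewrite mulrDl [leLHS]addrC; apply: lerD.
  rewrite -RintegralB//; try exact: continuous_itv_integrable.
  apply: (@le_trans _ _ (C * l1dist l l' * (M - clamp (l' i)))).
    apply: Rintegral_itv_bound => //.
      by move=> y; apply: cvgB; exact: cphi.
    move=> y _; apply: le_trans (hC2 _ _) _.
    by rewrite ler_wpM2l// l1dist_upd2.
  rewrite -mulrA (mulrC (l1dist _ _)) mulrA ler_wpM2r ?l1dist_ge0//.
  by rewrite ler_wpM2l// gerBl.
apply: (@le_trans _ _ (C * (clamp (l' i) - clamp (l i)))).
  exact: Rintegral_itv_bound.
rewrite ler_wpM2l// (le_trans (ler_norm _))// distrC.
exact: le_trans (clamp_lip _ _) (ler_l1dist _ _ _).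
Qed.

(* An exponential weight in the clamped total local time makes the integral
   operator contracting; this replaces the factorial bounds of Picard's
   iteration. *)
Definition time_weight (lam : R) l : R := expR (- lam * \sum_k clamp (l k)).

(** Raising coordinate [i] from l_i to y multiplies the weight by exp(- lam (y - l_i)), whose
    integral over y is at most 1 / lam. *)
Lemma tail_integral_weight lam A h i : 0 < lam -> blip (h i) ->
  (forall l, `|h i l| <= A * time_weight lam l) ->
  forall l, `|tail_integral h i l| <= A / lam * time_weight lam l.
Proof.
move=> lam0 bh hA l; have A0 : 0 <= A.
  have := le_trans (normr_ge0 _) (hA (fun=> 0)).
  by rewrite pmulr_lge0// expR_gt0.
have /andP[c0 cM] := clamp_itv (l i).
pose S := \sum_(k | k != i) clamp (l k).
have cphi : continuous (fun y : R => h i (upd l i y)).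
  exact: blip_upd_continuous.
pose F (y : R) := - (A * expR (- lam * S) / lam * expR (- lam * y)).
pose f (y : R) := A * expR (- lam * S) * expR (- lam * y).
have cf : continuous f.
  move=> y; apply: cvgMr; apply: continuous_comp; last exact: continuous_expR.
  by apply: cvgMr; exact: cvg_id.
have dF (x : R) : is_derive x 1 F (f x).
  rewrite /F /f; apply: is_derive_eq.
  rewrite /GRing.scale/=; field; exact: lt0r_neq0.
have fE y : 0 <= y <= M -> A * time_weight lam (upd l i y) = f y.
  move=> yM; rewrite /f /time_weight (bigD1 i)//= upd_same clamp_id//.
  rewrite -mulrA -expRD; congr (_ * expR _).
  rewrite mulrDr addrC; congr (_ * _ + _); apply: eq_bigr => k ki.
  by rewrite /upd (negbTE ki).
apply: le_trans (le_normr_Rintegral _ (continuous_itv_integrable _ _ cphi)) _ => //.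
apply: (@le_trans _ _ (\int[mu]_(y in `[clamp (l i), M]) f y)).
  apply: le_Rintegral => //.
  - by apply: continuous_itv_integrable => x; apply: cvg_norm; exact: cphi.
  - exact: continuous_itv_integrable.
  - move=> y; rewrite /= in_itv/= => /andP[cy yM].
    by rewrite -fE ?hA// yM (le_trans c0).
rewrite /Rintegral (FTC2 dF cf)//= /F opprK addrC.
apply: le_trans (_ : A * expR (- lam * S) / lam * expR (- lam * clamp (l i)) <= _).
  by rewrite gerBl// !mulr_ge0 ?expR_ge0// invr_ge0 ltW.
rewrite le_eqVlt; apply/predU1l.
rewrite /time_weight (bigD1 i)//= -/S mulrDr expRD; field; exact: lt0r_neq0.
Qed.

Let D : R := \sum_i \sum_j 2 * M * `|beta i j|.

Lemma jump_weight A lam h i : (forall j l, `|h j l| <= A * time_weight lam l) ->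
  forall l, `|jump h i l| <= A * D * time_weight lam l.
Proof.
move=> hA l; set w := time_weight lam l.
have A0 : 0 <= A * w by apply: le_trans (hA i l).
apply: le_trans (ler_norm_sum _ _ _) _.
apply: (@le_trans _ _ (\sum_j 2 * M * `|beta i j| * (A * w))); last first.
  rewrite -mulr_suml (_ : A * D * w = D * (A * w)); last by ring.
  apply: ler_wpM2r => //; rewrite /D [leRHS](bigD1 i)//= lerDl.
  by do 2 apply: sumr_ge0 => ? _; rewrite !mulr_ge0// ltW.
apply: ler_sum => j _; rewrite !normrM.
have -> : 2 * M * `|beta i j| * (A * w) = `|beta i j| * M * (2 * (A * w)) by ring.
apply: ler_pM; rewrite ?mulr_ge0//.
  by rewrite ler_wpM2l// ger0_norm; have /andP[] := clamp_itv (l j).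
by rewrite mulr_natl mulr2n (le_trans (ler_normB _ _))// lerD.
Qed.

Fixpoint picard_iter q (k : nat) : L -> (L -> R) -> R :=
  if k is k'.+1 then tail_integral (jump (picard_iter q k')) else tail_integral q.

Lemma blip_picard_iter q (k : nat) i : (forall j, blip (q j)) -> blip (picard_iter q k i).
Proof.
move=> bq; elim: k i => [|k IH] i /=; first exact: blip_tail_integral.
by apply: blip_tail_integral; exact: blip_jump.
Qed.

Lemma vanishes_picard_iter q k m n : m <= M ->
  vanishes_above k m q -> vanishes_above k m (picard_iter q n).
Proof.
move=> mM qv; elim: n => [|n IH] /=; first exact: vanishes_tail_integral.
by apply: vanishes_tail_integral => //; exact: vanishes_jump.
Qed.

(** In the weighted norm [jump] costs a factor [D] and [tail_integral] gains [1 / lam], so one round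
    halves the norm. *)
Lemma jump_picard_iter_le q : (forall i, blip (q i)) -> exists A, forall n i l,
  `|jump (picard_iter q n) i l| <= A * 2^-1 ^+ n.
Proof.
move=> /[dup] bq /blip_family[Q qQ].
have D0 : 0 <= D by do 2 apply: sumr_ge0 => ? _; rewrite !mulr_ge0// ltW.
(* [D / lam < 1 / 2]; the added 1 keeps [lam] positive when [D = 0]. *)
pose lam := 2 * D + 1; have lam0 : 0 < lam by rewrite /lam ltr_wpDl// mulr_ge0.
(* The exponential is the largest value of the inverse weight, as clamped local times are at most
   [M]. *)
pose A0 := Q * expR (lam * \sum_(k : L) M).
have w1 l : time_weight lam l <= 1.
  rewrite /time_weight -expR0 ler_expR mulNr oppr_le0; apply: mulr_ge0; first exact: ltW.
  by apply: sumr_ge0 => k _; have /andP[] := clamp_itv (l k).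
have q0 i l : `|q i l| <= A0 * time_weight lam l.
  have [q1 _] := qQ i; apply: (le_trans (q1 l)).
  have Q0 := lip_bounded_ge0 (qQ i).
  rewrite /A0 /time_weight -mulrA -expRD ler_peMr// -expR0 ler_expR.
  rewrite mulNr subr_ge0; apply: ler_wpM2l; first exact: ltW.
  apply: ler_sum => k _.
  by have /andP[] := clamp_itv (l k).
have step n i l : `|picard_iter q n i l| <= A0 / lam * 2^-1 ^+ n * time_weight lam l.
  elim: n i l => [|n IH] i l.
    by rewrite expr0 mulr1; apply: tail_integral_weight.
  have -> : A0 / lam * 2^-1 ^+ n.+1 = (A0 / lam * 2^-1 ^+ n / 2 * lam) / lam.
    by rewrite exprSr; field; exact: lt0r_neq0.
  apply: tail_integral_weight => //.
    by apply: blip_jump => j; exact: blip_picard_iter.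
  move=> {}l; apply: le_trans (jump_weight _ IH l) _.
  have X0 : 0 <= A0 / lam * 2^-1 ^+ n * time_weight lam l.
    exact: le_trans (IH i l).
  rewrite mulrAC [leRHS](_ : _ = A0 / lam * 2^-1 ^+ n * time_weight lam l * (lam / 2)); last by ring.
  by rewrite ler_wpM2l// /lam; lra.
exists (A0 / lam * D) => n i l; apply: le_trans (jump_weight _ (step n) l) _.
have X0 : 0 <= A0 / lam * 2^-1 ^+ n * D.
  rewrite mulr_ge0//; have := le_trans (normr_ge0 _) (step n i l).
  by rewrite pmulr_lge0// expR_gt0.
by rewrite [leRHS]mulrAC ler_piMr.
Qed.

(* An approximate solution [F], with error [eps], of [generator F = - q], where
   [F' i] is the derivative of [F i] in direction [i]. *)
Definition poisson_solution q (eps : R) (F F' : L -> (L -> R) -> R) : Prop :=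
  [/\ forall i, blip (F i), forall i, blip (F' i),
      forall k m, m <= M -> vanishes_above k m q ->
        vanishes_above k m F /\ vanishes_above k m F',
      exists C, forall i l s t, 0 <= s -> 0 <= t ->
        `|F i (upd l i t) - F i (upd l i s) - (t - s) * F' i (upd l i s)|
        <= C * (t - s) ^+ 2 &
      forall i l, (forall k, 0 <= l k) ->
        `|F' i l + \sum_j beta i j * l j * (F j l - F i l) + q i l| <= eps].

(** A finite Picard sum suffices: the derivative of each term cancels the jump part of the preceding
    one, and only the jump part of the last term is left as error. *)
Lemma poisson_approx q (eps : R) : (forall i, blip (q i)) ->
  (forall k, vanishes_above k M q) -> 0 < eps ->
  exists F F', poisson_solution q eps F F'.
Proof.
move=> bq qv eps0; have [A HA] := jump_picard_iter_le bq.
have [n An] : exists n, `|A| * 2^-1 ^+ n <= eps.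
  have : `|A| * 2^-1 ^+ n @[n --> \oo] --> `|A| * 0.
    by apply: cvgMr; apply: cvg_expr; rewrite ger0_norm; lra.
  rewrite mulr0 => /cvgr0_norm_le /(_ _ eps0) [n _ H]; exists n.
  by have := H n (leqnn _); rewrite normrM normr_id ger0_norm// exprn_ge0.
pose p := picard_iter q.
pose F i l := \sum_(0 <= k < n.+1) p k i l.
(* The sum stops one short of that in [F]: [p 0] contributes [- q] and [p k.+1] contributes
   [- jump (p k)]. *)
pose F' i l := - q i l - \sum_(0 <= k < n) jump (p k) i l.
have bp (k : nat) i : blip (p k i) by exact: blip_picard_iter.
exists F, F'; split.
- by move=> i; apply: blip_sum.
- move=> i; apply: blipB; first exact: blipN.
  by apply: blip_sum => k; exact: blip_jump.
- move=> k m mM qkm; have pv j := vanishes_picard_iter j mM qkm.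
  split=> i l ml; first by rewrite /F big1_seq// => j _; exact: pv.
  rewrite /F' qkm// oppr0 sub0r big1_seq ?oppr0// => j _.
  exact: (vanishes_jump (pv j)).
- pose h (k : nat) : L -> (L -> R) -> R := if k is k'.+1 then jump (p k') else q.
  have pE (k : nat) : p k = tail_integral (h k) by case: k.
  have bh (k : nat) i : blip (h k i) by case: k => //= k; exact: blip_jump.
  have hv (k : nat) i : vanishes_above i M (h k).
    case: k => //= k; apply: vanishes_jump.
    by apply: vanishes_picard_iter.
  have F'E i l : F' i l = - \sum_(0 <= k < n.+1) h k i l.
    by rewrite big_nat_recl//= opprD.
  have [C HC] := blip_family (fun ki : 'I_n.+1 * L => bh ki.1 ki.2).
  exists (\sum_(0 <= k < n.+1) 2 * C) => i l s t s0 t0.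
  rewrite F'E mulrN opprK mulr_sumr -sumrB -big_split/= mulr_suml.
  apply: le_trans (ler_norm_sum _ _ _) _.
  rewrite [leLHS]big_nat [leRHS]big_nat; apply: ler_sum => k /andP[_ kn].
  rewrite pE; apply: tail_integral_quadratic => //.
  exact: (HC (Ordinal kn, i)).
- move=> i l l0.
  have -> : F' i l + \sum_j beta i j * l j * (F j l - F i l) + q i l = jump (p n) i l.
    have -> : \sum_j beta i j * l j * (F j l - F i l) = jump F i l.
      (* If some local time has reached [M], all the values of [F] are zero and the rates do not
         matter; otherwise [clamp] is the identity on every coordinate. *)
      have [[k Mk]|H] := pselect (exists k, M <= l k).
        have Fv : vanishes_above k M F.
          by move=> ? ? ?; rewrite /F big1_seq// => ? _; exact: (vanishes_picard_iter _ (lexx M) (qv k)).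
        rewrite (vanishes_jump Fv i Mk) big1// => j _.
        by rewrite !(Fv _ _ Mk) subrr mulr0.
      apply: eq_bigr => j _; rewrite clamp_id// l0 /= leNgt; apply/negP => /ltW Mj.
      by apply: H; exists j.
    have -> : jump F i l = \sum_(0 <= k < n.+1) jump (p k) i l.
      rewrite exchange_big; apply: eq_bigr => j _ /=.
      by rewrite -mulr_sumr sumrB.
    by rewrite big_nat_recr//= /F'; ring.
  apply: le_trans (HA n i l) _; apply: le_trans An.
  by rewrite ler_wpM2r ?ler_norm// exprn_ge0.
Qed.

End picard.

(** * Occupation times *)

(** The sublevel set is a countable union over rational points r: [F r + C * l1dist (Z x) r]
    dominates [F (Z x)] and comes arbitrarily close to it. Only the coordinates of [Z] need to be
    measurable. *)
Lemma blip_measurable {R : realType} {L : finType} d (T : measurableType d)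
    (Z : T -> L -> R) (F : (L -> R) -> R) : blip F ->
  (forall k, measurable_fun setT (fun x => Z x k)) ->
  measurable_fun setT (fun x => F (Z x)).
Proof.
move=> [C FC] mZ; have C0 := lip_bounded_ge0 FC; have [_ F2] := FC.
apply: (measurability _ (RGenInftyO.measurableE R)) => //.
move=> _ [_ [c ->] <-].
pose G (r : {ffun L -> rat}) x : R :=
  F (fun k => ratr (r k)) + C * l1dist (Z x) (fun k => ratr (r k)).
pose A r := setT `&` (G r @^-1` `]-oo, c[%classic).
have mA r : measurable (A r).
  have mG : measurable_fun setT (G r).
    apply: measurable_funD => //; apply: measurable_funM => //.
    apply: measurable_sum => k; apply: measurableT_comp => //.
    exact: measurable_funB.
  by apply: mG => //; exact: measurable_itv.
rewrite [X in measurable X](_ : _ =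
    \bigcup_n (if unpickle n is Some r then A r else set0)).
  by apply: bigcupT_measurable => n; case: unpickle.
apply/seteqP; split=> [x [_]|x [n _]].
- rewrite /= in_itv/= => Fc.
  pose N : R := #|L|%:R; have N0 : 0 <= N by rewrite ler0n.
  have den0 : 0 < 2 * C * N + 1 by rewrite ltr_wpDl// !mulr_ge0.
  (* The Lipschitz error [C * e * N] occurs twice, in comparing the values of [F] and in the added
     distance term. *)
  pose e := (c - F (Z x)) / (2 * C * N + 1).
  have e0 : 0 < e by rewrite divr_gt0// subr_gt0.
  have /choice[r rP] : forall k, exists q : rat, `|Z x k - ratr q| <= e.
    move=> k; have [q] := @rat_in_itvoo R (Z x k) (Z x k + e) (ltac:(by rewrite ltrDl)).
    rewrite in_itv/= => /andP[q1 q2]; exists q.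
    by rewrite ltr0_norm ?subr_lt0//; lra.
  have dr : l1dist (Z x) (fun k => ratr (r k)) <= e * N.
    apply: le_trans (ler_sum _ (fun k _ => rP k)) _.
    by rewrite sumr_const -mulr_natr.
  exists (pickle (finfun r)) => //; rewrite pickleK; split => //=.
  have Er : (fun k => ratr (finfun r k) : R) = (fun k => ratr (r k)).
    by apply/funext => k; rewrite ffunE.
  rewrite /G Er in_itv/=.
  have := le_trans (ler_norm _) (F2 (fun k => ratr (r k)) (Z x)).
  have -> : l1dist (fun k => ratr (r k)) (Z x) = l1dist (Z x) (fun k => ratr (r k)).
    by apply: eq_bigr => k _; rewrite distrC.
  have : C * l1dist (Z x) (fun k => ratr (r k)) <= C * (e * N) by rewrite ler_wpM2l.
  have : 2 * C * (e * N) < c - F (Z x).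
    have -> : c - F (Z x) = e * (2 * C * N + 1) by rewrite divfK// lt0r_neq0.
    by rewrite mulrDr mulr1; lra.
  lra.
- case: (unpickle n) => // r [_]; rewrite /= !in_itv/= /G => Gc; split => //.
  have := le_trans (ler_norm _) (F2 (Z x) (fun k => ratr (r k))); lra.
Qed.

Section occupation.
Context {R : realType} {L : finType} d (Omega : measurableType d).
Notation mu := (@lebesgue_measure R).
Variables (X : R -> Omega -> L) (T : R).
Hypothesis X_measurable : forall s i, 0 <= s <= T ->
  measurable (X s @^-1` [set i]).
Hypothesis X_right_continuous : forall w s, 0 <= s ->
  \forall r \near s^'+, X r w = X s w.

Lemma measurable_indic_fst (A : set R) : measurable A ->
  measurable_fun setT (fun p : R * Omega => \1_A p.1 : R).
Proof.
move=> mA; apply: (measurableT_comp (f := \1_A : R -> R)) => //.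
Qed.

(** The cut to [0, T] keeps out the times at which nothing is assumed of [X]. *)
Definition visit i (p : R * Omega) : R :=
  \1_(`[0, T]%classic) p.1 * (X p.1 p.2 == i)%:R.

Lemma measurable_at s i : 0 <= s <= T ->
  measurable_fun setT (fun w => (X s w == i)%:R : R).
Proof.
move=> sT; rewrite (_ : (fun _ => _) = \1_(X s @^-1` [set i])).
  by apply: measurable_indic; exact: X_measurable.
by apply/funext => w; rewrite indicE; case: eqP => XE; [rewrite mem_set|rewrite memNset].
Qed.

(** By right continuity [X] at time s is the limit of [X] sampled at the right end of the grid cell
    containing s. Taking the minimum with [T] makes the approximation use only times up to [T], so
    the result also holds for the sigma-algebra of the past. *)
Lemma measurable_visit i : measurable_fun setT (visit i).
Proof.
have [T0|T0] := ltP T 0.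
  rewrite (_ : visit i = fun=> 0)//; apply/funext => p; rewrite /visit indicE.
  rewrite memNset ?mul0r//= in_itv/= => /andP[p0 pT].
  by have := le_lt_trans (le_trans p0 pT) T0; rewrite ltxx.
pose s_ n k : R := Num.min T (k.+1%:R / n.+1%:R).
pose h n (p : R * Omega) : R := \sum_(0 <= k < (Num.truncn (n.+1%:R * T)).+1)
  \1_(`[k%:R / n.+1%:R, k.+1%:R / n.+1%:R[%classic) p.1 *
  (\1_(`[0, T]%classic) p.1 * (X (s_ n k) p.2 == i)%:R).
have s_itv n k : 0 <= s_ n k <= T.
  by rewrite /s_ ge_min lexx /= andbT le_min T0 divr_ge0.
apply: (@measurable_fun_cvg _ _ _ _ h) => [n|[s w] _].
  apply: measurable_sum => k; apply: measurable_funM.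
    by apply: measurable_indic_fst; exact: measurable_itv.
  apply: measurable_funM.
    by apply: measurable_indic_fst; exact: measurable_itv.
  exact: (measurableT_comp (measurable_at _ (s_itv n k)) measurable_snd).
rewrite /visit /=; have [sT|sT] := boolP (s \in `[0, T]); last first.
  have -> : \1_(`[0, T]%classic) s = 0 :> R by rewrite indicE memNset//; exact/negP.
  rewrite mul0r (_ : h ^~ _ = fun=> 0); first exact: cvg_cst.
  apply/funext => n; rewrite /h big1// => k _ /=.
  have -> : \1_(`[0, T]%classic) s = 0 :> R by rewrite indicE memNset//; exact/negP.
  by rewrite mul0r mulr0.
move: (sT); rewrite in_itv/= => /andP[s0 s1].
rewrite indicE mem_set// mul1r.
have hE n : h n (s, w) = (X (s_ n (Num.truncn (n.+1%:R * s))) w == i)%:R.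
  have n0 : 0 < n.+1%:R :> R by [].
  have ns0 : 0 <= n.+1%:R * s by rewrite mulr_ge0.
  rewrite /h (bigD1_seq (Num.truncn (n.+1%:R * s))) ?iota_uniq//=; last first.
    by rewrite mem_index_iota/= ltnS le_truncn// ler_pM2l.
  rewrite big1 ?addr0 => [|k kN].
    rewrite !indicE !mem_set ?mul1r//= in_itv/=.
    by rewrite ler_pdivrMr// ltr_pdivlMr// ![s * _]mulrC truncn_itv.
  rewrite indicE memNset ?mul0r//= in_itv/= => /andP[].
  rewrite ler_pdivrMr// ltr_pdivlMr// ![s * _]mulrC => k1 k2.
  by move/eqP : kN; apply; rewrite (truncn_def (n := k)) ?k1.
under eq_cvg do rewrite hE.
(* At s = T every sampled time is T itself; for s < T the sampled time lies strictly after s and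
   within one cell of it. *)
move: s1; rewrite le_eqVlt => /predU1P[sE|sltT].
  apply: cvg_near_cst; apply: nearW => n; congr ((X _ w == i)%:R).
  rewrite /s_ min_l//.
  rewrite -sE ler_pdivlMr// mulrC.
  by have /andP[_ /ltW] := truncn_itv (mulr_ge0 (ler0n R n.+1) s0).
apply: cvg_near_cst.
have [e /= e0 eP] := X_right_continuous w s0.
near=> n.
have n0 : 0 < n.+1%:R :> R by [].
have /andP[k1 k2] := truncn_itv (mulr_ge0 (ler0n R n.+1) s0).
have ss : s < s_ n (Num.truncn (n.+1%:R * s)).
  by rewrite lt_min sltT/= ltr_pdivlMr// mulrC.
rewrite eP//= ltr0_norm ?subr_lt0// opprB ltrBlDl gt_min; apply/orP; right.
apply: (@le_lt_trans _ _ (s + n.+1%:R^-1)).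
  rewrite ler_pdivrMr// mulrDl mulVf ?lt0r_neq0// -natr1 mulrC.
  by rewrite lerD2r mulrC.
rewrite ltrD2l; near: n; exact: (near_infty_natSinv_lt (PosNum e0)).
Unshelve. all: by end_near. Qed.

Definition occ i s t w : R := \int[mu]_(r in `[s, t]) (X r w == i)%:R.

Section itv.
Variables (s t : R).
Hypotheses (s_ge0 : 0 <= s) (t_le : t <= T).

Lemma integrable_at i w : mu.-integrable `[s, t] (EFin \o (fun r => (X r w == i)%:R : R)).
Proof.
apply: (@bounded_on_integrable _ _ _ _ _ _ 1) => //.
- exact: lebesgue_itv_fin.
- apply: (@eq_measurable_fun _ _ _ _ _ (fun r => visit i (r, w))).
    move=> r; rewrite inE/= in_itv/= => /andP[sr rt].
    rewrite /visit/= indicE mem_set ?mul1r//= in_itv/=.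
    by rewrite (le_trans s_ge0)//= (le_trans rt).
  apply: measurable_funTS; apply: (measurableT_comp (measurable_visit i)).
  exact: measurable_pair2.
- by move=> r _; rewrite ger0_norm// lern1 leq_b1.
Qed.

Lemma occE i w : (occ i s t w)%:E = (\int[mu]_(r in `[s, t]) ((X r w == i)%:R)%:E)%E.
Proof. by rewrite /occ /Rintegral fineK//; exact: integrable_fin_num (integrable_at i w). Qed.

Lemma occEvisit i w :
  (occ i s t w)%:E = (\int[mu]_r (\1_(`[s, t]%classic) r * visit i (r, w))%:E)%E.
Proof.
rewrite occE integral_mkcond; apply: eq_integral => r _.
rewrite patchE indicE; case: ifPn => rst; last by rewrite mul0r.
rewrite mul1r /visit indicE/= mem_set ?mul1r//.
move: rst; rewrite inE/= !in_itv/= => /andP[sr rt].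
by rewrite (le_trans s_ge0)//= (le_trans rt).
Qed.

Lemma measurable_occ i : measurable_fun setT (occ i s t).
Proof.
apply/measurable_EFinP.
rewrite (_ : _ \o _ = fubini_G mu (fun p => (\1_(`[s, t]%classic) p.1 * visit i p)%:E)).
  apply: measurable_fun_fubini_tonelli_G.
    apply/measurable_EFinP; apply: measurable_funM; last exact: measurable_visit.
    by apply: measurable_indic_fst; exact: measurable_itv.
  by move=> p; rewrite lee_fin !mulr_ge0// indicE.
by apply/funext => w /=; rewrite occEvisit /fubini_G.
Qed.

Lemma occ_ge0 i w : 0 <= occ i s t w.
Proof. by apply: Rintegral_ge0 => r _. Qed.

Lemma occ_sum w : s <= t -> \sum_i occ i s t w = t - s.
Proof.
move=> st; apply: EFin_inj; rewrite -sumEFin.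
under eq_bigr do rewrite occE.
rewrite -ge0_integral_sum//; last first.
  by move=> i; have /integrableP[] := integrable_at i w.
under eq_integral => r _.
  rewrite sumEFin (bigD1 (X r w))//= eqxx big1 ?addr0 => [|i /negbTE]; last first.
    by rewrite eq_sym => ->.
over.
by rewrite integral_cst// mul1e; exact: lebesgue_itv_cc.
Qed.

End itv.

Lemma occ_split i r s t w : 0 <= r -> r <= s -> s <= t -> t <= T ->
  occ i r t w = occ i r s w + occ i s t w.
Proof.
move=> r0 rs st tT; have irt := integrable_at r0 tT i w.
have := @Rintegral_itvB _ (fun r => (X r w == i)%:R) (BLeft r) (BRight t) s irt.
rewrite !bnd_simp => /(_ rs st).
rewrite Rintegral_itv_obnd_cbnd; last first.
  apply: integrableS (integrable_at (le_trans r0 rs) tT i w) => //.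
  exact: subset_itv_oc_cc.
by rewrite /occ => <-; rewrite addrC subrK.
Qed.

End occupation.

(** * Expectations of bounded random variables *)

Section bounded_measurable.
Context {R : realType} d (Omega : measurableType d) (P : probability Omega R).
Implicit Types f g : Omega -> R.

Definition bounded_rv f := measurable_fun setT f /\ exists C, forall w, `|f w| <= C.

Lemma bounded_rv_integrable f : bounded_rv f -> P.-integrable setT (EFin \o f).
Proof.
move=> [mf [C fC]]; apply: (@bounded_on_integrable _ _ _ _ _ _ C) => //.
exact: le_lt_trans (probability_le1 _ _) (ltry _).
Qed.

Lemma bounded_rv_meanE f : bounded_rv f ->
  (\int[P]_w f w)%:E = (\int[P]_w (f w)%:E)%E.
Proof.
move=> /bounded_rv_integrable fi; rewrite /Rintegral fineK//.
exact: (integrable_fin_num measurableT fi).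
Qed.

Lemma bounded_rv_cst (c : R) : bounded_rv (fun=> c).
Proof. by split => //; exists `|c|. Qed.

Lemma bounded_rvD f g : bounded_rv f -> bounded_rv g ->
  bounded_rv (fun w => f w + g w).
Proof.
move=> [mf [C fC]] [mg [D gD]]; split; first exact: measurable_funD.
by exists (C + D) => w; apply: le_trans (ler_normD _ _) _; exact: lerD.
Qed.

Lemma bounded_rvM f g : bounded_rv f -> bounded_rv g ->
  bounded_rv (fun w => f w * g w).
Proof.
move=> [mf [C fC]] [mg [D gD]]; split; first exact: measurable_funM.
by exists (C * D) => w; rewrite normrM ler_pM.
Qed.

Lemma bounded_rvB f g : bounded_rv f -> bounded_rv g ->
  bounded_rv (fun w => f w - g w).
Proof.
move=> [mf [C fC]] [mg [D gD]]; split; first exact: measurable_funB.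
by exists (C + D) => w; apply: le_trans (ler_normB _ _) _; exact: lerD.
Qed.

Lemma bounded_rv_norm f : bounded_rv f -> bounded_rv (fun w => `|f w|).
Proof.
move=> [mf [C fC]]; split; first exact: measurableT_comp.
by exists C => w; rewrite normr_id.
Qed.

Lemma bounded_rv_sum (I : Type) (r : seq I) (Q : pred I) (F : I -> Omega -> R) :
  (forall i, bounded_rv (F i)) ->
  bounded_rv (fun w => \sum_(i <- r | Q i) F i w).
Proof.
move=> bF; elim: r => [|x r IH].
  by under [X in bounded_rv X]eq_fun do rewrite big_nil; exact: bounded_rv_cst.
under [X in bounded_rv X]eq_fun do rewrite big_cons.
by case: (Q x) => //; exact: bounded_rvD.
Qed.

Lemma bounded_rv_indic (A : set Omega) : measurable A -> bounded_rv (\1_A).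
Proof.
move=> mA; split; first exact: measurable_indic.
by exists 1 => w; rewrite indicE ger0_norm// lern1 leq_b1.
Qed.

Lemma mean_cst (c : R) : \int[P]_w c = c.
Proof. by rewrite Rintegral_cst// [X in fine X]probability_setT mulr1. Qed.

Lemma meanD f g : bounded_rv f -> bounded_rv g ->
  \int[P]_w (f w + g w) = \int[P]_w f w + \int[P]_w g w.
Proof. by move=> bf bg; rewrite RintegralD//; exact: bounded_rv_integrable. Qed.

Lemma meanB f g : bounded_rv f -> bounded_rv g ->
  \int[P]_w (f w - g w) = \int[P]_w f w - \int[P]_w g w.
Proof. by move=> bf bg; rewrite RintegralB//; exact: bounded_rv_integrable. Qed.

Lemma meanZ (c : R) f : bounded_rv f -> \int[P]_w (c * f w) = c * \int[P]_w f w.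
Proof. by move=> bf; rewrite RintegralZl//; exact: bounded_rv_integrable. Qed.

Lemma mean_sum (I : Type) (r : seq I) (Q : pred I) (F : I -> Omega -> R) :
  (forall i, bounded_rv (F i)) ->
  \int[P]_w (\sum_(i <- r | Q i) F i w) = \sum_(i <- r | Q i) \int[P]_w F i w.
Proof.
move=> bF; elim: r => [|x r IH].
  by under eq_Rintegral do rewrite big_nil; rewrite big_nil mean_cst.
under eq_Rintegral do rewrite big_cons.
rewrite big_cons; case: (Q x) => //.
by rewrite meanD ?IH//; exact: bounded_rv_sum.
Qed.

Lemma le_mean f g : bounded_rv f -> bounded_rv g -> (forall w, f w <= g w) ->
  \int[P]_w f w <= \int[P]_w g w.
Proof. by move=> bf bg fg; apply: le_Rintegral => //; exact: bounded_rv_integrable. Qed.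

Lemma mean_norm f g : bounded_rv f -> bounded_rv g -> (forall w, `|f w| <= g w) ->
  `|\int[P]_w f w| <= \int[P]_w g w.
Proof.
move=> bf bg fg; apply: le_trans (le_normr_Rintegral _ (bounded_rv_integrable bf)) _ => //.
by apply: le_mean => //; exact: bounded_rv_norm.
Qed.

Lemma mean_indic (A : set Omega) : measurable A -> \int[P]_w \1_A w = fine (P A).
Proof. by move=> mA; rewrite /Rintegral integral_indic// setIT. Qed.

Lemma mean_on (A : set Omega) f : measurable A ->
  \int[P]_(w in A) f w = \int[P]_w (\1_A w * f w).
Proof.
move=> mA; rewrite Rintegral_mkcond; apply: eq_Rintegral => w _.
by rewrite patchE indicE; case: ifPn; rewrite ?mul1r ?mul0r.
Qed.

End bounded_measurable.

Lemma count_truncn {R : realType} (x : R) (n : nat) : 0 <= x <= n%:R ->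
  \sum_(0 <= k < n) ((k.+1%:R <= x)%R : nat)%:R = (Num.truncn x)%:R :> R.
Proof.
move=> /andP[x0 xn].
have tn : (Num.truncn x <= n)%N.
  by have /andP[tx _] := truncn_itv x0; rewrite -(ler_nat R) (le_trans tx).
rewrite (@big_cat_nat _ _ _ (Num.truncn x))//= [X in X + _](_ : _ = (Num.truncn x)%:R).
  rewrite [X in _ + X]big_nat big1 ?addr0// => k /andP[tk _].
  have /andP[_ xt] := truncn_itv x0.
  by rewrite leNgt (lt_le_trans xt)// ler_nat.
rewrite big_nat (eq_bigr (fun=> 1)) => [|k /andP[_ kt]].
  by rewrite -big_nat sumr_const_nat subn0.
have /andP[tx _] := truncn_itv x0.
by rewrite (le_trans _ tx)// ler_nat.
Qed.

(** * From events of the past to functions of the past *)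

Section uniform_bound.
Context {R : realType} d (Omega : measurableType d) (P : probability Omega R).
Variables (G : set (set Omega)) (Z : Omega -> R) (e : R).
Hypothesis G_measurable : forall A, G A -> measurable A.
Hypothesis bZ : bounded_rv Z.
Hypothesis Z_le : forall A, G A -> `|\int[P]_w (\1_A w * Z w)| <= e.

(* [phi] is within [1/n] of the average of the indicators of the events
   [k + 1 <= n * phi], [k < n]. *)
Lemma mean_uniform01 (phi : Omega -> R) : bounded_rv phi ->
  (forall w, 0 <= phi w <= 1) -> (forall c, G [set w | c <= phi w]) ->
  `|\int[P]_w (phi w * Z w)| <= e.
Proof.
move=> bphi phi01 Gphi; have [mZ [B ZB]] := bZ.
have B0 : 0 <= B by apply: le_trans (ZB point).
apply/ler_addgt0Pr => eps eps0.
(* With this many levels the discretisation error [B / N] is at most [eps]. *)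
pose n := Num.truncn (B / eps); pose N : R := n.+1%:R.
have N0 : 0 < N by [].
have N1 : 0 <= N^-1 by rewrite invr_ge0 ltW.
have BN : B / N <= eps.
  rewrite ler_pdivrMr// mulrC -ler_pdivrMr//.
  by have /andP[_ /ltW] := truncn_itv (divr_ge0 B0 (ltW eps0)).
pose A (k : nat) := [set w | k.+1%:R / N <= phi w].
have mA k : measurable (A k) by exact/G_measurable/Gphi.
pose psi w := N^-1 * \sum_(0 <= k < n.+1) \1_(A k) w.
have bs : bounded_rv (fun w => \sum_(0 <= k < n.+1) \1_(A k) w).
  have := bounded_rv_sum (index_iota 0 n.+1) xpredT (fun k => bounded_rv_indic (mA k)).
  by [].
have bpsi : bounded_rv psi.
  by apply: bounded_rvM => //; exact: bounded_rv_cst.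
have psiE w : psi w = N^-1 * (Num.truncn (N * phi w))%:R.
  have /andP[p0 p1] := phi01 w.
  rewrite /psi -(@count_truncn _ _ n.+1); last first.
    by rewrite mulr_ge0 ?ler0n//= ler_piMr.
  congr (_ * _); apply: eq_bigr => k _; rewrite indicE; congr (_%:R).
  congr nat_of_bool; apply/idP/idP.
    by rewrite inE /A/= ler_pdivrMr// mulrC.
  by move=> ?; rewrite inE /A/= ler_pdivrMr// mulrC.
have close w : `|phi w - psi w| <= N^-1.
  have /andP[p0 p1] := phi01 w.
  have /andP[t1 t2] := truncn_itv (mulr_ge0 (ltW N0) p0).
  rewrite psiE -[phi w](mulKf (lt0r_neq0 N0)) -mulrBr normrM.
  rewrite (ger0_norm N1) ler_piMr//.
  rewrite mulKf ?lt0r_neq0// ger0_norm ?subr_ge0//.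
  by rewrite lerBlDl natr1 ltW.
have I1 : `|\int[P]_w (psi w * Z w)| <= e.
  have -> : \int[P]_w (psi w * Z w) =
      N^-1 * \sum_(0 <= k < n.+1) \int[P]_w (\1_(A k) w * Z w).
    rewrite -mean_sum => [|k]; last by apply: bounded_rvM => //; exact: bounded_rv_indic.
    rewrite -meanZ; last first.
      by apply: bounded_rv_sum => k; apply: bounded_rvM => //; exact: bounded_rv_indic.
    by apply: eq_Rintegral => w _; rewrite /psi -mulrA mulr_suml.
  rewrite normrM (ger0_norm N1) ler_pdivrMl//.
  apply: le_trans (ler_norm_sum _ _ _) _.
  apply: le_trans (ler_sum _ (fun k _ => Z_le (Gphi _))) _.
  by rewrite sumr_const_nat subn0 -mulr_natl.
have -> : \int[P]_w (phi w * Z w) =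
    \int[P]_w (psi w * Z w) + \int[P]_w ((phi w - psi w) * Z w).
  rewrite -meanD; last 2 first.
  - exact: bounded_rvM.
  - by apply: bounded_rvM => //; exact: bounded_rvB.
  by apply: eq_Rintegral => w _; rewrite mulrBl addrC subrK.
apply: le_trans (ler_normD _ _) (lerD I1 _); apply: le_trans BN.
rewrite -[leRHS](mean_cst P); apply: mean_norm => [||w].
- by apply: bounded_rvM => //; exact: bounded_rvB.
- exact: bounded_rv_cst.
- by rewrite normrM mulrC ler_pM.
Qed.

(** With psi = (phi + C) / (2 C), which takes values in [0, 1], one has phi = 2 C psi - C. The
    constant 3 is 2 for psi plus 1 for the constant function. *)
Lemma mean_uniform (phi : Omega -> R) C : 0 < C -> bounded_rv phi ->
  (forall w, `|phi w| <= C) -> (forall c, G [set w | c <= phi w]) ->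
  `|\int[P]_w (phi w * Z w)| <= 3 * C * e.
Proof.
move=> C0 bphi phiC Gphi.
have G2 c : [set w | c <= (2 * C)^-1 * (phi w + C)] = [set w | 2 * C * c - C <= phi w].
  by apply/seteqP; split=> w /=; rewrite ler_pdivlMl ?lerBlDr// mulr_gt0.
have bpC : bounded_rv (fun w => phi w + C).
  by apply: bounded_rvD => //; exact: bounded_rv_cst.
have b1 : bounded_rv (fun w => (2 * C)^-1 * (phi w + C)).
  by apply: bounded_rvM => //; exact: bounded_rv_cst.
have H1 : `|\int[P]_w ((2 * C)^-1 * (phi w + C) * Z w)| <= e.
  apply: mean_uniform01 => // [w|c]; last by rewrite G2.
  have := phiC w; rewrite ler_norml => /andP[p1 p2].
  apply/andP; split; last by rewrite ler_pdivrMl ?mulr_gt0//; lra.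
  by apply: mulr_ge0; [rewrite invr_ge0 mulr_ge0// ltW|lra].
have H2 : `|\int[P]_w Z w| <= e.
  have -> : \int[P]_w Z w = \int[P]_w (1 * Z w).
    by apply: eq_Rintegral => w _; rewrite mul1r.
  apply: mean_uniform01 => [||c]; first exact: bounded_rv_cst.
    by move=> w; rewrite ler01 lexx.
  (* The level sets of the constant 1 are the whole space and the empty set. Both are level sets of
     [phi], at [- C] and [C + 1], so no closure property of [G] is called for. *)
  have [c1|c1] := leP c 1.
    rewrite (_ : mkset _ = [set w | - C <= phi w]) //.
    by apply/seteqP; split=> w //= _; have := phiC w; rewrite ler_norml => /andP[].
  rewrite (_ : mkset _ = [set w | C + 1 <= phi w]) //.
  apply/seteqP; split=> w //= h.
  have := le_trans h (le_trans (ler_norm _) (phiC w)); rewrite gerDl; lra.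
have -> : \int[P]_w (phi w * Z w) =
    2 * C * \int[P]_w ((2 * C)^-1 * (phi w + C) * Z w) - C * \int[P]_w Z w.
  rewrite -!meanZ -?meanB; last 4 first.
  - by apply: bounded_rvM; [exact: bounded_rv_cst|exact: bounded_rvM].
  - by apply: bounded_rvM => //; exact: bounded_rv_cst.
  - by [].
  - exact: bounded_rvM.
  apply: eq_Rintegral => w _; field; exact: lt0r_neq0.
apply: le_trans (ler_normB _ _) _; rewrite !normrM !(ger0_norm (ltW C0)) ger0_norm//.
have := ler_wpM2l (ltW C0) H1; have := ler_wpM2l (ltW C0) H2; lra.
Qed.

End uniform_bound.

(** * Dynkin's formula for the VRJP *)

Section vrjp_local_time.
Context {R : realType} {L : finType} d (Omega : measurableType d)
  (P : probability Omega R).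
Notation mu := (@lebesgue_measure R).
Variables (beta : L -> L -> R) (v : L) (ell : L -> R) (X : R -> Omega -> L).
Hypothesis V : is_VRJP beta v ell P X.
Hypothesis ell_ge0 : forall i, 0 <= ell i.

Local Notation lt := (local_time X ell).
Local Notation at_ t i w := ((X t w == i)%:R : R).

Let mX (T s : R) i : 0 <= s <= T -> measurable (X s @^-1` [set i]).
Proof. by case/andP=> s0 _; exact: vrjp_measurable V _ i s0. Qed.

Let rcX := vrjp_right_continuous V.

Lemma local_time_sub i s t w : 0 <= s -> s <= t ->
  lt t w i = lt s w i + occ X i s t w.
Proof.
move=> s0 st; rewrite /local_time -addrA; congr (_ + _).
exact: (@occ_split _ _ _ _ _ t (mX (T := t)) rcX).
Qed.

Lemma occ_sumE s t w : 0 <= s -> s <= t -> \sum_i occ X i s t w = t - s.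
Proof. by move=> s0 st; exact: (@occ_sum _ _ _ _ _ t (mX (T := t)) rcX). Qed.

Lemma occ_le i s t w : 0 <= s -> s <= t -> occ X i s t w <= t - s.
Proof.
move=> s0 st; rewrite -(occ_sumE w s0 st) (bigD1 i)//= lerDl.
by apply: sumr_ge0 => k _; exact: occ_ge0.
Qed.

Lemma local_time0 w : lt 0 w = ell.
Proof.
apply/funext => i; rewrite /local_time set_itv1 Rintegral_set1.
by rewrite addr0.
Qed.

Lemma local_time_dist s t w : 0 <= s -> s <= t -> l1dist (lt t w) (lt s w) = t - s.
Proof.
move=> s0 st; rewrite -(occ_sumE w s0 st); apply: eq_bigr => i _.
by rewrite (local_time_sub _ _ s0 st) addrC addKr ger0_norm// occ_ge0.
Qed.

Lemma local_time_ge i t w : 0 <= t -> ell i <= lt t w i.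
Proof. by move=> t0; rewrite lerDl; apply: occ_ge0. Qed.

Lemma local_time_ge0 i t w : 0 <= t -> 0 <= lt t w i.
Proof. by move=> t0; apply: le_trans (ell_ge0 i) (local_time_ge _ _ t0). Qed.

Lemma local_time_le i t w : 0 <= t -> lt t w i <= ell i + t.
Proof. by move=> t0; rewrite lerD2l -[leRHS]subr0; exact: occ_le. Qed.

Lemma local_time_total t w : 0 <= t -> \sum_i lt t w i = \sum_i ell i + t.
Proof.
move=> t0; rewrite /local_time big_split/=; congr (_ + _).
by rewrite -[RHS]subr0; exact: occ_sumE.
Qed.

Lemma bounded_at t i : 0 <= t -> bounded_rv (fun w => at_ t i w).
Proof.
move=> t0; split.
  by apply: (@measurable_at _ _ _ _ X t (mX (T := t))); rewrite t0 lexx.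
by exists 1 => w; rewrite ger0_norm// lern1 leq_b1.
Qed.

Lemma measurable_local_time t i : 0 <= t ->
  measurable_fun setT (fun w => lt t w i).
Proof.
move=> t0; apply: measurable_funD => //.
exact: (@measurable_occ _ _ _ _ X t (mX (T := t)) rcX).
Qed.

Lemma bounded_local_time t i : 0 <= t -> bounded_rv (fun w => lt t w i).
Proof.
move=> t0; split; first exact: measurable_local_time.
by exists (ell i + t) => w; rewrite ger0_norm ?local_time_ge0// local_time_le.
Qed.

Lemma bounded_occ s t i : 0 <= s -> s <= t -> bounded_rv (fun w => occ X i s t w).
Proof.
move=> s0 st; split.
  exact: (@measurable_occ _ _ _ _ X t (mX (T := t)) rcX s t).
by exists (t - s) => w; rewrite ger0_norm ?occ_ge0// occ_le.
Qed.

Lemma bounded_blip t F : 0 <= t -> blip F -> bounded_rv (fun w => F (lt t w)).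
Proof.
move=> t0 bF; split; last by have [C [F1 _]] := bF; exists C.
by apply: blip_measurable => // k; exact: measurable_local_time.
Qed.

(** The results on occupation times are applied to [Omega] carrying only the sigma-algebra generated
    by [X] up to [t]; this is why they ask for measurability of [X s] on [0, T] alone. *)
Lemma past_blip t F (c : R) : 0 <= t -> blip F -> past X t [set w | c <= F (lt t w)].
Proof.
move=> t0 bF; set G := [set A | exists s i, 0 <= s <= t /\ A = X s @^-1` [set i]].
have mX' s i : 0 <= s <= t ->
    measurable (X s @^-1` [set i] : set (g_sigma_algebraType G)).
  by move=> st; apply: sub_sigma_algebra; exists s, i.
have mF : measurable_fun [set: g_sigma_algebraType G] (fun w => F (lt t w)).
  apply: blip_measurable => // k; apply: measurable_funD => //.
  exact: (@measurable_occ _ _ _ (g_sigma_algebraType G) X t mX' rcX).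
have := mF measurableT `[c, +oo[%classic (measurable_itv _).
rewrite setTI; congr (past X t _).
by apply/seteqP; split=> w /=; rewrite in_itv/= andbT.
Qed.

Lemma past_measurable t A : 0 <= t -> past X t A -> measurable A.
Proof.
move=> t0; apply: (smallest_sub (sigma_algebra_measurable _)).
by move=> _ [s [i [st ->]]]; exact: mX st.
Qed.

(** By Tonelli the left-hand side is the integral over r in [s, t] of the means bounded by [K]. *)
Lemma mean_mul_occ_le (U : Omega -> R) j s t (K : R) : 0 <= s -> s <= t ->
  bounded_rv U -> (forall w, 0 <= U w) -> 0 <= K ->
  (forall r, s <= r <= t -> \int[P]_w (U w * at_ r j w) <= K) ->
  \int[P]_w (U w * occ X j s t w) <= K * (t - s).
Proof.
move=> s0 st bU U0 K0 UK.
pose f (p : R * Omega) : \bar R :=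
  (U p.2 * (\1_(`[s, t]%classic) p.1 * visit X t j p))%:E.
have mf : measurable_fun setT f.
  apply/measurable_EFinP; apply: measurable_funM.
    by apply: measurableT_comp => //; have [] := bU.
  apply: measurable_funM; last exact: measurable_visit (mX (T := t)) rcX j.
  by apply: measurable_indic_fst; exact: measurable_itv.
have f0 p : (0 <= f p)%E by rewrite lee_fin !mulr_ge0// indicE.
rewrite -lee_fin; have bUo := bounded_rvM bU (bounded_occ j s0 st).
rewrite (bounded_rv_meanE P bUo).
rewrite (_ : (\int[P]_w _)%E = (\int[P]_w (fubini_G mu f w))%E); last first.
  apply: eq_integral => w _; rewrite /fubini_G /f EFinM.
  rewrite (@occEvisit _ _ _ _ X t (mX (T := t)) rcX)//.
  rewrite -ge0_integralZl//.
  - apply/measurable_EFinP; apply: measurable_funM.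
      by apply: measurable_indic; exact: measurable_itv.
    apply: (measurableT_comp (measurable_visit (mX (T := t)) rcX j)).
    exact: measurable_pair2.
  - by move=> r _; rewrite lee_fin mulr_ge0// ?mulr_ge0// indicE.
  - by rewrite lee_fin.
rewrite -(@fubini_tonelli _ _ _ _ _ mu P)//.
rewrite (_ : (K * (t - s))%:E = (\int[mu]_(r in `[s, t]) K%:E)%E); last first.
  by rewrite integral_cst// [X in (_ * X)%E]lebesgue_itv_cc.
rewrite [leRHS]integral_mkcond; apply: ge0_le_integral => //.
- by move=> r _; apply: integral_ge0 => w _; exact: f0.
- exact: measurable_fun_fubini_tonelli_F.
- by apply/measurable_restrict => //; exact: measurable_cst.
move=> r _; rewrite /fubini_F patchE; case: ifPn => [|rst].
  rewrite inE/= in_itv/= => rst; have /andP[sr rt] := rst.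
  have r0 := le_trans s0 sr.
  rewrite (_ : (\int[P]_w _)%E = (\int[P]_w (U w * at_ r j w))%:E) ?lee_fin ?UK//.
  have bUr := bounded_rvM bU (bounded_at j r0).
  rewrite (bounded_rv_meanE P bUr).
  apply: eq_integral => w _; rewrite /f /visit /= !indicE !mem_set ?mul1r//=.
  by rewrite in_itv/= r0.
rewrite integral0_eq// => w _; rewrite /f /= indicE memNset ?mul0r ?mulr0//.
by move=> rs; move/negP: rst; apply; rewrite inE.
Qed.

Lemma mem_at t i w : (w \in X t @^-1` [set i]) = (X t w == i).
Proof. by apply/idP/eqP => [|h]; rewrite inE. Qed.

(** Since the threshold in [vrjp_rate] is uniform over events of the past, a single [h0] serves all
    level sets of [F], and [mean_uniform] applies. *)
Lemma vrjp_rate_functional T e : 0 < e -> exists2 h0 : R, 0 < h0 &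
  forall h t i j F C, 0 < h < h0 -> 0 <= t <= T -> i != j -> 0 < C ->
  lip_bounded C F ->
  `|\int[P]_w (F (lt t w) * (at_ t i w * at_ (t + h) j w
      - h * (at_ t i w * (beta i j * lt t w j))))| <= 3 * C * (e * h).
Proof.
move=> e0; have [h0 /= h00 H] := vrjp_rate V T e0; exists h0 => //.
move=> h t i j F C /andP[hp hh0] tT ij C0 FC.
have /andP[t0 _] := tT; have th0 : 0 <= t + h by rewrite addr_ge0// ltW.
have bF : blip F by exists C.
have b1 : bounded_rv (fun w => at_ t i w * at_ (t + h) j w).
  by apply: bounded_rvM; exact: bounded_at.
have b2 : bounded_rv (fun w => beta i j * lt t w j).
  by apply: bounded_rvM; [exact: bounded_rv_cst|exact: bounded_local_time].
have b3 : bounded_rv (fun w => at_ t i w * (beta i j * lt t w j)).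
  by apply: bounded_rvM => //; exact: bounded_at.
have b4 : bounded_rv (fun w => h * (at_ t i w * (beta i j * lt t w j))).
  by apply: bounded_rvM => //; exact: bounded_rv_cst.
apply: (mean_uniform (G := past X t)) => //.
- by move=> A; exact: past_measurable.
- exact: bounded_rvB.
- move=> A pA; have mA := past_measurable t0 pA.
  have bA := bounded_rv_indic mA.
  have mB : measurable (X t @^-1` [set i]) by exact: (vrjp_measurable V).
  have mC : measurable (X (t + h) @^-1` [set j]) by exact: (vrjp_measurable V).
  have := H h _ hp t A i j tT pA ij.
  rewrite /= sub0r normrN gtr0_norm// => /(_ hh0).
  rewrite -(mean_indic P (measurableI _ _ (measurableI _ _ mA mB) mC)).
  rewrite (mean_on P _ (measurableI _ _ mA mB)) -meanZ; last first.
    by apply: bounded_rvM => //; apply: bounded_rv_indic; exact: measurableI.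
  rewrite -meanB; last 2 first.
  - by apply: bounded_rv_indic; apply: measurableI => //; exact: measurableI.
  - apply: bounded_rvM; first exact: bounded_rv_cst.
    by apply: bounded_rvM => //; apply: bounded_rv_indic; exact: measurableI.
  congr (`|_| <= _); apply: eq_Rintegral => w _.
  rewrite !indicE !in_setI !mem_at.
  by case: (w \in A); case: (X t w == i); case: (X (t + h) w == j) => /=; ring.
- exact: bounded_blip.
- by have [F1 _] := FC; move=> w; exact: F1.
- by move=> c; exact: past_blip.
Qed.

Lemma sum_at (x : L) (G : L -> R) : \sum_i (x == i)%:R * G i = G x.
Proof.
rewrite (bigD1 x)//= eqxx mul1r big1 ?addr0// => i /negbTE.
by rewrite eq_sym => ->; rewrite mul0r.
Qed.

Lemma sum_jump (x y : L) (G : L -> L -> R) :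
  \sum_i \sum_(j | j != i) (x == i)%:R * (y == j)%:R * G i j =
  (x != y)%:R * G x y.
Proof.
rewrite (eq_bigr (fun i => (x == i)%:R * \sum_(j | j != i) (y == j)%:R * G i j)).
  rewrite sum_at; have [->|xy] := eqVneq x y.
    by rewrite mul0r big1// => j /negbTE; rewrite eq_sym => ->; rewrite mul0r.
  rewrite mul1r (bigD1 y)/=; last by rewrite eq_sym.
  rewrite eqxx mul1r big1 ?addr0// => j /andP[_ /negbTE].
  by rewrite eq_sym => ->; rewrite mul0r.
by move=> i _; rewrite mulr_sumr; apply: eq_bigr => j _; rewrite mulrA.
Qed.

(** * Short-time increments and their sum *)

Section increments.
Variables (T : R) (F F' : L -> (L -> R) -> R) (a : L) (qa : (L -> R) -> R).
Variables (C eps : R).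
Hypothesis T_gt0 : 0 < T.
Hypothesis C_gt0 : 0 < C.
Hypothesis F_lip : forall i, lip_bounded C (F i).
Hypothesis F'_lip : forall i, lip_bounded C (F' i).
Hypothesis qa_lip : lip_bounded C qa.
Hypothesis F_quad : forall i l s t, 0 <= s -> 0 <= t ->
  `|F i (upd l i t) - F i (upd l i s) - (t - s) * F' i (upd l i s)|
    <= C * (t - s) ^+ 2.
Hypothesis F_gen : forall i l, (forall k, 0 <= l k) ->
  `|F' i l + \sum_j beta i j * l j * (F j l - F i l) + (i == a)%:R * qa l| <= eps.

(** One step of the process that Dynkin's formula makes a martingale up to the error [eps], with the
    source frozen at the start of the step. *)
Let increment t h w : R := F (X (t + h) w) (lt (t + h) w) - F (X t w) (lt t w)
  + qa (lt t w) * (lt (t + h) w a - lt t w a).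

(** The first-order part of [increment]: a jump at frozen local times, plus a full step of local
    time at the site occupied at time [t]. *)
Let main t h w : R :=
  \sum_i \sum_(j | j != i) at_ t i w * at_ (t + h) j w *
     (F j (lt t w) - F i (lt t w))
  + h * \sum_i at_ t i w * (F' i (lt t w) + (i == a)%:R * qa (lt t w)).

(** [jumped] compares the two ends of the step only, while [away] below is the time spent off the
    starting site; a path may leave and come back, so both enter the error. *)
Let jumped t h w : R := \sum_i \sum_(j | j != i) at_ t i w * at_ (t + h) j w.

Let away t h w : R := \sum_i \sum_(j | j != i) at_ t i w * occ X j t (t + h) w.

(** Three errors: the jump term uses the old local times ([2 * h] if the site has changed), time
    spent away is missed (2 in the motion of [F], 1 in the source), and the quadratic remainder
    gives [h ^+ 2]. *)
Lemma increment_main t h w : 0 <= t -> 0 <= h ->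
  `|increment t h w - main t h w| <=
  C * (2 * h * jumped t h w + 3 * away t h w + h ^+ 2).
Proof.
move=> t0 h0; have tth : t <= t + h by rewrite lerDl.
set x := X t w; set y := X (t + h) w; set l := lt t w; set l' := lt (t + h) w.
have jE : jumped t h w = (x != y)%:R.
  rewrite -[RHS]mulr1 -(sum_jump x y (fun _ _ => 1)); apply: eq_bigr => i _.
  by apply: eq_bigr => j _; rewrite mulr1.
have l'E k : l' k = l k + occ X k t (t + h) w by exact: local_time_sub.
have oS : \sum_k occ X k t (t + h) w = h by rewrite occ_sumE// addrC addKr.
have o0 k : 0 <= occ X k t (t + h) w by exact: occ_ge0.
pose J : R := \sum_(j | j != x) occ X j t (t + h) w.
have JE : occ X x t (t + h) w = h - J.
  by apply/eqP; rewrite eq_sym subr_eq -[X in X == _]oS (bigD1 x).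
have J0 : 0 <= J by exact: sumr_ge0.
have aE : away t h w = J.
  rewrite /away (eq_bigr (fun i => at_ t i w * \sum_(j | j != i) occ X j t (t + h) w)).
    exact: sum_at.
  by move=> i _; rewrite mulr_sumr.
have mE : main t h w = (x != y)%:R * (F y l - F x l) + h * (F' x l + (x == a)%:R * qa l).
  by rewrite /main sum_jump sum_at.
have C0 := ltW C_gt0.
have dl : l1dist l' l = h by rewrite local_time_dist// addrC addKr.
have [Fl1 Fl2] : (forall i l, `|F i l| <= C) /\
    (forall i l l', `|F i l - F i l'| <= C * l1dist l l').
  by split=> i; have [] := F_lip i.
have [q1 q2] := qa_lip.
have B1 : `|(F y l' - F x l') - (x != y)%:R * (F y l - F x l)| <= C * (2 * h * (x != y)%:R).
  have [->|xy] := eqVneq x y; first by rewrite !subrr mul0r !mulr0 subrr normr0.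
  rewrite mul1r mulr1 opprB addrACA -opprB (_ : _ - _ = (F y l' - F y l) - (F x l' - F x l)); last by ring.
  apply: le_trans (ler_normB _ _) _.
  by rewrite mulr_natl mulr2n mulrDr lerD// (le_trans (Fl2 _ _ _))// dl.
(* The path is compared with one staying at [x] for the whole step: the time [J] spent elsewhere is
   counted once at [x] and once at the other sites. *)
have B2 : `|F x l' - F x l - h * F' x l| <= C * (2 * J) + C * h ^+ 2.
  have -> : F x l' - F x l - h * F' x l =
    (F x l' - F x (upd l x (l x + h))) + (F x (upd l x (l x + h)) - F x (upd l x (l x))
       - (l x + h - l x) * F' x (upd l x (l x))).
    by rewrite upd_id; ring.
  apply: le_trans (ler_normD _ _) _; apply: lerD.
    apply: le_trans (Fl2 _ _ _) _; rewrite ler_wpM2l// /l1dist (bigD1 x)//= upd_same.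
    rewrite l'E JE; have -> : l x + (h - J) - (l x + h) = - J by ring.
    rewrite normrN ger0_norm// mulr_natl mulr2n lerD2l ler_sum// => k kx.
    by rewrite /upd (negbTE kx) l'E addrC addKr ger0_norm.
  have -> : C * h ^+ 2 = C * (l x + h - l x) ^+ 2 by congr (_ * _ ^+ 2); ring.
  have lx0 : 0 <= l x by exact: local_time_ge0.
  exact: (F_quad x l lx0 (addr_ge0 lx0 h0)).
have B3 : `|qa l * (l' a - l a) - h * ((x == a)%:R * qa l)| <= C * J.
  rewrite l'E (_ : l a + _ - l a = occ X a t (t + h) w); last by rewrite addrC addKr.
  have [xa|xa] := eqVneq x a.
    rewrite -xa JE mul1r (_ : _ - _ = - (qa l * J)); last by ring.
    by rewrite normrN normrM ler_pM// ger0_norm.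
  rewrite mul0r mulr0 subr0 normrM ler_pM// ger0_norm//.
  by rewrite /J (bigD1 a) 1?eq_sym//= lerDl sumr_ge0.
rewrite jE aE mE /increment -/x -/y -/l -/l'.
rewrite (_ : _ - _ = ((F y l' - F x l') - (x != y)%:R * (F y l - F x l)) +
  ((F x l' - F x l - h * F' x l) + (qa l * (l' a - l a) - h * ((x == a)%:R * qa l)))); last by ring.
apply: le_trans (ler_normD _ _) _.
apply: le_trans (lerD B1 (le_trans (ler_normD _ _) (lerD B2 B3))) _.
rewrite le_eqVlt; apply/predU1l; ring.
Qed.

Lemma bounded_jumped t h : 0 <= t -> 0 <= h -> bounded_rv (jumped t h).
Proof.
move=> t0 h0; apply: bounded_rv_sum => i; apply: bounded_rv_sum => j.
by apply: bounded_rvM; apply: bounded_at; rewrite // addr_ge0.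
Qed.

Lemma bounded_away t h : 0 <= t -> 0 <= h -> bounded_rv (away t h).
Proof.
move=> t0 h0; apply: bounded_rv_sum => i; apply: bounded_rv_sum => j.
by apply: bounded_rvM; [exact: bounded_at|apply: bounded_occ; rewrite // lerDl].
Qed.

Lemma blip_F i : blip (F i). Proof. by exists C. Qed.
Lemma blip_F' i : blip (F' i). Proof. by exists C. Qed.
Lemma blip_qa : blip qa. Proof. by exists C. Qed.

Lemma bounded_F_at t s : 0 <= t -> 0 <= s ->
  bounded_rv (fun w => F (X t w) (lt s w)).
Proof.
move=> t0 s0.
rewrite (_ : (fun w => _) = fun w => \sum_i at_ t i w * F i (lt s w)).
  apply: bounded_rv_sum => i; apply: bounded_rvM; first exact: bounded_at.
  by apply: bounded_blip => //; exact: blip_F.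
by apply/funext => w; rewrite sum_at.
Qed.

Lemma bounded_step t h : 0 <= t -> 0 <= h ->
  bounded_rv (fun w => qa (lt t w) * (lt (t + h) w a - lt t w a)).
Proof.
move=> t0 h0; have th0 := addr_ge0 t0 h0.
apply: bounded_rvM; first by apply: bounded_blip => //; exact: blip_qa.
by apply: bounded_rvB; exact: bounded_local_time.
Qed.

Lemma bounded_increment t h : 0 <= t -> 0 <= h -> bounded_rv (increment t h).
Proof.
move=> t0 h0; have th0 := addr_ge0 t0 h0.
apply: bounded_rvD; last exact: bounded_step.
by apply: bounded_rvB; exact: bounded_F_at.
Qed.

Lemma bounded_main t h : 0 <= t -> 0 <= h -> bounded_rv (main t h).
Proof.
move=> t0 h0; have th0 := addr_ge0 t0 h0; apply: bounded_rvD.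
  apply: bounded_rv_sum => i; apply: bounded_rv_sum => j; apply: bounded_rvM.
    by apply: bounded_rvM; exact: bounded_at.
  by apply: bounded_rvB; apply: bounded_blip => //; exact: blip_F.
apply: bounded_rvM; first exact: bounded_rv_cst.
apply: bounded_rv_sum => i; apply: bounded_rvM; first exact: bounded_at.
apply: bounded_rvD; first by apply: bounded_blip => //; exact: blip_F'.
by apply: bounded_rvM; [exact: bounded_rv_cst|apply: bounded_blip => //; exact: blip_qa].
Qed.

Let N : R := #|L|%:R.

(** The sum bounds every jump rate up to time [T]; the 3 absorbs the error [3 * e * h] of the rate
    estimate when [e <= 1]. *)
Let K : R := 3 + \sum_i \sum_j `|beta i j| * (ell j + T).

Let K_ge0 : 0 <= K.
Proof.
rewrite addr_ge0//; do 2 apply: sumr_ge0 => ? _.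
by rewrite mulr_ge0// addr_ge0// ltW.
Qed.

Lemma sum_sum_cst (B : R) : \sum_(i : L) \sum_(j : L) B = N * N * B.
Proof. by rewrite !sumr_const -mulrnA -mulr_natl natrM. Qed.

(** The case [h = 0] is included because [away] integrates over all times of a step, its start among
    them. *)
Lemma jump_prob_le (e : R) : 0 < e <= 1 -> exists2 h0 : R, 0 < h0 &
  forall h t i j, 0 <= h < h0 -> 0 <= t <= T -> i != j ->
  \int[P]_w (at_ t i w * at_ (t + h) j w) <= K * h.
Proof.
move=> /andP[e0 e1]; have [h0 h00 H] := vrjp_rate_functional T e0.
exists h0 => // h t i j /andP[hp hh0] tT ij; have /andP[t0 tT'] := tT.
have th0 := addr_ge0 t0 hp.
move: hp; rewrite le_eqVlt => /predU1P[<-|hp].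
  rewrite addr0 mulr0 -(mean_cst P 0); apply: le_mean.
  - by apply: bounded_rvM; exact: bounded_at.
  - exact: bounded_rv_cst.
  - move=> w; have [->|] := eqVneq (X t w) i; last by rewrite mul0r.
    by rewrite (negbTE ij) mulr0.
have := H h t i j (fun=> 1) 1; rewrite hp hh0 => /(_ isT tT ij ltr01).
have -> : lip_bounded 1 (fun _ : L -> R => 1 : R) <-> True.
  split=> // _; split=> *; first by rewrite normr1.
  by rewrite subrr normr0 mul1r l1dist_ge0.
move=> /(_ I).
under eq_Rintegral do rewrite mul1r.
have b1 : bounded_rv (fun w => at_ t i w * at_ (t + h) j w).
  by apply: bounded_rvM; exact: bounded_at.
have b2 : bounded_rv (fun w => at_ t i w * (beta i j * lt t w j)).
  apply: bounded_rvM; first exact: bounded_at.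
  by apply: bounded_rvM; [exact: bounded_rv_cst|exact: bounded_local_time].
rewrite meanB//; last by apply: bounded_rvM => //; exact: bounded_rv_cst.
rewrite meanZ//.
set p := \int[P]_w (_ * _); set r := \int[P]_w (at_ t i w * _).
move=> Hpr; have rK : r <= \sum_i \sum_j `|beta i j| * (ell j + T).
  apply: (@le_trans _ _ (`|beta i j| * (ell j + T))).
    rewrite -[leRHS](mean_cst P); apply: le_mean => //; first exact: bounded_rv_cst.
    move=> w; apply: (@le_trans _ _ (1 * (`|beta i j| * (ell j + T)))); last by rewrite mul1r.
    apply: le_trans (ler_norm _) _; rewrite !normrM; apply: ler_pM => //.
      by rewrite ger0_norm// lern1 leq_b1.
    rewrite ler_wpM2l// ger0_norm ?local_time_ge0//.
    by apply: le_trans (local_time_le _ _ t0) _; rewrite lerD2l.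
  have S0 k l : 0 <= `|beta k l| * (ell l + T).
    by rewrite mulr_ge0// addr_ge0// ltW.
  rewrite (bigD1 i)//= (bigD1 j)//= -addrA lerDl addr_ge0 ?sumr_ge0// => *.
  exact: sumr_ge0.
have := le_trans (ler_norm _) Hpr; rewrite /K mulrDl mulr1.
have : h * r <= (\sum_i \sum_j `|beta i j| * (ell j + T)) * h by rewrite mulrC ler_wpM2r// ltW.
have : e * h <= 1 * h by rewrite ler_wpM2r// ltW.
lra.
Qed.

(** The bound on [away] is of second order: at each time of the step, being elsewhere has
    probability of order [h], and the step has length [h]. *)
Lemma mean_jumped_le (e : R) : 0 < e <= 1 -> exists2 h0 : R, 0 < h0 &
  forall h t, 0 <= h < h0 -> 0 <= t <= T ->
  \int[P]_w jumped t h w <= N * N * K * h /\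
  \int[P]_w away t h w <= N * N * K * h ^+ 2.
Proof.
move=> e01; have [h0 h00 H] := jump_prob_le e01; exists h0 => // h t hh tT.
have /andP[t0 tT'] := tT; have /andP[hp hh0] := hh.
have Kh : 0 <= K * h by rewrite mulr_ge0.
have double (c : L -> L -> R) (B : R) : 0 <= B ->
    (forall i j, j != i -> c i j <= B) -> \sum_i \sum_(j | j != i) c i j <= N * N * B.
  move=> B0 cB; apply: (@le_trans _ _ (\sum_(i : L) \sum_(j : L) B)).
    apply: ler_sum => i _; apply: (@le_trans _ _ (\sum_(j | j != i) B)).
      by apply: ler_sum => j; exact: cB.
    by rewrite [leRHS](bigID (fun j => j != i))/= lerDl sumr_ge0.
  by rewrite sum_sum_cst.
split.
  rewrite /jumped mean_sum => [|i]; last first.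
    by apply: bounded_rv_sum => j; apply: bounded_rvM; apply: bounded_at; rewrite ?addr_ge0.
  rewrite -(mulrA (N * N)).
  under eq_bigr => i _.
    rewrite mean_sum => [|j]; last by apply: bounded_rvM; apply: bounded_at; rewrite ?addr_ge0.
  over.
  by apply: double => // i j ji; apply: H; rewrite // eq_sym.
rewrite /away mean_sum => [|i]; last first.
  by apply: bounded_rv_sum => j; apply: bounded_rvM; [exact: bounded_at|apply: bounded_occ; rewrite ?lerDl].
rewrite (_ : N * N * K * h ^+ 2 = N * N * (K * h * h)); last by rewrite expr2 !mulrA.
under eq_bigr => i _.
  rewrite mean_sum => [|j]; last first.
    by apply: bounded_rvM; [exact: bounded_at|apply: bounded_occ; rewrite ?lerDl].
over.
apply: double => [|i j ji]; first by rewrite mulr_ge0.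
have -> : K * h * h = K * h * (t + h - t) by rewrite addrC addKr.
apply: mean_mul_occ_le => //; first by rewrite lerDl.
  exact: bounded_at.
move=> r /andP[tr rth]; have -> : r = t + (r - t) by rewrite addrC subrK.
have rt0 : 0 <= r - t by rewrite subr_ge0.
have rth' : r - t <= h by rewrite lerBlDl.
apply: le_trans (H _ _ _ _ _ tT _) _.
- by rewrite rt0 (le_lt_trans rth').
- by rewrite eq_sym.
- by rewrite ler_wpM2l.
Qed.

Lemma mean_increment_le eta : 0 < eta -> exists2 h0 : R, 0 < h0 &
  forall h t, 0 < h < h0 -> 0 <= t <= T ->
  `|\int[P]_w increment t h w| <= (eps + eta) * h.
Proof.
move=> eta0.
(* [D] collects the coefficients of [e * h] at the end: 6 = 3 * 2 from the rate estimate for the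
   difference of two values of [F], 5 = 2 + 3 from [increment_main] with one factor [h] replaced by
   [e], and 1 for positivity. *)
pose D : R := N * N * 6 * C + C * (5 * (N * N * K) + 1) + 1.
have NN : 0 <= N * N by rewrite mulr_ge0.
have D0 : 0 < D.
  by rewrite ltr_wpDl// addr_ge0// !mulr_ge0// ?addr_ge0// ?mulr_ge0// ltW.
pose e := Num.min 1 (eta / D).
have e01 : 0 < e <= 1 by rewrite lt_min ltr01 divr_gt0//= ge_min lexx.
have eD : e * D <= eta by rewrite -ler_pdivlMr// ge_min lexx orbT.
clearbody e; have [h1 h10 H1] := mean_jumped_le e01.
have /andP[e0 e1] := e01.
have [h2 h20 H2] := vrjp_rate_functional T e0.
exists (Num.min e (Num.min h1 h2)); first by rewrite !lt_min e0 h10 h20.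
move=> h t /andP[hp]; rewrite !lt_min => /and3P[he hh1 hh2] tT.
have /andP[t0 tT'] := tT; have h0 := ltW hp; have th0 := addr_ge0 t0 h0.
have [Hj Ha] : \int[P]_w jumped t h w <= N * N * K * h /\
  \int[P]_w away t h w <= N * N * K * h ^+ 2 by apply: H1; rewrite ?h0.
have bj := bounded_jumped t0 h0; have ba := bounded_away t0 h0.
have bi := bounded_increment t0 h0; have bm := bounded_main t0 h0.
(* [main] is [h * drift + defect]. The Poisson equation bounds [drift] pointwise, whereas [defect]
   is small only in mean, by the jump rates. *)
pose drift w := \sum_i at_ t i w * (F' i (lt t w)
   + \sum_j beta i j * lt t w j * (F j (lt t w) - F i (lt t w))
   + (i == a)%:R * qa (lt t w)).
pose defect w := \sum_i \sum_(j | j != i) (F j (lt t w) - F i (lt t w)) *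
  (at_ t i w * at_ (t + h) j w - h * (at_ t i w * (beta i j * lt t w j))).
have mainE w : main t h w = h * drift w + defect w.
  rewrite /main /drift /defect.
  have -> : \sum_i \sum_(j | j != i) (F j (lt t w) - F i (lt t w)) *
     (at_ t i w * at_ (t + h) j w - h * (at_ t i w * (beta i j * lt t w j))) =
     \sum_i \sum_(j | j != i) at_ t i w * at_ (t + h) j w * (F j (lt t w) - F i (lt t w))
     - h * \sum_i at_ t i w * \sum_j beta i j * lt t w j * (F j (lt t w) - F i (lt t w)).
    rewrite mulr_sumr -sumrB; apply: eq_bigr => i _.
    rewrite [X in h * (_ * X)](bigD1 i)//= subrr mulr0 add0r !mulr_sumr -sumrB.
    by apply: eq_bigr => j _; ring.
  rewrite addrCA -mulrBr -sumrB; congr (_ + h * _).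
  by apply: eq_bigr => i _; ring.
have bb i j : bounded_rv (fun w => (F j (lt t w) - F i (lt t w)) *
  (at_ t i w * at_ (t + h) j w - h * (at_ t i w * (beta i j * lt t w j)))).
  apply: bounded_rvM; first by apply: bounded_rvB; apply: bounded_blip => //; exact: blip_F.
  apply: bounded_rvB; first by apply: bounded_rvM; exact: bounded_at.
  apply: bounded_rvM; first exact: bounded_rv_cst.
  apply: bounded_rvM; first exact: bounded_at.
  by apply: bounded_rvM; [exact: bounded_rv_cst|exact: bounded_local_time].
have bdef : bounded_rv defect by apply: bounded_rv_sum => i; exact: bounded_rv_sum.
have bdr : bounded_rv drift.
  apply: bounded_rv_sum => i; apply: bounded_rvM; first exact: bounded_at.
  apply: bounded_rvD; last first.
    by apply: bounded_rvM; [exact: bounded_rv_cst|apply: bounded_blip => //; exact: blip_qa].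
  apply: bounded_rvD; first by apply: bounded_blip => //; exact: blip_F'.
  apply: bounded_rv_sum => j; apply: bounded_rvM.
    by apply: bounded_rvM; [exact: bounded_rv_cst|exact: bounded_local_time].
  by apply: bounded_rvB; apply: bounded_blip => //; exact: blip_F.
have Hdr : `|\int[P]_w drift w| <= eps.
  rewrite -[leRHS](mean_cst P); apply: mean_norm => //; first exact: bounded_rv_cst.
  by move=> w; rewrite /drift sum_at; apply: F_gen => k; exact: local_time_ge0.
have Hdef : `|\int[P]_w defect w| <= N * N * (6 * C * (e * h)).
  rewrite /defect mean_sum => [|i]; last exact: bounded_rv_sum.
  apply: le_trans (ler_norm_sum _ _ _) _.
  apply: (@le_trans _ _ (\sum_(i : L) \sum_(j : L) 6 * C * (e * h))); last first.
    by rewrite sum_sum_cst.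
  have pos : 0 <= 6 * C * (e * h) by rewrite !mulr_ge0// ltW.
  apply: ler_sum => i _; rewrite mean_sum//.
  apply: le_trans (ler_norm_sum _ _ _) _.
  apply: (@le_trans _ _ (\sum_(j | j != i) 6 * C * (e * h))); last first.
    by rewrite [leRHS](bigID (fun j => j != i))/= lerDl sumr_ge0.
  apply: ler_sum => j ji.
  have lipB : lip_bounded (2 * C) (fun l => F j l - F i l).
    have [f1 f2] := F_lip j; have [g1 g2] := F_lip i.
    split=> [l|l l'].
      by rewrite mulr_natl mulr2n (le_trans (ler_normB _ _))// lerD.
    rewrite (_ : _ - _ = (F j l - F j l') - (F i l - F i l')); last by ring.
    rewrite mulr_natl mulr2n mulrDl.
    by apply: le_trans (ler_normB _ _) _; exact: lerD.
  have -> : 6 * C * (e * h) = 3 * (2 * C) * (e * h) by ring.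
  apply: (H2 h t i j (fun l => F j l - F i l) (2 * C)) => //.
  - by rewrite hp.
  - by rewrite eq_sym.
  - by rewrite mulr_gt0.
have -> : \int[P]_w increment t h w =
   \int[P]_w (increment t h w - main t h w) + (h * \int[P]_w drift w + \int[P]_w defect w).
  rewrite -meanZ// -meanD//; last by apply: bounded_rvM => //; exact: bounded_rv_cst.
  rewrite -meanD; last 2 first.
  - exact: bounded_rvB.
  - by apply: bounded_rvD => //; apply: bounded_rvM => //; exact: bounded_rv_cst.
  by apply: eq_Rintegral => w _; rewrite mainE subrK.
have Him : `|\int[P]_w (increment t h w - main t h w)| <=
    C * (2 * h * (N * N * K * h) + 3 * (N * N * K * h ^+ 2) + h ^+ 2).
  have bJ : bounded_rv (fun w => 2 * h * jumped t h w).
    by apply: bounded_rvM => //; exact: bounded_rv_cst.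
  have bA : bounded_rv (fun w => 3 * away t h w).
    by apply: bounded_rvM => //; exact: bounded_rv_cst.
  have bJA : bounded_rv (fun w => 2 * h * jumped t h w + 3 * away t h w).
    exact: bounded_rvD.
  have bJAh : bounded_rv (fun w => 2 * h * jumped t h w + 3 * away t h w + h ^+ 2).
    by apply: bounded_rvD => //; exact: bounded_rv_cst.
  apply: (@le_trans _ _ (\int[P]_w (C * (2 * h * jumped t h w + 3 * away t h w + h ^+ 2)))).
    apply: mean_norm; first exact: bounded_rvB.
      by apply: bounded_rvM => //; exact: bounded_rv_cst.
    by move=> w; exact: increment_main.
  rewrite meanZ//; apply: ler_wpM2l; first exact: ltW.
  rewrite meanD//; last exact: bounded_rv_cst.
  rewrite (mean_cst P (h ^+ 2)) meanD// lerD2r (meanZ P _ bj) (meanZ P _ ba).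
  by apply: lerD; apply: ler_wpM2l => //; rewrite mulr_ge0.
apply: le_trans (ler_normD _ _) _; apply: le_trans (lerD Him (ler_normD _ _)) _.
rewrite normrM (ger0_norm h0).
have Hd : h * `|\int[P]_w drift w| <= h * eps by rewrite ler_wpM2l.
apply: le_trans (lerD (lexx _) (lerD Hd Hdef)) _.
apply: (@le_trans _ _ ((eps + e * D) * h)); last by rewrite ler_wpM2r// lerD2l.
have CC : 0 <= C * (5 * (N * N * K) + 1).
  by rewrite mulr_ge0 ?addr_ge0 ?mulr_ge0// ltW.
have Hh : C * (5 * (N * N * K) + 1) * (h * h) <= C * (5 * (N * N * K) + 1) * (e * h).
  by rewrite ler_wpM2l// ler_wpM2r// ltW.
have eh : 0 <= e * h by rewrite mulr_ge0// ltW.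
rewrite (_ : _ + _ = C * (5 * (N * N * K) + 1) * (h * h) + (h * eps + N * N * (6 * C * (e * h)))); last by ring.
rewrite (_ : (eps + e * D) * h = C * (5 * (N * N * K) + 1) * (e * h) +
  (h * eps + N * N * (6 * C * (e * h))) + e * h); last by rewrite /D; ring.
by rewrite -[leLHS]addr0; apply: lerD => //; rewrite lerD2r.
Qed.

Definition riemann_sum (N : nat) w : R := \sum_(0 <= k < N)
  qa (lt (k%:R * (T / N%:R)) w) *
  (lt (k.+1%:R * (T / N%:R)) w a - lt (k%:R * (T / N%:R)) w a).

Lemma bounded_riemann_sum n : bounded_rv (riemann_sum n).
Proof.
apply: bounded_rv_sum => k; rewrite -natr1 mulrDl mul1r.
by apply: bounded_step; rewrite ?mulr_ge0 ?divr_ge0// ltW.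
Qed.

(** The process starts at [v] only almost surely, so the difference is bounded by [2 * C] times the
    indicator of starting elsewhere. *)
Lemma mean_initial : \int[P]_w F (X 0 w) (lt 0 w) = F v ell.
Proof.
have b0 := bounded_F_at (lexx 0) (lexx 0).
have bv := bounded_at v (lexx 0).
have mv : measurable (X 0 @^-1` [set v]) by exact: (vrjp_measurable V).
have Ev : \int[P]_w at_ 0 v w = 1.
  transitivity (\int[P]_w \1_(X 0 @^-1` [set v]) w).
    by apply: eq_Rintegral => w _; rewrite indicE mem_at.
  by rewrite mean_indic// (vrjp_start V).
apply/eqP; rewrite -subr_eq0 -normr_le0.
rewrite -(mean_cst P (F v ell)) -meanB//; last exact: bounded_rv_cst.
rewrite [leRHS](_ : _ = 2 * C * (\int[P]_w 1 - \int[P]_w at_ 0 v w)); last first.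
  by rewrite mean_cst Ev subrr mulr0.
rewrite -[X in _ <= _ * X]meanB//; last exact: bounded_rv_cst.
have b1 : bounded_rv (fun w => 1 - at_ 0 v w).
  by apply: bounded_rvB => //; exact: bounded_rv_cst.
rewrite -meanZ//; apply: mean_norm => [||w].
- by apply: bounded_rvB => //; exact: bounded_rv_cst.
- by apply: bounded_rvM => //; exact: bounded_rv_cst.
rewrite local_time0; have [->|xv] := eqVneq (X 0 w) v.
  by rewrite !subrr normr0 mulr0.
rewrite subr0 mulr1 mulr_natl mulr2n; apply: le_trans (ler_normB _ _) _.
by have [f1 _] := F_lip (X 0 w); have [f2 _] := F_lip v; exact: lerD.
Qed.

(** The increments telescope over a grid of mesh below the threshold [h0]; [n] steps of error
    [(eps + eta) * T / n] add up, and the terminal value is zero. *)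
Lemma dynkin eta : 0 < eta -> (forall w, F (X T w) (lt T w) = 0) ->
  exists n0, forall n, (n0 <= n)%N ->
  `|F v ell - \int[P]_w riemann_sum n w| <= (eps + eta) * T.
Proof.
move=> eta0 FT0; have [h0 h00 H] := mean_increment_le eta0.
exists (Num.truncn (T / h0)).+1 => n Tn.
have n0 : (0 < n)%N by exact: leq_ltn_trans Tn.
have nR : 0 < n%:R :> R by rewrite ltr0n.
pose h := T / n%:R; have hp : 0 < h by rewrite divr_gt0.
have hh0 : h < h0.
  rewrite ltr_pdivrMr// mulrC -ltr_pdivrMr//.
  have /andP[_ t2] := truncn_itv (divr_ge0 (ltW T_gt0) (ltW h00)).
  by apply: lt_le_trans t2 _; rewrite ler_nat.
have tk k : k.+1%:R * h = k%:R * h + h by rewrite -natr1 mulrDl mul1r.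
have tk0 (k : nat) : 0 <= k%:R * h by rewrite mulr_ge0// ltW.
have nh : n%:R * h = T by rewrite mulrCA divff ?mulr1// lt0r_neq0.
have E w : \sum_(0 <= k < n) increment (k%:R * h) h w =
    - F (X 0 w) (lt 0 w) + riemann_sum n w.
  rewrite /increment big_split/= /riemann_sum; congr (_ + _); last first.
    by apply: eq_bigr => k _; rewrite -tk.
  under eq_bigr do rewrite -tk.
  rewrite (telescope_sumr (fun k => F (X (k%:R * h) w) (lt (k%:R * h) w)))//.
  by rewrite nh FT0 mul0r sub0r.
have bi k : bounded_rv (increment (k%:R * h) h) by apply: bounded_increment => //; exact: ltW.
have bF0 := bounded_F_at (lexx 0) (lexx 0).
have brs := bounded_riemann_sum n.
have -> : F v ell - \int[P]_w riemann_sum n w =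
    - \sum_(0 <= k < n) \int[P]_w increment (k%:R * h) h w.
  rewrite -mean_sum// -mean_initial -meanB// -[RHS]mulN1r -meanZ; last exact: bounded_rv_sum.
  by apply: eq_Rintegral => w _; rewrite E; ring.
rewrite normrN; apply: le_trans (ler_norm_sum _ _ _) _.
apply: (@le_trans _ _ (\sum_(0 <= k < n) (eps + eta) * h)); last first.
  by rewrite sumr_const_nat subn0 -mulr_natr -mulrA (mulrC h) nh.
rewrite [leLHS]big_nat [leRHS]big_nat; apply: ler_sum => k /andP[_ kn].
apply: H; first by rewrite hp.
rewrite tk0 -nh; apply: ler_wpM2r; first exact: ltW.
by rewrite ler_nat ltnW.
Qed.

End increments.

End vrjp_local_time.

(** * The hitting time as a limit *)

Section tent.
Context {R : realType}.
Variables (al ga : R).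
Hypothesis al_lt_ga : al < ga.

Definition pos (x : R) := Num.max x 0.
Let mid := (al + ga) / 2.
Let c := 2 / (ga - al) ^+ 2.

(* The tent on [al, ga] of mass 1, and its primitive. *)
Definition tent (x : R) := 2 * c * (pos (x - al) - 2 * pos (x - mid) + pos (x - ga)).
Definition tent_cdf (x : R) :=
  c * (pos (x - al) ^+ 2 - 2 * pos (x - mid) ^+ 2 + pos (x - ga) ^+ 2).

Let c_gt0 : 0 < c.
Proof. by rewrite divr_gt0// exprn_gt0// subr_gt0. Qed.

Lemma pos_ge x : 0 <= x -> pos x = x. Proof. by move=> x0; rewrite /pos max_l. Qed.
Lemma pos_le x : x <= 0 -> pos x = 0. Proof. by move=> x0; rewrite /pos max_r. Qed.

Lemma pos_lip x y : `|pos x - pos y| <= `|x - y|.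
Proof.
have [x0|/ltW x0] := leP 0 x; have [y0|/ltW y0] := leP 0 y;
  rewrite ?(pos_ge x0) ?(pos_le x0) ?(pos_ge y0) ?(pos_le y0)//.
- by rewrite subr0 ger0_norm// (le_trans _ (ler_norm _))// lerDl oppr_ge0.
- by rewrite sub0r normrN ger0_norm// distrC (le_trans _ (ler_norm _))// lerDl oppr_ge0.
- by rewrite subrr normr0.
Qed.

Lemma pos_sqr_quadratic x y : `|pos y ^+ 2 - pos x ^+ 2 - 2 * pos x * (y - x)| <= (y - x) ^+ 2.
Proof.
rewrite ler_norml; have hx := sqr_ge0 x; have hy := sqr_ge0 y; have hd := sqr_ge0 (y - x).
have [x0|/ltW x0] := leP 0 x; have [y0|/ltW y0] := leP 0 y.
- rewrite (pos_ge x0) (pos_ge y0); have -> : y ^+ 2 - x ^+ 2 - 2 * x * (y - x) = (y - x) ^+ 2 by ring.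
  by rewrite lexx andbT; lra.
- rewrite (pos_ge x0) (pos_le y0); have xy := mulr_ge0_le0 x0 y0.
  have -> : 0 ^+ 2 - x ^+ 2 - 2 * x * (y - x) = (y - x) ^+ 2 - y ^+ 2 by ring.
  apply/andP; split; last lra.
  have -> : (y - x) ^+ 2 - y ^+ 2 = x ^+ 2 - 2 * (x * y) by ring.
  lra.
- rewrite (pos_le x0) (pos_ge y0); have xy := mulr_le0_ge0 x0 y0.
  have -> : y ^+ 2 - 0 ^+ 2 - 2 * 0 * (y - x) = y ^+ 2 by ring.
  apply/andP; split; first lra.
  have -> : (y - x) ^+ 2 = y ^+ 2 + x ^+ 2 - 2 * (x * y) by ring.
  lra.
- rewrite (pos_le x0) (pos_le y0).
  have -> : 0 ^+ 2 - 0 ^+ 2 - 2 * 0 * (y - x) = 0 :> R by ring.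
  apply/andP; split; lra.
Qed.

(** [tent_cdf] combines squares of positive parts with coefficients 1, - 2, 1, whence the 4 = 1 + 2
    + 1. *)
Lemma tent_quadratic x y : `|tent_cdf y - tent_cdf x - tent x * (y - x)|
  <= 4 * c * (y - x) ^+ 2.
Proof.
have q k : `|pos (y - k) ^+ 2 - pos (x - k) ^+ 2 - 2 * pos (x - k) * (y - x)| <= (y - x) ^+ 2.
  have := pos_sqr_quadratic (x - k) (y - k).
  by have -> : y - k - (x - k) = y - x by ring.
have Ha := q al; have Hm := q mid; have Hg := q ga.
set qa := (X in `|X| <= _) in Ha; set qm := (X in `|X| <= _) in Hm.
set qg := (X in `|X| <= _) in Hg.
have -> : tent_cdf y - tent_cdf x - tent x * (y - x) = c * (qa - 2 * qm + qg).
  by rewrite /tent_cdf /tent /qa /qm /qg; ring.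
rewrite (_ : 4 * c * _ = c * (4 * (y - x) ^+ 2)); last by rewrite [RHS]mulrCA mulrA.
rewrite normrM (ger0_norm (ltW c_gt0)); apply: ler_wpM2l; first exact: ltW.
apply: le_trans (ler_normD _ _) _; apply: le_trans (lerD (ler_normB _ _) (lexx _)) _.
rewrite normrM (ger0_norm (_ : 0 <= 2))//; lra.
Qed.

Lemma tent0 x : x <= al \/ ga <= x -> tent x = 0.
Proof.
rewrite /tent /mid; have := al_lt_ga => ag [xa|gx].
  by rewrite !pos_le; [ring|lra|lra|lra].
by rewrite !pos_ge; [field|lra|lra|lra].
Qed.

Lemma tent_ge0 x : 0 <= tent x.
Proof.
rewrite /tent; apply: mulr_ge0; first by rewrite mulr_ge0// ltW.
have ag := al_lt_ga; rewrite /pos /mid /Num.max.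
by repeat case: ifPn; rewrite -?leNgt; lra.
Qed.

Lemma tent_cdf0 x : x <= al -> tent_cdf x = 0.
Proof.
by move=> xa; have ag := al_lt_ga; rewrite /tent_cdf !pos_le; [ring|rewrite /mid; lra..].
Qed.

Lemma tent_cdf1 x : ga <= x -> tent_cdf x = 1.
Proof.
move=> gx; have ag := al_lt_ga; rewrite /tent_cdf !pos_ge; [|rewrite /mid; lra..].
by rewrite /c /mid; field; rewrite subr_eq0 gt_eqF.
Qed.

Lemma tent_cdf_le1 x : tent_cdf x <= 1.
Proof.
have ag := al_lt_ga; have cE : c * (ga - al) ^+ 2 = 2.
  by rewrite /c divfK// expf_neq0// subr_eq0 gt_eqF.
have [xa|ax] := leP x al; first by rewrite tent_cdf0.
have [gx|xg] := leP ga x; first by rewrite tent_cdf1.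
have c0 := ltW c_gt0.
have [xm|mx] := leP x mid.
  rewrite /tent_cdf (pos_ge (_ : 0 <= x - al)) ?(pos_le (_ : x - mid <= 0)) ?(pos_le (_ : x - ga <= 0)); [|lra..].
  rewrite -(ler_pM2l (ltr0n _ 2)) mulr1 -[leRHS]cE !expr0n/= mulr0 subr0 addr0 mulrCA.
  apply: ler_wpM2l => //; have H : 0 <= 2 * (x - al) <= ga - al by move: xm; rewrite /mid; lra.
  have := ler_pM (proj1 (andP H)) (proj1 (andP H)) (proj2 (andP H)) (proj2 (andP H)).
  have := sqr_ge0 (x - al); rewrite !expr2; lra.
rewrite /tent_cdf (pos_ge (_ : 0 <= x - al)) ?(pos_ge (_ : 0 <= x - mid)) ?(pos_le (_ : x - ga <= 0)); [|lra..].
have -> : (x - al) ^+ 2 - 2 * (x - mid) ^+ 2 + 0 ^+ 2 = (ga - al) ^+ 2 / 2 - (ga - x) ^+ 2.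
  by rewrite /mid; field.
by rewrite mulrBr mulrA cE divff// gerBl mulr_ge0// sqr_ge0.
Qed.

Lemma blip_tent (L : finType) (k : L) : blip (fun l : L -> R => tent (l k)).
Proof.
have c0 := ltW c_gt0.
have lip x y : `|tent x - tent y| <= 8 * c * `|x - y|.
  rewrite /tent -mulrBr normrM (ger0_norm (mulr_ge0 (ler0n _ 2) c0)).
  have -> : 8 * c * `|x - y| = 2 * c * (`|x - y| + 2 * `|x - y| + `|x - y|) by ring.
  apply: ler_wpM2l; first by apply: mulr_ge0.
  have H k' : `|pos (x - k') - pos (y - k')| <= `|x - y|.
    by apply: le_trans (pos_lip _ _) _; rewrite opprB addrA subrK.
  rewrite (_ : pos (x - al) - 2 * pos (x - mid) + pos (x - ga) -
     (pos (y - al) - 2 * pos (y - mid) + pos (y - ga)) =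
     (pos (x - al) - pos (y - al)) - 2 * (pos (x - mid) - pos (y - mid))
     + (pos (x - ga) - pos (y - ga))); last by ring.
  apply: le_trans (ler_normD _ _) _; apply: lerD => //.
  apply: le_trans (ler_normB _ _) _; apply: lerD => //.
  by rewrite normrM ger0_norm// ler_wpM2l.
apply: (@blip_coord _ _ tent k (8 * c * (ga - al)) (8 * c)) => // [x|].
  have [xa|ax] := leP x al.
    by rewrite tent0 ?normr0; [apply: mulr_ge0; [exact: mulr_ge0|rewrite subr_ge0 ltW]|left].
  have [gx|xg] := leP ga x.
    by rewrite tent0 ?normr0; [apply: mulr_ge0; [exact: mulr_ge0|rewrite subr_ge0 ltW]|right].
  rewrite -[tent x]subr0 -(@tent0 al); last by left.
  apply: le_trans (lip _ _) _; apply: ler_wpM2l; first by apply: mulr_ge0.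
  rewrite gtr0_norm ?subr_gt0//.
  by rewrite lerB// ltW.
by apply: mulr_ge0.
Qed.

Lemma is_derive_tent_cdf (x : R) : is_derive x 1 tent_cdf (tent x).
Proof.
apply: (@is_derive_quadratic _ _ _ _ (4 * c)); exists 1 => // y _.
by rewrite (mulrC (y - x)); exact: tent_quadratic.
Qed.

(* The Riemann sum is written with increasing levels [y k] in place of the
   local times at the grid points. *)
Lemma tent_sum_near (n : nat) (y : nat -> R) (h : R) :
  (forall k, 0 <= y k.+1 - y k <= h) ->
  `|\sum_(0 <= k < n) tent (y k) * (y k.+1 - y k) - (tent_cdf (y n) - tent_cdf (y 0))|
    <= 4 * c * h ^+ 2 *+ n.
Proof.
move=> yh.
rewrite -(telescope_sumr (fun k => tent_cdf (y k)))// -sumrB.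
apply: le_trans (ler_norm_sum _ _ _) _.
apply: (@le_trans _ _ (\sum_(0 <= k < n) 4 * c * h ^+ 2)); last first.
  by rewrite sumr_const_nat subn0.
apply: ler_sum => k _; apply: le_trans (_ : 4 * c * (y k.+1 - y k) ^+ 2 <= _).
  by rewrite distrC; exact: tent_quadratic.
have /andP[y0 yh'] := yh k.
apply: ler_wpM2l; first by apply: mulr_ge0 => //; exact: ltW.
by rewrite !expr2; exact: ler_pM.
Qed.

(** The constant of [tent_quadratic], named because [c] is local to the section. *)
Definition tent_slope := 4 * c.

End tent.

Lemma cvg_EFin_real {R : realType} {T : Type} {F : set_system T} {FF : Filter F}
  (u : T -> R) (l : R) : u x @[x --> F] --> l -> (u x)%:E @[x --> F] --> l%:E.
Proof. by move=> ul; apply: cvg_EFin; [exact: nearW|exact: ul]. Qed.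

(** Measurability of the limit is a consequence, not a hypothesis; for the VRJP expectation as a
    function of the spins there is no other source of it. *)
Lemma dominated_cvg {R : realType} d (T : measurableType d)
    (m : {measure set T -> \bar R}) (f_ : nat -> T -> R) (f h : T -> R) :
  (forall n, measurable_fun setT (f_ n)) ->
  (forall x, f_ n x @[n --> \oo] --> f x) ->
  m.-integrable setT (EFin \o h) -> (forall n x, `|f_ n x| <= h x) ->
  m.-integrable setT (EFin \o f) /\
  (\int[m]_x (f_ n x)%:E)%E @[n --> \oo] --> (\int[m]_x (f x)%:E)%E.
Proof.
move=> mf_ f_f ih f_h.
have mf : measurable_fun setT f by apply: (measurable_fun_cvg (h := f_)) => // x _.
have [] := @dominated_convergence _ T R m setT measurableT
  (fun n => EFin \o f_ n) (EFin \o f) (EFin \o h).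
- by move=> n; exact/measurable_EFinP.
- exact/measurable_EFinP.
- by apply: aeW => x _; exact: cvg_EFin_real.
- exact: ih.
- by apply: aeW => x n _; rewrite lee_fin.
- by move=> ? _ ?; split.
Qed.

(** * Riemann sums concentrating at the hitting time *)

Section hitting.
Context {R : realType} {L : finType} d (Omega : measurableType d)
  (P : probability Omega R).
Variables (beta : L -> L -> R) (a : L) (ell : L -> R) (X : R -> Omega -> L).
Hypothesis V : is_VRJP beta a ell P X.
Hypothesis ell_ge0 : forall i, 0 <= ell i.
Variables (ga M C : R) (g : (L -> R) -> R).
Hypothesis ell_lt : ell a < ga.
Hypothesis M_gt0 : 0 < M.
Hypothesis g_lip : lip_bounded C g.
Hypothesis g_vanishes : forall l k, M <= l k -> g l = 0.

Local Notation lt := (local_time X ell).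
(** From this time on the total local time is at least |L| M, so some local time has reached [M] and
    [g] vanishes. *)
Let T : R := #|L|%:R * M.

Let lt_sub i s t w := local_time_sub V i w (s := s) (t := t).

Let C_ge0 : 0 <= C := lip_bounded_ge0 g_lip.

Lemma horizon_gt0 : 0 < T.
Proof. by rewrite mulr_gt0// ltr0n; apply/card_gt0P; exists a. Qed.

Lemma local_time_horizon w t : T <= t -> exists k, M <= lt t w k.
Proof.
move=> Tt; have t0 : 0 <= t by rewrite (le_trans _ Tt)// ltW// horizon_gt0.
apply: contrapT => H.
have : \sum_k lt t w k < \sum_(k : L) M.
  apply: ltr_sum => [|k _]; first by apply/hasP; exists a; rewrite ?mem_index_enum.
  by rewrite ltNge; apply/negP => Mk; apply: H; exists k.
rewrite (local_time_total V)// sumr_const -mulr_natl -/T => /lt_le_trans /(_ Tt).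
by rewrite gtrDr; apply/negP; rewrite -leNgt sumr_ge0.
Qed.

Lemma g_horizon w t : T <= t -> g (lt t w) = 0.
Proof. by move=> /(local_time_horizon w)[k]; exact: g_vanishes. Qed.

Lemma local_time_homo w s t : 0 <= s -> s <= t ->
  lt s w a <= lt t w a <= lt s w a + (t - s).
Proof.
move=> s0 st; rewrite (lt_sub _ _ s0 st) lerDl occ_ge0/= lerD2l.
exact: (occ_le V).
Qed.

(** The local time at [a] is 1-Lipschitz, so the infimum is attained and the level is met exactly;
    it is positive because [ell a < ga]. *)
Lemma hitting_timeP w : ga <= lt T w a ->
  exists t, [/\ hitting_time X ell a ga w = t%:E, 0 < t, t <= T, lt t w a = ga &
    forall s, 0 <= s -> s < t -> lt s w a < ga].
Proof.
move=> gT; have T0 := ltW horizon_gt0.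
pose S := [set t | 0 <= t /\ ga <= lt t w a].
have ST : S T by [].
have lbS : has_lbound S by exists 0 => t [].
have infS : has_inf S by split=> //; exists T.
pose t := inf S.
have t0 : 0 <= t by apply: lb_le_inf; [exists T|move=> s []].
have tT : t <= T by exact: ge_inf.
have before s : 0 <= s -> s < t -> lt s w a < ga.
  move=> s0 st; rewrite ltNge; apply/negP => gs.
  by have := ge_inf lbS (conj s0 gs : S s); rewrite leNgt st.
have tga : ga <= lt t w a.
  apply/ler_addgt0Pr => e e0.
  have [s [s0 gs] se] := inf_adherent e0 infS.
  have ts : t <= s by apply: ge_inf.
  have /andP[_] := local_time_homo w t0 ts.
  by move=> /(le_trans gs) /le_trans; apply; rewrite lerD2l lerBlDl ltW.
have tpos : 0 < t.
  rewrite lt_neqAle t0 andbT; apply/eqP => t00.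
  by move: tga; rewrite -t00 local_time0 leNgt ell_lt.
exists t; split => //; last first.
  apply/eqP; rewrite eq_le tga andbT; apply/ler_addgt0Pr => e e0.
  pose s := Num.max 0 (t - e).
  have s0 : 0 <= s by rewrite /s le_max lexx.
  have st : s < t by rewrite /s gt_max tpos/= gtrBl.
  have /andP[_ h] := local_time_homo w s0 (ltW st).
  apply: le_trans h _; apply: lerD; first by rewrite ltW// before.
  by rewrite lerBlDr -lerBlDl le_max lexx orbT.
by rewrite /hitting_time -(@ereal_inf_EFin _ S)//; exists T.
Qed.

(** A level not reached by [T] gives the value 0 whether the hitting time is finite or not, in
    agreement with the default of [at_hitting_time]. *)
Lemma hitting_time_late w t : lt T w a < ga -> hitting_time X ell a ga w = t%:E ->
  g (lt t w) = 0.
Proof.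
move=> gT tE; apply: g_horizon; rewrite -lee_fin -tE.
apply: le_ereal_inf_tmp => _ [s [s0 gs] <-]; rewrite lee_fin leNgt.
apply/negP => sT; have /andP[h _] := local_time_homo w s0 (ltW sT).
by have := lt_le_trans gT (le_trans gs h); rewrite ltxx.
Qed.

Section level.
Variables (al eps : R) (n : nat).
Hypothesis ell_le : ell a <= al.
Hypothesis al_lt : al < ga.
Hypothesis n_gt0 : (0 < n)%N.
Hypothesis fine_grid : tent_slope al ga * (T / n%:R) ^+ 2 *+ n <= eps.

Let h := T / n%:R.
Let y w (k : nat) : R := lt (k%:R * h) w a.
Let mass w : R := \sum_(0 <= k < n) tent al ga (y w k) * (y w k.+1 - y w k).

Definition level_sum w : R :=
  riemann_sum ell X T a (fun l => tent al ga (l a) * g l) n w.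

Let h_ge0 : 0 <= h. Proof. by rewrite divr_ge0// ltW// horizon_gt0. Qed.

Let nh : n%:R * h = T.
Proof. by rewrite mulrCA divff ?mulr1// pnatr_eq0 -lt0n. Qed.

Let kh_ge0 (k : nat) : 0 <= k%:R * h. Proof. by rewrite mulr_ge0. Qed.

Let y_step w k : 0 <= y w k.+1 - y w k <= h.
Proof.
have kk : k%:R * h <= k.+1%:R * h by rewrite ler_wpM2r// ler_nat.
have /andP[h1 h2] := local_time_homo w (kh_ge0 k) kk.
rewrite /y subr_ge0 h1/= lerBlDl; apply: le_trans h2 _.
by rewrite lerD2l -mulrBl -natrB// subSnn mul1r.
Qed.

Let mass_near w : `|mass w - (tent_cdf al ga (y w n) - tent_cdf al ga (y w 0))| <= eps.
Proof. by apply: le_trans fine_grid; exact: tent_sum_near. Qed.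

Let y0 w : y w 0 = ell a. Proof. by rewrite /y mul0r local_time0. Qed.

Let mass_le w : mass w <= 1 + eps.
Proof.
have := le_trans (ler_norm _) (mass_near w).
rewrite y0 (tent_cdf0 al_lt ell_le) subr0 lerBlDl => /le_trans; apply.
by rewrite lerD2r tent_cdf_le1.
Qed.

Let term_ge0 w k : 0 <= tent al ga (y w k) * (y w k.+1 - y w k).
Proof. by rewrite mulr_ge0 ?tent_ge0//; have /andP[] := y_step w k. Qed.

Let level_sumE w : level_sum w =
  \sum_(0 <= k < n) tent al ga (y w k) * (y w k.+1 - y w k) * g (lt (k%:R * h) w).
Proof. by apply: eq_bigr => k _; rewrite mulrAC. Qed.

Lemma level_sum_le w : `|level_sum w| <= C * (1 + eps).
Proof.
rewrite level_sumE; apply: le_trans (ler_norm_sum _ _ _) _.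
apply: (@le_trans _ _ (C * mass w)); last by rewrite ler_wpM2l.
rewrite /mass mulr_sumr; apply: ler_sum => k _.
rewrite normrM (ger0_norm (term_ge0 w k)) mulrC ler_wpM2r//.
by have [g1 _] := g_lip.
Qed.

Lemma level_sum_late w : lt T w a <= al -> level_sum w = 0.
Proof.
move=> Tal; rewrite level_sumE big_nat big1// => k /andP[_ kn].
rewrite tent0 ?mul0r//; left; apply: le_trans Tal.
have kT : k%:R * h <= T by rewrite -[leRHS]nh ler_wpM2r// ler_nat ltnW.
by have /andP[] := local_time_homo w (kh_ge0 k) kT.
Qed.

(** The weights are nonnegative with total within [eps] of 1, and are carried by grid times at most
    [delta] before [t], where [g] differs from its value at [t] by at most [C * delta]. *)
Lemma level_sum_hit w t delta : 0 <= t -> ga <= lt T w a -> ga <= lt t w a -> 0 <= delta ->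
  (forall s, 0 <= s -> s < t -> al < lt s w a -> t - s <= delta) ->
  `|level_sum w - g (lt t w)| <= C * (delta * (1 + eps) + eps).
Proof.
move=> t0 gT gt delta0 near_hit; have [g1 g2] := g_lip.
have -> : level_sum w - g (lt t w) =
  \sum_(0 <= k < n) tent al ga (y w k) * (y w k.+1 - y w k) * (g (lt (k%:R * h) w) - g (lt t w))
  + g (lt t w) * (mass w - 1).
  rewrite level_sumE mulrBr mulr1 mulrC /mass mulr_suml addrA -big_split/=; congr (_ - _).
  by apply: eq_bigr => k _; rewrite -mulrDr subrK.
rewrite [leRHS]mulrDr; apply: le_trans (ler_normD _ _) _; apply: lerD; last first.
  rewrite normrM ler_pM//; have := mass_near w.
  rewrite y0 (tent_cdf0 al_lt ell_le) subr0 (tent_cdf1 al_lt)//.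
  by rewrite /y nh.
apply: le_trans (ler_norm_sum _ _ _) _.
apply: (@le_trans _ _ (\sum_(0 <= k < n) (C * delta) * (tent al ga (y w k) * (y w k.+1 - y w k)))).
  apply: ler_sum => k _; rewrite normrM (ger0_norm (term_ge0 w k)) mulrC.
  have [z0|z0] := eqVneq (tent al ga (y w k)) 0; first by rewrite z0 mul0r !mulr0.
  rewrite ler_wpM2r//.
  have yal : al < y w k.
    by rewrite ltNge; apply/negP => yl; move/eqP: z0; apply; rewrite tent0//; left.
  have yga : y w k < ga.
    by rewrite ltNge; apply/negP => yl; move/eqP: z0; apply; rewrite tent0//; right.
  have st : k%:R * h < t.
    rewrite ltNge; apply/negP => ts.
    have /andP[h1 _] := local_time_homo w t0 ts.
    by have := lt_le_trans yga (le_trans gt h1); rewrite ltxx.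
  rewrite distrC; apply: le_trans (g2 _ _) _; rewrite ler_wpM2l//.
  by rewrite (local_time_dist V)// ?near_hit// ltW.
rewrite -mulr_sumr [leRHS]mulrA; apply: ler_wpM2l; first exact: mulr_ge0.
exact: mass_le.
Qed.

End level.

Section limit.
Variables (al e : nat -> R) (N : nat -> nat).
Hypothesis ell_al : forall m, ell a <= al m.
Hypothesis al_ga : forall m, al m < ga.
Hypothesis al_cvg : al @ \oo --> ga.
Hypothesis e_cvg : e @ \oo --> 0.
Hypothesis e_itv : forall m, 0 <= e m <= 1.
Hypothesis N_gt0 : forall m, (0 < N m)%N.
Hypothesis N_fine : forall m,
  tent_slope (al m) ga * (T / (N m)%:R) ^+ 2 *+ N m <= e m.

Lemma level_sum_cvg w :
  level_sum (al m) (N m) w @[m --> \oo] --> at_hitting_time X ell a ga g w.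
Proof.
have [gT|Tg] := leP ga (lt T w a); last first.
  have -> : at_hitting_time X ell a ga g w = 0.
    rewrite /at_hitting_time; case E : hitting_time => [t||]//.
    exact: (hitting_time_late Tg E).
  apply: cvg_near_cst.
  move/cvgr_gt : al_cvg => /(_ _ Tg); apply: filterS => m Tm.
  by apply: level_sum_late => //; exact: ltW.
have [t [tE t_gt0 tT tga before]] := hitting_timeP gT.
rewrite /at_hitting_time tE; apply/(@cvgrPdistC_le _ R) => d0 d0_gt0.
have C1 : 0 < 4 * (C + 1) by rewrite mulr_gt0// ltr_wpDl.
(* With [e m <= delta] and [e m <= 1] the error is at most [(C + 1) * (3 * delta)], which is three
   quarters of [d0]. *)
pose delta := d0 / (4 * (C + 1)); have delta_gt0 : 0 < delta by rewrite divr_gt0.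
(* The local time at [s0] is still below [ga], hence eventually below [al m]; the weights then
   vanish before [s0]. *)
pose s0 := Num.max 0 (t - delta).
have s0t : s0 < t by rewrite /s0 gt_max t_gt0/= gtrBl.
have s0_ge0 : 0 <= s0 by rewrite le_max lexx.
move/cvgr_gt : al_cvg => /(_ _ (before _ s0_ge0 s0t)) E1.
move/cvgr_lt : e_cvg => /(_ _ delta_gt0) E2.
near=> m.
have em : e m <= delta by apply: ltW; near: m.
have am : lt s0 w a < al m by near: m.
apply: le_trans (level_sum_hit (eps := e m) (delta := delta) _ _ _ _ _ gT _ _ _) _ => //.
- exact: ltW.
- by rewrite tga.
- exact: ltW.
- move=> s s_ge0 st al_lt; rewrite leNgt; apply/negP => ts.
  have ss0 : s <= s0 by rewrite le_max; apply/orP; right; lra.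
  have /andP[h1 _] := local_time_homo w s_ge0 ss0.
  by have := lt_trans (lt_le_trans al_lt h1) am; rewrite ltxx.
have d1 : delta * (1 + e m) <= delta * 2.
  by rewrite ler_wpM2l ?(ltW delta_gt0)//; have := e_itv m; lra.
have /andP[em0 _] := e_itv m; have delta_ge0 := ltW delta_gt0.
apply: (@le_trans _ _ ((C + 1) * (3 * delta))).
  apply: ler_pM => //; [|by rewrite lerDl|by lra].
  by rewrite addr_ge0// mulr_ge0// addr_ge0.
rewrite (_ : (C + 1) * (3 * delta) = d0 * (3 / 4)); first lra.
by rewrite /delta; field; rewrite lt0r_neq0// ltr_wpDl.
Unshelve. all: by end_near. Qed.

End limit.

(** For each [m] the grid is fine enough both for Dynkin's formula and for the mass of the Riemann
    weights. The second conclusion, a bound free of [ell], serves to dominate the integrals over the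
    spins. *)
Lemma hitting_limit (al eps : nat -> R) (F F' : nat -> L -> (L -> R) -> R) :
  (forall m, ell a <= al m < ga) -> al @ \oo --> ga ->
  (forall m, 0 < eps m) -> eps @ \oo --> 0 ->
  (forall m, poisson_solution beta M
    (fun i l => (i == a)%:R * (tent (al m) ga (l a) * g l)) (eps m) (F m) (F' m)) ->
  (F m a ell)%:E @[m --> \oo] --> ('E_P[at_hitting_time X ell a ga g])%E /\
  forall m, `|F m a ell| <= C * 2 + (eps m + 1) * T.
Proof.
move=> al_itv al_cvg eps0 eps_cvg FP.
pose e (m : nat) : R := m.+1%:R^-1.
have e_gt0 m : 0 < e m by rewrite invr_gt0.
have e_itv m : 0 <= e m <= 1 by rewrite ltW//= invf_le1// ler1n.
have e_cvg : e @ \oo --> 0 by exact: cvg_harmonic.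
have al1 m : ell a <= al m by case/andP: (al_itv m).
have al2 m : al m < ga by case/andP: (al_itv m).
have T0 := horizon_gt0.
pose q m l := tent (al m) ga (l a) * g l.
have bg : blip g by exists C.
have bq m : blip (q m) by apply: blipM => //; exact: blip_tent.
have FT m w : F m (X T w) (lt T w) = 0.
  have [k Mk] := local_time_horizon w (lexx T).
  have [_ _ Fv _ _] := FP m.
  have qv : vanishes_above k M (fun i l => (i == a)%:R * (tent (al m) ga (l a) * g l)).
    by move=> i l Ml; rewrite (g_vanishes Ml) !mulr0.
  by have [Fv' _] := Fv k M (lexx M) qv; exact: Fv'.
have dyn m : exists n0, forall n, (n0 <= n)%N ->
    `|F m a ell - \int[P]_w riemann_sum ell X T a (q m) n w| <= (eps m + e m) * T.
  have [bF bF' _ [C1 HC1] Fgen] := FP m.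
  have [C2 HC2] := blip_family bF; have [C3 HC3] := blip_family bF'.
  have [C4 HC4] := bq m.
  pose D := 1 + `|C1| + `|C2| + `|C3| + `|C4|.
  have D0 : 0 < D by rewrite /D -!addrA ltr_pwDl// !addr_ge0.
  have n1 := ler_norm C1; have n2 := ler_norm C2.
  have n3 := ler_norm C3; have n4 := ler_norm C4.
  have p1 := normr_ge0 C1; have p2 := normr_ge0 C2.
  have p3 := normr_ge0 C3; have p4 := normr_ge0 C4.
  apply: (@dynkin _ _ _ _ P beta a ell X V ell_ge0 T (F m) (F' m) a (q m) D (eps m)) => //.
  - by move=> i; apply: lip_bounded_le (HC2 i) _; rewrite /D; lra.
  - by move=> i; apply: lip_bounded_le (HC3 i) _; rewrite /D; lra.
  - by apply: lip_bounded_le HC4 _; rewrite /D; lra.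
  - move=> i l s t s0 t0; apply: le_trans (HC1 _ _ _ _ s0 t0) _.
    by rewrite ler_wpM2r ?sqr_ge0//; rewrite /D; lra.
have fineN m : exists n0, forall n, (n0 <= n)%N ->
    tent_slope (al m) ga * (T / n%:R) ^+ 2 *+ n <= e m.
  pose A := tent_slope (al m) ga * T ^+ 2.
  have A0 : 0 <= A.
    rewrite mulr_ge0 ?sqr_ge0// /tent_slope mulr_ge0// divr_ge0// sqr_ge0//.
  exists (Num.truncn (A / e m)).+1 => n nA.
  have n0 : (0 < n)%N by exact: leq_ltn_trans nA.
  have nR : 0 < n%:R :> R by rewrite ltr0n.
  have -> : tent_slope (al m) ga * (T / n%:R) ^+ 2 *+ n = A / n%:R.
    by rewrite /A -mulr_natr; field; rewrite pnatr_eq0 -lt0n.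
  rewrite ler_pdivrMr// mulrC -ler_pdivrMr//.
  have /andP[_ /ltW tA] := truncn_itv (divr_ge0 A0 (ltW (e_gt0 m))).
  by apply: le_trans tA _; rewrite ler_nat.
have /choice[n1 n1P] := dyn; have /choice[n2 n2P] := fineN.
pose N m := (maxn (n1 m) (n2 m)).+1.
have N1 m : (n1 m <= N m)%N by rewrite leqW// leq_maxl.
have N2 m : (n2 m <= N m)%N by rewrite leqW// leq_maxr.
have N0 m : (0 < N m)%N by [].
pose Y m w := level_sum (al m) (N m) w.
have Ycvg w : Y m w @[m --> \oo] --> at_hitting_time X ell a ga g w.
  by apply: (@level_sum_cvg al e N) => // m; exact: n2P.
have Yle m w : `|Y m w| <= C * 2.
  have := level_sum_le (al1 m) (al2 m) (n2P m (N m) (N2 m)) w.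
  by move/le_trans; apply; rewrite ler_wpM2l//; have := e_itv m; lra.
have bY m : bounded_rv (Y m).
  by have [C4 HC4] := bq m; apply: (bounded_riemann_sum V ell_ge0 a T0 HC4).
(* Measurability is read off the convergence of the Riemann sums, so the hitting time itself need
   not be discussed. *)
have mZ : measurable_fun setT (at_hitting_time X ell a ga g).
  by apply: (measurable_fun_cvg (h := Y)) => [m|w _]; [have [] := bY m|exact: Ycvg].
have bZ : bounded_rv (at_hitting_time X ell a ga g).
  split=> //; exists C => w; have [g1 _] := g_lip.
  by rewrite /at_hitting_time; case: hitting_time => [t||]; rewrite ?normr0.
have EY : \int[P]_w Y m w @[m --> \oo] --> \int[P]_w at_hitting_time X ell a ga g w.
  have [_ ] := dominated_cvg (fun m => proj1 (bY m)) Ycvg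
    (bounded_rv_integrable P
      (@bounded_rv_cst _ _ Omega (C * 2))) Yle.
  rewrite -(bounded_rv_meanE P bZ) => /fine_cvg; apply: cvg_trans.
  by apply: near_eq_cvg; apply: nearW => m.
split; last first.
  move=> m; rewrite -(subrK (\int[P]_w Y m w) (F m a ell)) addrC.
  apply: le_trans (ler_normD _ _) _; apply: lerD.
    by rewrite -(mean_cst P (C * 2)); apply: mean_norm => //; exact: bounded_rv_cst.
  apply: le_trans (n1P m _ (N1 m)) _; apply: ler_wpM2r; first exact: ltW.
  by rewrite lerD2l; have /andP[] := e_itv m.
rewrite unlock -(bounded_rv_meanE P bZ); apply: cvg_EFin_real.
have D0 : F m a ell - \int[P]_w Y m w @[m --> \oo] --> (0 : R).
  apply: (@squeeze_cvgr _ _ _ _ (fun m => - ((eps m + e m) * T)) (fun m => (eps m + e m) * T)).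
  - by apply: nearW => m; rewrite -ler_norml; apply: n1P; exact: N1.
  - rewrite -oppr0 -[X in - X](mul0r T) -[X in X * _](addr0 0); apply: cvgN.
    by apply: cvgMl; exact: cvgD.
  - rewrite -[X in _ --> X](mul0r T) -[X in X * _](addr0 0).
    by apply: cvgMl; exact: cvgD.
rewrite -[X in _ --> X]add0r (_ : (fun m => F m a ell) =
  fun m => (F m a ell - \int[P]_w Y m w) + \int[P]_w Y m w).
  exact: cvgD.
by apply/funext => m; rewrite subrK.
Qed.

End hitting.

(** * Ward identity *)

Section coordinates.
Context {R : realType} d (T : measurableType d).
Variable mu : {sigma_finite_measure set T -> \bar R}.

Definition tupd n (y : n.-tuple T) (j : 'I_n) (x : T) : n.-tuple T :=
  [tuple if i == j then x else tnth y i | i < n].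

Lemma tnth_tupd n (y : n.-tuple T) j x i :
  tnth (tupd y j x) i = if i == j then x else tnth y i.
Proof. by rewrite tnth_mktuple. Qed.

Lemma tupd_tcons0 n x0 x (y : n.-tuple T) : tupd (tcons (x0, y)) ord0 x = tcons (x, y).
Proof.
apply: eq_from_tnth => i; rewrite tnth_tupd.
case: (unliftP ord0 i) => [k ->|->]; last by rewrite eqxx.
by rewrite eq_sym (negbTE (neq_lift _ _)) !tnthS.
Qed.

Lemma tupd_tconsS n x0 x (y : n.-tuple T) j :
  tupd (tcons (x0, y)) (lift ord0 j) x = tcons (x0, tupd y j x).
Proof.
apply: eq_from_tnth => i; rewrite tnth_tupd.
case: (unliftP ord0 i) => [k ->|->]; last by rewrite (negbTE (neq_lift _ _)).
by rewrite (inj_eq lift_inj) !tnthS tnth_tupd.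
Qed.

Lemma measurable_tupd n (y : n.-tuple T) j : measurable_fun setT (tupd y j).
Proof.
apply/measurable_fun_tnthP => i; rewrite (_ : _ \o _ = fun x => if i == j then x else tnth y i).
  by case: (i == j).
by apply/funext => x /=; rewrite tnth_tupd.
Qed.

(** Both orders of integration are recorded: the head is integrated innermost when it is the
    coordinate of interest, outermost when the induction goes on in the tail. *)
Lemma power_measure_recl n (F : n.+1.-tuple T -> \bar R) :
  measurable_fun setT F -> (forall y, (0 <= F y)%E) ->
  (\int[power_measure mu n.+1]_y F y = \int[mu]_x \int[power_measure mu n]_y F (tcons (x, y)))%E /\
  (\int[power_measure mu n.+1]_y F y = \int[power_measure mu n]_y \int[mu]_x F (tcons (x, y)))%E.
Proof.
move=> mF F0.
have mFt : measurable_fun setT (F \o @tcons _ T n).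
  exact: measurableT_comp mF (@measurable_tcons _ T n).
have E : (\int[power_measure mu n.+1]_y F y = \int[mu \x power_measure mu n]_p (F \o @tcons _ T n) p)%E.
  exact: (@ge0_integral_pushforward _ _ _ _ _ (@tcons _ T n) (@measurable_tcons _ T n) (mu \x power_measure mu n)%E setT F measurableT mF (fun y _ => F0 y)).
have Ft0 p : (0 <= (F \o @tcons _ T n) p)%E by exact: F0.
by split; rewrite E; [exact: (fubini_tonelli1 _ mFt Ft0)|exact: (fubini_tonelli2 _ mFt Ft0)].
Qed.

(** Tonelli with coordinate [j] innermost. Working with nonnegative functions avoids integrability
    conditions on the slices. *)
Lemma power_measure_coordinate n (j : 'I_n) (F G : n.-tuple T -> \bar R) :
  measurable_fun setT F -> measurable_fun setT G ->
  (forall y, (0 <= F y)%E) -> (forall y, (0 <= G y)%E) ->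
  (forall y, (\int[mu]_x F (tupd y j x) = \int[mu]_x G (tupd y j x))%E) ->
  (\int[power_measure mu n]_y F y = \int[power_measure mu n]_y G y)%E.
Proof.
elim: n j F G => [[]//|n IH] j F G mF mG F0 G0 FG.
have [F1 F2] := power_measure_recl mF F0; have [G1 G2] := power_measure_recl mG G0.
case: (unliftP ord0 j) => [k jk|j0].
  rewrite F1 G1; apply: eq_integral => x _; apply: (IH k) => //.
  - exact: measurableT_comp mF (measurableT_comp (@measurable_tcons _ T n) (measurable_pair1 x)).
  - exact: measurableT_comp mG (measurableT_comp (@measurable_tcons _ T n) (measurable_pair1 x)).
  - move=> y; have := FG (tcons (x, y)); rewrite jk.
    by under eq_integral do rewrite tupd_tconsS; under [X in _ = X -> _]eq_integral do rewrite tupd_tconsS.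
rewrite F2 G2; apply: eq_integral => y _.
have := FG (tcons (point, y)); rewrite j0.
by under eq_integral do rewrite tupd_tcons0; under [X in _ = X -> _]eq_integral do rewrite tupd_tcons0.
Qed.

Lemma measurable_tuple_box n (A : set T) : measurable A ->
  measurable [set y : n.-tuple T | forall i, A (tnth y i)].
Proof.
move=> mA; rewrite (_ : mkset _ = \bigcap_(i in [set: 'I_n]) ((fun y => tnth y i) @^-1` A)).
  apply: fin_bigcap_measurable => // i _; rewrite -[X in measurable X]setTI.
  exact: measurable_tnth.
by apply/seteqP; split=> y h i; [move=> _|]; exact: h.
Qed.

Lemma power_measure_box n (A : set T) : measurable A -> (mu A < +oo)%E ->
  (power_measure mu n [set y | forall i, A (tnth y i)] < +oo)%E.
Proof.
move=> mA Afin; elim: n => [|n IH].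
  by rewrite /power_measure /= diracE; case: (_ \in _); rewrite ltry.
have mB : measurable [set y : n.-tuple T | forall i, A (tnth y i)] by exact: measurable_tuple_box.
rewrite (_ : power_measure _ _ _ = (mu A * power_measure mu n [set y | forall i, A (tnth y i)])%E).
  by rewrite lte_mul_pinfty// ge0_fin_numE.
rewrite -product_measure1E//; congr ((mu \x _)%E _).
apply/seteqP; split=> [[x y] h|[x y] [/= h1 h2] i] /=.
  split=> [|i]; first exact: (h ord0).
  by have := h (lift ord0 i); rewrite tnthS.
by case: (unliftP ord0 i) => [k ->|->]; rewrite ?tnthS//; exact: h1.
Qed.

End coordinates.

Lemma is_derive_sumr {R : realType} (I : Type) (r : seq I) (F : I -> R -> R)
    (D : I -> R) (x : R) :
  (forall i, is_derive x 1 (F i) (D i)) ->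
  is_derive x 1 (fun t => \sum_(i <- r) F i t) (\sum_(i <- r) D i).
Proof.
move=> FD; elim: r => [|i r IH].
  under [X in is_derive _ _ X _]eq_fun do rewrite big_nil.
  by rewrite big_nil; exact: is_derive_cst.
under [X in is_derive _ _ X _]eq_fun do rewrite big_cons.
by rewrite big_cons; exact: is_deriveD.
Qed.

(** * The Hamiltonian along the motion of one spin *)

Section hamiltonian_derivative.
Context {R : realType} {L : finType} {n : nat}.
Notation vec := ('rV[R]_n.+2).
Variable beta : L -> L -> R.
Hypothesis beta_sym : forall i j, beta i j = beta j i.
Implicit Types (u : L -> vec) (p w : vec).

(** Vectors have size [n.+2], that is, spins live in a hyperbolic space of positive dimension, so
    [inord 1] is a genuine spatial index. *)
Lemma xcoordE w : xcoord w = w 0 (lift ord0 ord0).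
Proof. by rewrite /xcoord; congr (w 0 _); apply: val_inj; rewrite /= inordK. Qed.

Lemma minkowskiE w : Defs.minkowski w w = - zcoord w ^+ 2 + xcoord w ^+ 2
  + \sum_(k < n) w 0 (lift ord0 (lift ord0 k)) ^+ 2.
Proof. by rewrite /Defs.minkowski big_ord_recl -xcoordE addrA -!expr2. Qed.

Definition upd_site u i p : L -> vec := fun k => if k == i then p else u k.

(* The derivative of the Hamiltonian along the boost generator
   [z_i d/dx_i + x_i d/dz_i] acting on the spin at [i]. *)
Definition boost_hamiltonian i u : R :=
  \sum_l beta i l * (zcoord (u l) * xcoord (u i) - xcoord (u l) * zcoord (u i)).

Section curve.
Variables (gam : R -> vec) (kap : R -> R) (u : L -> vec) (i : L) (t : R).
Hypothesis gam_z : is_derive t 1 (fun s => zcoord (gam s)) (kap t * xcoord (gam t)).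
Hypothesis gam_x : is_derive t 1 (fun s => xcoord (gam s)) (kap t * zcoord (gam t)).
Hypothesis gam_rest : forall s k, gam s 0 (lift ord0 (lift ord0 k)) = gam t 0 (lift ord0 (lift ord0 k)).

Let c s := upd_site u i (gam s).

Let dz k : is_derive t 1 (fun s => zcoord (c s k)) ((k == i)%:R * (kap t * xcoord (gam t))).
Proof.
rewrite /c /upd_site; case: eqP => _; first by rewrite mul1r.
by rewrite mul0r; exact: is_derive_cst.
Qed.

Let dx k : is_derive t 1 (fun s => xcoord (c s k)) ((k == i)%:R * (kap t * zcoord (gam t))).
Proof.
rewrite /c /upd_site; case: eqP => _; first by rewrite mul1r.
by rewrite mul0r; exact: is_derive_cst.
Qed.

Let rest k l : R := \sum_(j < n) (c t k - c t l) 0 (lift ord0 (lift ord0 j)) ^+ 2.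

Let hamiltonianE s : hamiltonian beta (c s) = 4^-1 * \sum_k \sum_l beta k l *
   (- (zcoord (c s k) - zcoord (c s l)) ^+ 2 + (xcoord (c s k) - xcoord (c s l)) ^+ 2 + rest k l).
Proof.
congr (_ * _); apply: eq_bigr => k _; apply: eq_bigr => l _.
rewrite minkowskiE /rest; congr (_ * (_ + _)).
  by rewrite /zcoord /xcoord !mxE.
apply: eq_bigr => j _; rewrite !mxE /c /upd_site.
by do 2 case: ifP => _; rewrite // ?gam_rest// (gam_rest s).
Qed.

(** [kap] is the speed in units of the boost generator: it is [1 / z] along a coordinate line of the
    hyperboloid and [s] along the orbit of the pinned spin, so one computation serves both. *)
Lemma is_derive_hamiltonian : is_derive t 1 (fun s => hamiltonian beta (c s))
  (kap t * boost_hamiltonian i (c t)).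
Proof.
rewrite (_ : (fun s => _) = (fun s => 4^-1 * \sum_k \sum_l beta k l *
   (- (zcoord (c s k) - zcoord (c s l)) ^+ 2 + (xcoord (c s k) - xcoord (c s l)) ^+ 2 + rest k l))); last first.
  by apply/funext => s; exact: hamiltonianE.
pose m k l : R := kap t * (- (zcoord (c t k) - zcoord (c t l)) * xcoord (gam t)
  + (xcoord (c t k) - xcoord (c t l)) * zcoord (gam t)).
have D k l : is_derive t 1 (fun s => beta k l * (- (zcoord (c s k) - zcoord (c s l)) ^+ 2
     + (xcoord (c s k) - xcoord (c s l)) ^+ 2 + rest k l))
     (2 * beta k l * ((k == i)%:R - (l == i)%:R) * m k l).
  have dzk := dz k; have dzl := dz l; have dxk := dx k; have dxl := dx l.
  apply: is_derive_eq.
  rewrite /GRing.scale/= /m; ring.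
have D2 := is_derive_sumr (index_enum L) (fun k => is_derive_sumr (index_enum L) (fun l => D k l)).
have D3 := @is_deriveZ _ _ _ _ 4^-1 _ _ _ D2.
apply: is_derive_eq.
rewrite /GRing.scale/=.
have sum_delta (f : L -> R) : \sum_k (k == i)%:R * f k = f i.
  rewrite (bigD1 i)//= eqxx mul1r big1 ?addr0// => k /negbTE ->.
  by rewrite mul0r.
have -> : \sum_k \sum_l 2 * beta k l * ((k == i)%:R - (l == i)%:R) * m k l =
   \sum_l 2 * beta i l * m i l - \sum_k 2 * beta k i * m k i.
  rewrite -(sum_delta (fun k => \sum_l 2 * beta k l * m k l)).
  rewrite -sumrB; apply: eq_bigr => k _.
  rewrite -(sum_delta (fun l => 2 * beta k l * m k l)) mulr_sumr -sumrB.
  by apply: eq_bigr => l _; ring.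
rewrite -sumrB !mulr_sumr; apply: eq_bigr => l _.
rewrite (beta_sym l i) /m.
have -> : zcoord (gam t) = zcoord (c t i) by rewrite /c /upd_site eqxx.
have -> : xcoord (gam t) = xcoord (c t i) by rewrite /c /upd_site eqxx.
by field.
Qed.

End curve.

End hamiltonian_derivative.

Section ward_integrand.
Context {R : realType} {L : finType} {n : nat}.
Notation vec := ('rV[R]_n.+2).
Variable beta : L -> L -> R.
Hypothesis beta_sym : forall i j, beta i j = beta j i.
Implicit Types (u : L -> vec) (p w : vec).

Definition zvec u : L -> R := fun k => zcoord (u k).

Lemma zvec_upd u i p : zvec (upd_site u i p) = upd (zvec u) i (zcoord p).
Proof. by apply/funext => k; rewrite /zvec /upd_site /upd; case: eqP. Qed.

Variables (F F' : L -> (L -> R) -> R) (C : R).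
Hypothesis F_quad : forall i l s t, 0 <= s -> 0 <= t ->
  `|F i (upd l i t) - F i (upd l i s) - (t - s) * F' i (upd l i s)|
    <= C * (t - s) ^+ 2.

(** The boost generator at [i] applied to [F i (z) * exp(- H)], written out with [F'] in place of
    the derivative of [F i]. *)
Definition ward i u : R := (xcoord (u i) * F' i (zvec u)
  - F i (zvec u) * boost_hamiltonian beta i u) * expR (- hamiltonian beta u).

Lemma is_derive_F i l (t : R) : 0 < t -> is_derive t 1 (fun s => F i (upd l i s)) (F' i (upd l i t)).
Proof.
move=> t0; apply: (@is_derive_quadratic _ _ _ _ C); exists t => // s st.
apply: F_quad; first exact: ltW.
by move: st; rewrite ltr_norml => /andP[]; lra.
Qed.

Lemma is_derive_ward (gam : R -> vec) (kap : R -> R) u i (t : R) :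
  is_derive t 1 (fun s => zcoord (gam s)) (kap t * xcoord (gam t)) ->
  is_derive t 1 (fun s => xcoord (gam s)) (kap t * zcoord (gam t)) ->
  (forall s k, gam s 0 (lift ord0 (lift ord0 k)) = gam t 0 (lift ord0 (lift ord0 k))) ->
  0 < zcoord (gam t) ->
  is_derive t 1 (fun s => F i (zvec (upd_site u i (gam s))) *
    expR (- hamiltonian beta (upd_site u i (gam s))))
    (kap t * ward i (upd_site u i (gam t))).
Proof.
move=> dz dx rest z0.
have dH := is_derive_hamiltonian beta_sym u i dz dx rest.
set v := upd_site u i (gam t) in dH *.
have dF : is_derive t 1 (fun s => F i (zvec (upd_site u i (gam s))))
    (F' i (zvec v) * (kap t * xcoord (gam t))).
  rewrite (_ : (fun s => _) = (fun x => F i (upd (zvec u) i x)) \o (fun s => zcoord (gam s))); last first.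
    by apply/funext => s /=; rewrite zvec_upd.
  rewrite zvec_upd; apply: is_derive1_comp; exact: is_derive_F.
have dE : is_derive t 1 (fun s => expR (- hamiltonian beta (upd_site u i (gam s))))
    (- (kap t * boost_hamiltonian beta i v) * expR (- hamiltonian beta v)).
  apply: is_derive_eq; rewrite /GRing.scale/=; ring.
apply: (is_derive_eq (is_deriveM dF dE)).
rewrite /GRing.scale/= /ward.
have -> : xcoord (v i) = xcoord (gam t) by rewrite /v /upd_site eqxx.
by rewrite -/v; ring.
Qed.

(* Summed over all sites, the Hamiltonian terms turn into the jump part of
   the generator. *)
Lemma sum_ward u : \sum_i ward i u = expR (- hamiltonian beta u) *
  \sum_i xcoord (u i) * (F' i (zvec u)
     + \sum_j beta i j * zvec u j * (F j (zvec u) - F i (zvec u))).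
Proof.
rewrite /ward -mulr_suml mulrC; congr (_ * _).
transitivity (\sum_i xcoord (u i) * F' i (zvec u) +
   \sum_i xcoord (u i) * \sum_j beta i j * zvec u j * (F j (zvec u) - F i (zvec u))); last first.
  by rewrite -big_split/=; apply: eq_bigr => i _; rewrite mulrDr.
rewrite sumrB; congr (_ + _).
pose G i j := beta i j * xcoord (u i) * zvec u j * F i (zvec u).
pose K i j := beta i j * xcoord (u j) * zvec u i * F i (zvec u).
transitivity (- \sum_i \sum_j G i j + \sum_i \sum_j K i j).
  rewrite -sumrN -sumrN -big_split/=; apply: eq_bigr => i _.
  rewrite /boost_hamiltonian mulr_sumr -!sumrN -big_split/=.
  by apply: eq_bigr => j _; rewrite /G /K /zvec; ring.
rewrite addrC [X in X + _]exchange_big/= -sumrB.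
apply: eq_bigr => i _; rewrite mulr_sumr -sumrB; apply: eq_bigr => j _.
by rewrite /G /K (beta_sym j i); ring.
Qed.

End ward_integrand.

(** * Boosts and coordinate lines on the hyperboloid *)

Section hyperbolic_curves.
Context {R : realType} {n : nat}.
Notation vec := ('rV[R]_n.+2).
Implicit Types (v : n.+1.-tuple R) (u : vec) (s t x : R).

Lemma cosh_sqr s : cosh s ^+ 2 = 1 + sinh s ^+ 2.
Proof.
have E : expR s * expR (- s) = 1 by rewrite expRN divff// lt0r_neq0// expR_gt0.
rewrite /cosh /sinh; set a := expR s in E *; set b := expR (- s) in E *.
have -> : ((a + b) / 2) ^+ 2 = a * b + ((a - b) / 2) ^+ 2 by field.
by rewrite E.
Qed.

Lemma cosh_gt0 s : 0 < cosh s.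
Proof. by rewrite /cosh divr_gt0// addr_gt0// expR_gt0. Qed.

Lemma is_derive_cosh x : is_derive x 1 (@cosh R) (sinh x).
Proof. by rewrite /cosh; apply: is_derive_eq; rewrite /sinh /GRing.scale/=; field. Qed.

Lemma is_derive_sinh x : is_derive x 1 (@sinh R) (cosh x).
Proof. by rewrite /sinh; apply: is_derive_eq; rewrite /cosh /GRing.scale/=; field. Qed.

Lemma zcoord_boost s u : zcoord (boost s u) = xcoord u * sinh s + zcoord u * cosh s.
Proof. by rewrite /zcoord /boost mxE eqxx. Qed.

Lemma xcoord_boost s u : xcoord (boost s u) = xcoord u * cosh s + zcoord u * sinh s.
Proof. by rewrite [LHS]xcoordE /boost mxE -!val_eqE/= inordK. Qed.

Lemma rest_boost s u k : boost s u 0 (lift ord0 (lift ord0 k)) = u 0 (lift ord0 (lift ord0 k)).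
Proof. by rewrite /boost mxE -!val_eqE/= inordK. Qed.

Lemma zcoord_origin : zcoord (hyp_origin : vec) = 1.
Proof. by rewrite /zcoord mxE eqxx. Qed.

Lemma xcoord_origin : xcoord (hyp_origin : vec) = 0.
Proof. by rewrite /xcoord mxE -val_eqE/= inordK. Qed.

Lemma boost0 u : boost 0 u = u.
Proof.
have c0 : cosh (0 : R) = 1 by rewrite /cosh oppr0 expR0; field.
have s0 : sinh (0 : R) = 0 by rewrite /sinh oppr0 expR0; field.
apply/rowP => k; rewrite /boost mxE c0 s0 !mulr0 !mulr1 add0r addr0.
case: eqP => [->//|_]; case: eqP => [->|//].
by rewrite /xcoord.
Qed.

Lemma zcoord_boost_origin s : zcoord (boost s (hyp_origin : vec)) = cosh s.
Proof. by rewrite zcoord_boost zcoord_origin xcoord_origin mul0r mul1r add0r. Qed.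

Lemma xcoord_boost_origin s : xcoord (boost s (hyp_origin : vec)) = sinh s.
Proof. by rewrite xcoord_boost zcoord_origin xcoord_origin mul0r mul1r add0r. Qed.

Lemma hyperboloid_zx u : hyperboloid u -> 1 + xcoord u ^+ 2 <= zcoord u ^+ 2 /\ 0 < zcoord u.
Proof.
move=> [uu u0]; split=> //; move: uu; rewrite minkowskiE => uu.
have : 0 <= \sum_(k < n) u 0 (lift ord0 (lift ord0 k)) ^+ 2.
  by apply: sumr_ge0 => k _; exact: sqr_ge0.
lra.
Qed.

Lemma hyperboloid_z_ge1 u : hyperboloid u -> 1 <= zcoord u.
Proof.
move=> /hyperboloid_zx[uu u0].
rewrite -(@ler_pXn2r _ 2)// ?nnegrE// ?(ltW u0)//.
by rewrite expr1n; have := sqr_ge0 (xcoord u); lra.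
Qed.

Lemma hyperboloid_x_le u : hyperboloid u -> `|xcoord u| <= zcoord u.
Proof.
move=> /hyperboloid_zx[uu u0].
rewrite -(@ler_pXn2r _ 2)// ?nnegrE ?(ltW u0)//.
by rewrite real_normK ?num_real//; lra.
Qed.

Lemma hyperboloid_origin : hyperboloid (hyp_origin : vec).
Proof.
split; last by rewrite -/(zcoord _) zcoord_origin.
rewrite minkowskiE zcoord_origin xcoord_origin big1 => [|k _]; first by ring.
by rewrite mxE -val_eqE/= expr0n.
Qed.

Lemma minkowski_boost s u : Defs.minkowski (boost s u) (boost s u) = Defs.minkowski u u.
Proof.
rewrite !minkowskiE zcoord_boost xcoord_boost; congr (_ + _); last first.
  by apply: eq_bigr => k _; rewrite rest_boost.
have := cosh_sqr s; set c := cosh s; set h := sinh s => ch.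
have -> : - (xcoord u * h + zcoord u * c) ^+ 2 + (xcoord u * c + zcoord u * h) ^+ 2 =
  (c ^+ 2 - h ^+ 2) * (- zcoord u ^+ 2 + xcoord u ^+ 2) by ring.
by rewrite ch addrK mul1r.
Qed.

Lemma boostB s u w : boost s (u - w) = boost s u - boost s w.
Proof.
apply/rowP => k; rewrite !mxE /xcoord /zcoord !mxE.
by case: eqP => _; [|case: eqP => _]; ring.
Qed.

Lemma hyperboloid_boost s u : hyperboloid u -> hyperboloid (boost s u).
Proof.
move=> uH; have [uu u0] := hyperboloid_zx uH; have xz := hyperboloid_x_le uH.
split; first by rewrite minkowski_boost; case: uH.
rewrite -/(zcoord _) zcoord_boost.
have sc : `|sinh s| < cosh s.
  rewrite -(@ltr_pXn2r _ 2)// ?nnegrE ?(ltW (cosh_gt0 s))//.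
  by rewrite real_normK ?num_real// cosh_sqr ltrDr.
have : `|xcoord u * sinh s| < zcoord u * cosh s.
  rewrite normrM; apply: le_lt_trans (_ : zcoord u * `|sinh s| < _); first by rewrite ler_wpM2r.
  by rewrite ltr_pM2l.
by rewrite ltr_norml => /andP[h _]; lra.
Qed.

Lemma is_derive_boost_z u s t : is_derive t 1 (fun r => zcoord (boost (s * r) u)) (s * xcoord (boost (s * t) u)).
Proof.
under [X in is_derive _ _ X _]eq_fun do rewrite zcoord_boost.
have hs : is_derive t 1 (fun r : R => sinh (s * r)) (cosh (s * t) * s).
  by apply: (@is_derive1_comp _ (@sinh R) (fun r => s * r)); [exact: is_derive_sinh|apply: is_derive_eq; rewrite /GRing.scale/=; ring].
have hc : is_derive t 1 (fun r : R => cosh (s * r)) (sinh (s * t) * s).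
  by apply: (@is_derive1_comp _ (@cosh R) (fun r => s * r)); [exact: is_derive_cosh|apply: is_derive_eq; rewrite /GRing.scale/=; ring].
by apply: is_derive_eq; rewrite xcoord_boost /GRing.scale/=; ring.
Qed.

Lemma is_derive_boost_x u s t : is_derive t 1 (fun r => xcoord (boost (s * r) u)) (s * zcoord (boost (s * t) u)).
Proof.
under [X in is_derive _ _ X _]eq_fun do rewrite xcoord_boost.
have hs : is_derive t 1 (fun r : R => sinh (s * r)) (cosh (s * t) * s).
  by apply: (@is_derive1_comp _ (@sinh R) (fun r => s * r)); [exact: is_derive_sinh|apply: is_derive_eq; rewrite /GRing.scale/=; ring].
have hc : is_derive t 1 (fun r : R => cosh (s * r)) (sinh (s * t) * s).
  by apply: (@is_derive1_comp _ (@cosh R) (fun r => s * r)); [exact: is_derive_cosh|apply: is_derive_eq; rewrite /GRing.scale/=; ring].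
by apply: is_derive_eq; rewrite zcoord_boost /GRing.scale/=; ring.
Qed.

Lemma hyp_point_hyperboloid v : hyperboloid (hyp_point v).
Proof. by rewrite -hyp_pointP; exists v. Qed.

Lemma zcoord_hyp_point v : zcoord (hyp_point v) = Num.sqrt (1 + \sum_(j < n.+1) tnth v j ^+ 2).
Proof. by rewrite /zcoord mxE unlift_none. Qed.

Lemma hyp_point_lift v j : hyp_point v 0 (lift ord0 j) = tnth v j.
Proof. by rewrite mxE liftK. Qed.

Lemma xcoord_hyp_point v : xcoord (hyp_point v) = tnth v ord0.
Proof. by rewrite xcoordE hyp_point_lift. Qed.

Lemma hyp_point_coord_le v j : `|tnth v j| <= zcoord (hyp_point v).
Proof.
rewrite zcoord_hyp_point -sqrtr_sqr ler_sqrt; last first.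
  by rewrite addr_ge0// sumr_ge0// => k _; exact: sqr_ge0.
rewrite (bigD1 j)//= addrCA lerDl addr_ge0// sumr_ge0// => k _; exact: sqr_ge0.
Qed.

Lemma zcoord_hyp_point_tupd v x : zcoord (hyp_point (tupd v ord0 x)) =
  Num.sqrt (x ^+ 2 + (1 + \sum_(j < n) tnth v (lift ord0 j) ^+ 2)).
Proof.
rewrite zcoord_hyp_point big_ord_recl tnth_tupd eqxx addrCA; congr (Num.sqrt (_ + (_ + _))).
by apply: eq_bigr => j _; rewrite tnth_tupd eq_sym (negbTE (neq_lift _ _)).
Qed.

(** The factor 1 / z is the speed [kap] of the line and also the density of du; this coincidence is
    why the boost generator integrates to zero against du. *)
Lemma is_derive_hyp_point_z v (t : R) : is_derive t 1 (fun x => zcoord (hyp_point (tupd v ord0 x)))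
  ((zcoord (hyp_point (tupd v ord0 t)))^-1 * xcoord (hyp_point (tupd v ord0 t))).
Proof.
rewrite xcoord_hyp_point tnth_tupd eqxx.
under [X in is_derive _ _ X _]eq_fun do rewrite zcoord_hyp_point_tupd.
rewrite zcoord_hyp_point_tupd; set c := 1 + _.
have c0 : 0 < c.
  by rewrite /c ltr_pwDl// sumr_ge0// => k _; exact: sqr_ge0.
have tc : 0 < t ^+ 2 + c by rewrite ltr_wpDl// sqr_ge0.
have d1 : is_derive t 1 (fun x : R => x ^+ 2 + c) (2 * t).
  by apply: is_derive_eq; rewrite /GRing.scale/=; ring.
have D := @is_derive1_comp _ Num.sqrt (fun x : R => x ^+ 2 + c) t _ _ (is_derive1_sqrt tc) d1.
apply: (is_derive_eq D); field.
by rewrite lt0r_neq0// sqrtr_gt0.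
Qed.

Lemma is_derive_hyp_point_x v (t : R) : is_derive t 1 (fun x => xcoord (hyp_point (tupd v ord0 x)))
  ((zcoord (hyp_point (tupd v ord0 t)))^-1 * zcoord (hyp_point (tupd v ord0 t))).
Proof.
under [X in is_derive _ _ X _]eq_fun do rewrite xcoord_hyp_point tnth_tupd eqxx.
rewrite mulVf; first exact: is_derive_id.
by have [_ /lt0r_neq0] := hyperboloid_zx (hyp_point_hyperboloid (tupd v ord0 t)).
Qed.

Lemma hyp_point_rest v x t k : hyp_point (tupd v ord0 x) 0 (lift ord0 (lift ord0 k)) =
  hyp_point (tupd v ord0 t) 0 (lift ord0 (lift ord0 k)).
Proof. by rewrite !hyp_point_lift !tnth_tupd eq_sym (negbTE (neq_lift _ _)). Qed.

End hyperbolic_curves.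

(** * Configurations with a pinned spin *)

Section configurations.
Context {R : realType} {L : finType} {n : nat}.
Notation vec := ('rV[R]_n.+2).
Variables (beta : L -> L -> R) (a : L).
Hypothesis beta_ge0 : forall i j, 0 <= beta i j.
Notation Y := (#|free_site a|.-tuple (n.+1.-tuple R)).
Notation mu := (@lebesgue_measure R).
Notation m := (power_measure (power_measure mu n.+1) #|free_site a|).
Implicit Types (y : Y) (r M : R).

(** The boost [r] of the pinned spin is a parameter because the Ward identity moves this spin from
    [r = 0] to [r = s]. *)
Definition cfg r y : L -> vec := @pinned_config R L n.+1 a (boost r hyp_origin) y.

Definition site (i : L) (ia : i != a) : 'I_#|free_site a| :=
  enum_rank (Sub i ia : free_site a).

Lemma cfg_pinned r y : cfg r y a = boost r hyp_origin.
Proof. by rewrite /cfg /pinned_config insubF ?eqxx. Qed.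

Lemma cfg_site r y i (ia : i != a) : cfg r y i = hyp_point (tnth y (site ia)).
Proof. by rewrite /cfg /pinned_config insubT. Qed.

Lemma hyperboloid_cfg r y i : hyperboloid (cfg r y i).
Proof.
have [->|ia] := eqVneq i a.
  by rewrite cfg_pinned; exact/hyperboloid_boost/hyperboloid_origin.
by rewrite cfg_site; exact: hyp_point_hyperboloid.
Qed.

Lemma cfg_r r r' y : cfg r y = upd_site (cfg r' y) a (boost r hyp_origin).
Proof.
apply/funext => i; rewrite /upd_site; case: eqP => [->|/eqP ia].
  exact: cfg_pinned.
by rewrite !cfg_site.
Qed.

(** Only the x-coordinate of one spin moves: in these coordinates the boost generator is z d/dx. *)
Definition yupd (j : 'I_#|free_site a|) y (x : R) : Y := tupd y j (tupd (tnth y j) ord0 x).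

Lemma cfg_yupd r y i (ia : i != a) x : cfg r (yupd (site ia) y x) =
  upd_site (cfg r y) i (hyp_point (tupd (tnth y (site ia)) ord0 x)).
Proof.
apply/funext => k; rewrite /upd_site; case: eqP => [->|/eqP ki].
  by rewrite (cfg_site _ _ ia) tnth_tupd eqxx.
have [->|ka] := eqVneq k a; first by rewrite !cfg_pinned.
rewrite !cfg_site tnth_tupd (inj_eq enum_rank_inj) -val_eqE/=.
by rewrite (negbTE ki).
Qed.

(** The pinned site is not in the product, so the choice of 0 as boost parameter is immaterial
    ([yweightE]). *)
Definition yweight (y : Y) : R := \prod_(i | i != a) (zcoord (cfg 0 y i))^-1.

Lemma yweightE r y : \prod_(i | i != a) (zcoord (cfg r y i))^-1 = yweight y.
Proof. by apply: eq_bigr => i ia; rewrite !cfg_site. Qed.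

Lemma yweight_yupd y i (ia : i != a) x : yweight (yupd (site ia) y x) =
  (\prod_(k | (k != a) && (k != i)) (zcoord (cfg 0 y k))^-1) /
  zcoord (hyp_point (tupd (tnth y (site ia)) ord0 x)).
Proof.
rewrite /yweight cfg_yupd (bigD1 i)//= {1}/upd_site eqxx mulrC; congr (_ * _).
by apply: eq_bigr => k /andP[_ ki]; rewrite /upd_site (negbTE ki).
Qed.

Lemma yweight_itv y : 0 <= yweight y <= 1.
Proof.
rewrite /yweight; apply: (big_ind (fun x : R => 0 <= x <= 1)) => [|x x' /andP[x0 x1] /andP[x0' x1']|i _].
- by rewrite ler01 lexx.
- by rewrite mulr_ge0//= mulr_ile1.
have z1 := hyperboloid_z_ge1 (hyperboloid_cfg 0 y i).
have z0 := lt_le_trans ltr01 z1.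
by rewrite invr_ge0 (ltW z0)/= invf_le1.
Qed.

Lemma measurable_cosh : measurable_fun setT (@cosh R).
Proof.
by apply: continuous_measurable_fun; exact: is_derive_continuous is_derive_cosh.
Qed.

Lemma measurable_sinh : measurable_fun setT (@sinh R).
Proof.
by apply: continuous_measurable_fun; exact: is_derive_continuous is_derive_sinh.
Qed.

Section measurable_hamiltonian.
Context d (T : measurableType d) (c : T -> L -> vec).
Hypothesis mc : forall i k, measurable_fun setT (fun t => c t i 0 k).

Lemma measurable_hamiltonian : measurable_fun setT (fun t => hamiltonian beta (c t)).
Proof.
rewrite /hamiltonian; apply: measurable_funM => //.
apply: measurable_sum => i; apply: measurable_sum => j; apply: measurable_funM => //.
rewrite /Defs.minkowski.
have md k : measurable_fun setT (fun t => (c t i - c t j) 0 k).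
  by under [X in measurable_fun _ X]eq_fun do rewrite !mxE; exact: measurable_funB.
apply: measurable_funD.
  by apply: measurableT_comp => //; apply: measurable_funM.
by apply: measurable_sum => k; exact: measurable_funM.
Qed.

Lemma measurable_gibbs : measurable_fun setT (fun t => expR (- hamiltonian beta (c t))).
Proof.
apply: (measurableT_comp (@measurable_expR R)); apply: measurableT_comp => //.
exact: measurable_hamiltonian.
Qed.

End measurable_hamiltonian.

Section measurability.
Context d (T : measurableType d) (rho : T -> R) (eta : T -> Y).
Hypothesis mrho : measurable_fun setT rho.
Hypothesis meta : measurable_fun setT eta.

Lemma measurable_cfg i k : measurable_fun setT (fun t => cfg (rho t) (eta t) i 0 k).
Proof.
have [->|ia] := eqVneq i a.
  under [X in measurable_fun _ X]eq_fun do rewrite cfg_pinned /boost mxE zcoord_origin xcoord_origin !mul0r !mul1r !add0r.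
  case: eqP => _; first exact: measurableT_comp measurable_cosh mrho.
  case: eqP => _; first exact: measurableT_comp measurable_sinh mrho.
  exact: measurable_cst.
under [X in measurable_fun _ X]eq_fun do rewrite cfg_site.
have mt j : measurable_fun setT (fun t => tnth (tnth (eta t) (site ia)) j).
  apply: (measurableT_comp (measurable_tnth j)).
  exact: (measurableT_comp (measurable_tnth (site ia)) meta).
have [[j kj]|k0] : (exists j, k = lift ord0 j) \/ k = ord0.
  by case: (unliftP ord0 k) => [j|] ->; [left; exists j|right].
  rewrite kj; apply: (eq_measurable_fun (fun t => tnth (tnth (eta t) (site ia)) j)) => // t _.
  by rewrite hyp_point_lift.
rewrite k0; apply: (eq_measurable_fun (fun t => Num.sqrt (1 + \sum_(j < n.+1) tnth (tnth (eta t) (site ia)) j ^+ 2))) => [t _|].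
  by rewrite -/(zcoord _) zcoord_hyp_point.
have msqrt : measurable_fun setT (@Num.sqrt R).
  by apply: continuous_measurable_fun; exact: sqrt_continuous.
apply: (measurableT_comp msqrt).
apply: measurable_funD => //; apply: measurable_sum => j.
exact: measurable_funX.
Qed.

Lemma measurable_zcfg i : measurable_fun setT (fun t => zcoord (cfg (rho t) (eta t) i)).
Proof. exact: measurable_cfg. Qed.

Lemma measurable_xcfg i : measurable_fun setT (fun t => xcoord (cfg (rho t) (eta t) i)).
Proof. exact: measurable_cfg. Qed.

Lemma measurable_yweight : measurable_fun setT (fun t => yweight (eta t)).
Proof.
rewrite (_ : (fun t => _) = fun t =>
    \prod_i (if i != a then zcoord (cfg (rho t) (eta t) i) `^ (-1) else 1)); last first.
  apply/funext => t; rewrite -(yweightE (rho t)) big_mkcond/=; apply: eq_bigr => i _.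
  case: eqP => //= _; rewrite powR_inv1// ltW//.
  by have [] := hyperboloid_zx (hyperboloid_cfg (rho t) (eta t) i).
apply: measurable_prod => i _; case: eqP => //= _.
exact: (measurableT_comp (measurable_powR (-1)) (measurable_zcfg i)).
Qed.

Lemma measurable_zvec F : blip F -> measurable_fun setT (fun t => F (zvec (cfg (rho t) (eta t)))).
Proof. by move=> bF; apply: blip_measurable => // k; exact: measurable_zcfg. Qed.

End measurability.

(** Outside this box some z-coordinate is at least [M], where the integrands vanish; integrability
    thus reduces to boundedness on a set of finite measure. *)
Definition ybox M : set Y := [set y | forall j, [set v : n.+1.-tuple R | forall k, `[- M, M]%classic (tnth v k)] (tnth y j)].

Lemma measurable_ybox M : measurable (ybox M).
Proof. by apply: measurable_tuple_box; apply: measurable_tuple_box; exact: measurable_itv. Qed.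

Lemma ybox_fin M : (m (ybox M) < +oo)%E.
Proof.
apply: power_measure_box; first by apply: measurable_tuple_box; exact: measurable_itv.
by apply: power_measure_box; [exact: measurable_itv|exact: lebesgue_itv_fin].
Qed.

Lemma notin_ybox M r y : ~ ybox M y -> exists i, M <= zcoord (cfg r y i).
Proof.
move=> /existsNP[j] /existsNP[k] H.
pose i := val (enum_val j); have ia : i != a := valP (enum_val j).
exists i; rewrite (cfg_site r y ia).
have -> : site ia = j.
  by rewrite /site (_ : Sub i ia = enum_val j) ?enum_valK//; exact: val_inj.
rewrite leNgt; apply/negP => zM; apply: H => /=.
rewrite in_itv/= -ler_norml; apply: ltW; apply: le_lt_trans zM.
exact: hyp_point_coord_le.
Qed.

(** Only the time components can make H negative, and differences of numbers in (0, M] have square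
    at most M^2. H is in fact nonnegative, but this crude bound is enough. *)
Lemma gibbs_le M r y : (forall i, zcoord (cfg r y i) <= M) ->
  expR (- hamiltonian beta (cfg r y)) <= expR (4^-1 * \sum_i \sum_j beta i j * M ^+ 2).
Proof.
move=> zM; rewrite ler_expR /hamiltonian -mulrN ler_wpM2l ?invr_ge0// -sumrN.
apply: ler_sum => i _; rewrite -sumrN; apply: ler_sum => j _.
rewrite -mulrN ler_wpM2l// minkowskiE !opprD !opprK.
have -> : zcoord (cfg r y i - cfg r y j) = zcoord (cfg r y i) - zcoord (cfg r y j).
  by rewrite /zcoord !mxE.
have zpos k : 0 < zcoord (cfg r y k) by have [] := hyperboloid_zx (hyperboloid_cfg r y k).
have z1 := zpos i; have z2 := zpos j.
have : 0 <= \sum_(k < n) (cfg r y i - cfg r y j) 0 (lift ord0 (lift ord0 k)) ^+ 2.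
  by apply: sumr_ge0 => k _; exact: sqr_ge0.
have := sqr_ge0 (xcoord (cfg r y i - cfg r y j)).
have : (zcoord (cfg r y i) - zcoord (cfg r y j)) ^+ 2 <= M ^+ 2.
  rewrite -[leLHS]real_normK ?num_real// ler_pXn2r ?nnegrE//.
    by have := zM i; have := zM j; rewrite ler_norml; lra.
  by apply: le_trans (zM i); exact: ltW.
lra.
Qed.

End configurations.

Section indicator_bound.
Context {R : realType} d (T : measurableType d) (m : {measure set T -> \bar R}).
Implicit Types (A : set T) (f : T -> R) (K : R).

Lemma integrable_indic_fin A : measurable A -> (m A < +oo)%E ->
  m.-integrable setT (fun x => (\1_A x : R)%:E).
Proof.
move=> mA Afin; apply/integrableP; split; first exact/measurable_EFinP.
rewrite (eq_integral (fun x => (\1_A x)%:E)) => [|x _].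
  by rewrite integral_indic// setIT.
by rewrite gee0_abs// lee_fin.
Qed.

Lemma indic_bound_integrable A f K : measurable A -> (m A < +oo)%E ->
  measurable_fun setT f -> (forall x, `|f x| <= K * \1_A x) ->
  m.-integrable setT (EFin \o f).
Proof.
move=> mA Afin mf fK.
have iA : m.-integrable setT (fun x => (K * \1_A x)%:E).
  under eq_fun do rewrite EFinM.
  by apply: integrableZl => //; exact: integrable_indic_fin.
apply: le_integrable iA => //; first exact/measurable_EFinP.
by move=> x _ /=; rewrite lee_fin; apply: le_trans (fK x) (ler_norm _).
Qed.

Lemma indic_bound_integral A f K : measurable A -> (m A < +oo)%E ->
  measurable_fun setT f -> (forall x, `|f x| <= K * \1_A x) ->
  (`|\int[m]_x (f x)%:E| <= K%:E * m A)%E.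
Proof.
move=> mA Afin mf fK.
apply: le_trans (le_abse_integral _ _ _) _ => //; first exact/measurable_EFinP.
have -> : (K%:E * m A = \int[m]_x (K%:E * (\1_A x)%:E))%E.
  by rewrite integralZl//= ?integral_indic ?setIT//; exact: integrable_indic_fin.
apply: ge0_le_integral => //.
- by apply: measurableT_comp => //; exact/measurable_EFinP.
- by apply: emeasurable_funM => //; exact/measurable_EFinP.
- by move=> x _ /=; rewrite -EFinM lee_fin.
Qed.

End indicator_bound.

(** * Integrals over configurations *)

Section configuration_integrals.
Context {R : realType} {L : finType} {n : nat}.
Notation vec := ('rV[R]_n.+2).
Variable a : L.
Notation Y := (#|free_site a|.-tuple (n.+1.-tuple R)).
Notation mu := (@lebesgue_measure R).
Notation m := (power_measure (power_measure mu n.+1) #|free_site a|).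
Implicit Types (y : Y) (r M K : R).

Lemma yupd_tupd (j : 'I_#|free_site a|) y v (x : R) :
  yupd j (tupd y j v) x = tupd y j (tupd v ord0 x).
Proof.
apply: eq_from_tnth => i; rewrite !tnth_tupd; case: eqP => // _.
by rewrite eqxx.
Qed.

Lemma config_coordinate (j : 'I_#|free_site a|) (F G : Y -> \bar R) :
  measurable_fun setT F -> measurable_fun setT G ->
  (forall y, (0 <= F y)%E) -> (forall y, (0 <= G y)%E) ->
  (forall y, (\int[mu]_x F (yupd j y x) = \int[mu]_x G (yupd j y x))%E) ->
  (\int[m]_y F y = \int[m]_y G y)%E.
Proof.
move=> mF mG F0 G0 FG; apply: (power_measure_coordinate (j := j)) => // y.
apply: (power_measure_coordinate (j := ord0)) => //.
- exact: measurableT_comp mF (measurable_tupd y j).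
- exact: measurableT_comp mG (measurable_tupd y j).
- move=> v; have := FG (tupd y j v).
  by under eq_integral do rewrite yupd_tupd; under [X in _ = X -> _]eq_integral do rewrite yupd_tupd.
Qed.

(** On each line the positive and negative parts have the same integral, so the coordinatewise
    comparison applies to these two nonnegative functions. *)
Lemma config_integral0 (j : 'I_#|free_site a|) (Psi : Y -> \bar R) :
  m.-integrable setT Psi ->
  (forall y, mu.-integrable setT (fun x => Psi (yupd j y x))) ->
  (forall y, (\int[mu]_x Psi (yupd j y x) = 0)%E) ->
  (\int[m]_y Psi y = 0)%E.
Proof.
move=> iPsi iline line0; have mPsi := measurable_int _ iPsi.
have E : (\int[m]_y Psi^\+ y = \int[m]_y Psi^\- y)%E.
  apply: (config_coordinate (j := j)) => //.
  - exact: measurable_funepos.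
  - exact: measurable_funeneg.
  move=> y; have := line0 y; rewrite integralE.
  have := integrable_neg_fin_num measurableT (iline y).
  have := integrable_pos_fin_num measurableT (iline y).
  rewrite -/(Psi \o yupd j y).
  under eq_integral do rewrite funepos_comp/=.
  move=> fp; under eq_integral do rewrite funeneg_comp/=.
  move=> fm; under eq_integral do rewrite funepos_comp/=.
  under [X in (_ - X)%E = _]eq_integral do rewrite funeneg_comp/=.
  rewrite -(fineK fp) -(fineK fm) -EFinB => -[/eqP].
  by rewrite subr_eq0 => /eqP ->.
by rewrite integralE E subee// (integrable_neg_fin_num measurableT iPsi).
Qed.

(* The integrands below vanish as soon as one coordinate [z_k] reaches [M]. *)
Lemma indic_ybox M K r y (x : R) : 0 <= K ->
  ((forall k, zcoord (cfg r y k) < M) -> `|x| <= K) ->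
  ((exists k, M <= zcoord (cfg r y k)) -> x = 0) ->
  `|x| <= K * \1_(ybox M) y.
Proof.
move=> K0 xK x0; have [/forallP zM|/forallPn[k]] := boolP [forall k, zcoord (cfg r y k) < M].
  rewrite indicE; case: (boolP (y \in ybox M)) => [_|]; first by rewrite mulr1 xK.
  by rewrite notin_setE => /(notin_ybox r)[k]; rewrite leNgt zM.
rewrite -leNgt => Mk; rewrite x0 ?normr0; last by exists k.
by rewrite mulr_ge0// indicE.
Qed.

Lemma ybox_integrable M (f : Y -> R) K : measurable_fun setT f ->
  (forall y, `|f y| <= K * \1_(ybox M) y) -> m.-integrable setT (EFin \o f).
Proof.
move=> mf fK.
exact: (@indic_bound_integrable R _ _ m (ybox M) f K (measurable_ybox M) (ybox_fin a M) mf fK).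
Qed.

(** The first factor is the parameter r of the orbit followed by the pinned spin. *)
Definition slab M : set (R * Y) := `[0%R, 1%R]%classic `*` ybox M.

Lemma measurable_slab M : measurable (slab M).
Proof. by apply: measurableX; [exact: measurable_itv|exact: measurable_ybox]. Qed.

Lemma slab_measure M : (mu \x m)%E (slab M) = m (ybox M).
Proof.
rewrite product_measure1E//; last exact: measurable_ybox.
by rewrite [X in (X * _)%E](lebesgue_itv_cc ler01) subr0 mul1e.
Qed.

Lemma slab_integrable M (f : R * Y -> R) K : measurable_fun setT f ->
  (forall p, `|f p| <= K * \1_(slab M) p) -> (mu \x m)%E.-integrable setT (EFin \o f).
Proof.
move=> mf fK.
apply: (@indic_bound_integrable R _ _ (mu \x m)%E (slab M) f K (measurable_slab M) _ mf fK).
by have := @ybox_fin R L n a M; rewrite -slab_measure.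
Qed.

Lemma slab_integral M (f : R * Y -> R) K : measurable_fun setT f ->
  (forall p, `|f p| <= K * \1_(slab M) p) ->
  `|\int[(mu \x m)%E]_p f p| <= K * fine (m (ybox M)).
Proof.
move=> mf fK.
have fin : (m (ybox M) < +oo)%E by exact: ybox_fin.
have ff : m (ybox M) \is a fin_num by rewrite ge0_fin_numE.
have fi := integrable_fin_num measurableT (slab_integrable mf fK).
rewrite -lee_fin EFinM fineK// -slab_measure /Rintegral -[leLHS]/(`|(fine _)%:E|%E) fineK//.
apply: (@indic_bound_integral R _ _ (mu \x m)%E (slab M) f K (measurable_slab M) _ mf fK).
by move: fin; rewrite -slab_measure.
Qed.

End configuration_integrals.

(** * Change of variables on the line *)

Section substitution.
Context {R : realType}.
Notation mu := (@lebesgue_measure R).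

(** Both integrands vanish outside a compact interval, to which the substitution rule for increasing
    maps applies. *)
Lemma substitution_compact (F F' G : R -> R) a b : F a <= F b ->
  (forall x : R, is_derive x 1 F (F' x)) -> continuous F' -> (forall x, 0 < F' x) ->
  continuous G -> (forall x, ~ F a <= x <= F b -> G x = 0) ->
  (\int[mu]_x (G x)%:E = \int[mu]_x (G (F x) * F' x)%:E)%E.
Proof.
move=> Fab dF cF' F'0 cG G0.
have F'E : (F^`()%classic : R -> R) = F'.
  by apply/funext => x; rewrite derive1E; have [_ ->] := dF x.
have cF := is_derive_continuous dF.
have incF : {homo F : x y / x < y}.
  move=> x y xy; have := @MVT R F F' x y xy (fun z _ => dF z) (continuous_subspaceT cF).
  by move=> [z _ E]; rewrite -subr_gt0 E mulr_gt0// subr_gt0.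
have leF x y : (F x <= F y) = (x <= y) by exact: le_mono incF x y.
have ab : a <= b by rewrite -leF.
have off (f : R -> R) (c e : R) : (forall x, ~ c <= x <= e -> f x = 0) ->
    (\int[mu]_x (f x)%:E = \int[mu]_(x in `[c, e]) (f x)%:E)%E.
  move=> f0; rewrite [RHS]integral_mkcond; apply: eq_integral => x _.
  rewrite patchE; case: ifPn => // /negP; rewrite in_setE/= in_itv/= => /f0 ->//.
rewrite (off _ _ _ G0) (off (fun x => G (F x) * F' x) a b); last first.
  by move=> x xab; rewrite (G0 (F x)) ?mul0r// !leF.
rewrite integration_by_substitution_increasing//.
- by rewrite F'E.
- by move=> x y _ _; exact: incF.
- by move=> x _; rewrite F'E; exact: cF'.
- by rewrite F'E; apply/cvg_ex; exists (F' a); exact/cvg_at_right_filter/cF'.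
- by rewrite F'E; apply/cvg_ex; exists (F' b); exact/cvg_at_left_filter/cF'.
- split; first by move=> x _; have [] := dF x.
  + exact/cvg_at_right_filter/cF.
  + exact/cvg_at_left_filter/cF.
- exact: continuous_subspaceT.
Qed.

End substitution.

Lemma continuous_sumr {R : realType} {T : topologicalType} (I : Type) (r : seq I)
    (f : I -> T -> R) :
  (forall i, continuous (f i)) -> continuous (fun x => \sum_(i <- r) f i x).
Proof.
move=> cf; elim: r => [|i r IH].
  by under eq_fun do rewrite big_nil; exact: cst_continuous.
under eq_fun do rewrite big_cons.
by move=> x; apply: cvgD; [exact: cf|exact: IH].
Qed.

Lemma Rintegral_sumr {R : realType} d (T : measurableType d)
    (m : {measure set T -> \bar R}) (I : Type) (r : seq I) (f : I -> T -> R) :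
  (forall i, m.-integrable setT (EFin \o f i)) ->
  m.-integrable setT (EFin \o (fun x => \sum_(i <- r) f i x)) /\
  \int[m]_x (\sum_(i <- r) f i x) = \sum_(i <- r) \int[m]_x f i x.
Proof.
move=> fi; elim: r => [|i r [IH1 IH2]].
  split; first by under eq_fun do rewrite big_nil; exact: integrable0.
  by under eq_Rintegral do rewrite big_nil; rewrite big_nil Rintegral_cst// mul0r.
split.
  under eq_fun do rewrite big_cons.
  exact: (integrableD measurableT (fi i) IH1).
under eq_Rintegral do rewrite big_cons.
by rewrite RintegralD// IH2 big_cons.
Qed.

Section continuous_configuration.
Context {R : realType} {L : finType} {n : nat} {T : topologicalType}.
Notation vec := ('rV[R]_n.+2).
Variables (beta : L -> L -> R) (c : T -> L -> vec).
Hypothesis cc : forall k j, continuous (fun x => c x k 0 j).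

Lemma continuous_z k : continuous (fun x => zcoord (c x k)).
Proof. exact: cc. Qed.

Lemma continuous_x k : continuous (fun x => xcoord (c x k)).
Proof. exact: cc. Qed.

Lemma continuous_gibbs : continuous (fun x => expR (- hamiltonian beta (c x))).
Proof.
move=> x; apply: (@continuous_comp _ _ _ (fun x => - hamiltonian beta (c x)) expR); last exact: continuous_expR.
apply: cvgN; apply: cvgM; first exact: cvg_cst.
apply: continuous_sumr => k; apply: continuous_sumr => l y.
apply: cvgM; first exact: cvg_cst.
have cd j : continuous (fun x => (c x k - c x l) 0 j).
  under eq_fun do rewrite !mxE.
  by move=> z; apply: cvgB; exact: cc.
rewrite /Defs.minkowski; apply: cvgD; first by apply: cvgN; apply: cvgM; exact: cd.
by apply: continuous_sumr => j z; apply: cvgM; exact: cd.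
Qed.

Lemma continuous_ward (F F' : L -> (L -> R) -> R) i :
  (forall i, blip (F i)) -> (forall i, blip (F' i)) ->
  continuous (fun x => ward beta F F' i (c x)).
Proof.
move=> bF bF' x; have cz := continuous_z; have cx := continuous_x.
apply: cvgM; last exact: continuous_gibbs.
apply: cvgB; apply: cvgM.
- exact: cx.
- exact: blip_continuous.
- exact: blip_continuous.
- apply: continuous_sumr => l y; apply: cvgM; first exact: cvg_cst.
  by apply: cvgB; apply: cvgM; [exact: cz|exact: cx|exact: cx|exact: cz].
Qed.

End continuous_configuration.

Lemma continuous_hyp_line {R : realType} n (v : n.+1.-tuple R) j :
  continuous (fun x : R => hyp_point (tupd v ord0 x) 0 j).
Proof.
case: (unliftP ord0 j) => [k|] ->.
  rewrite (_ : (fun x => _) = (fun x => if k == ord0 then x else tnth v k)); last first.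
    by apply/funext => x; rewrite hyp_point_lift tnth_tupd.
  by case: eqP => _; [move=> x; exact: cvg_id|exact: cst_continuous].
exact: is_derive_continuous (is_derive_hyp_point_z v).
Qed.

Lemma continuous_boost_origin {R : realType} n (s : R) j :
  continuous (fun r : R => boost (s * r) (hyp_origin : 'rV[R]_n.+2) 0 j).
Proof.
have cz : continuous (fun r : R => zcoord (boost (s * r) (hyp_origin : 'rV[R]_n.+2))).
  exact: is_derive_continuous (@is_derive_boost_z R n hyp_origin s).
have cx : continuous (fun r : R => xcoord (boost (s * r) (hyp_origin : 'rV[R]_n.+2))).
  exact: is_derive_continuous (@is_derive_boost_x R n hyp_origin s).
case: (unliftP ord0 j) => [k|] ->; last exact: cz.
case: (unliftP ord0 k) => [l|] ->; last by under eq_fun do rewrite -xcoordE.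
by under eq_fun do rewrite rest_boost; exact: cst_continuous.
Qed.

(** * Integrated Ward identities *)

Section ward_identities.
Context {R : realType} {L : finType} {n : nat}.
Notation vec := ('rV[R]_n.+2).
Variables (beta : L -> L -> R) (a : L).
Hypothesis beta_sym : forall i j, beta i j = beta j i.
Hypothesis beta_ge0 : forall i j, 0 <= beta i j.
Notation Y := (#|free_site a|.-tuple (n.+1.-tuple R)).
Notation mu := (@lebesgue_measure R).
Notation m := (power_measure (power_measure mu n.+1) #|free_site a|).
Implicit Types (y : Y) (r K : R).

Variables (s M C : R) (F F' : L -> (L -> R) -> R).
Hypothesis M_gt0 : 0 < M.
Hypothesis F_blip : forall i, blip (F i).
Hypothesis F'_blip : forall i, blip (F' i).
Hypothesis F_vanishes : forall k, vanishes_above k M F.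
Hypothesis F'_vanishes : forall k, vanishes_above k M F'.
Hypothesis F_quad : forall i l s t, 0 <= s -> 0 <= t ->
  `|F i (upd l i t) - F i (upd l i s) - (t - s) * F' i (upd l i s)|
    <= C * (t - s) ^+ 2.
Hypothesis Fa_vanishes : vanishes_above a (cosh s) F.

Lemma ward_vanishes i (u : L -> vec) k : M <= zcoord (u k) -> ward beta F F' i u = 0.
Proof. by move=> Mz; rewrite /ward (@F_vanishes k i (zvec u) Mz) (@F'_vanishes k i (zvec u) Mz) mulr0 mul0r subrr mul0r. Qed.

Lemma ward_bound : exists2 K, 0 <= K & forall i r y,
  `|ward beta F F' i (cfg r y) * yweight y| <= K * \1_(ybox M) y.
Proof.
have [C1 HC1] := blip_family F_blip; have [C2 HC2] := blip_family F'_blip.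
pose Z : R := \sum_i \sum_l beta i l * (2 * M ^+ 2).
pose G : R := expR (4^-1 * \sum_i \sum_j beta i j * M ^+ 2).
have M0 := ltW M_gt0.
have Z0 i : \sum_l beta i l * (2 * M ^+ 2) <= Z.
  rewrite /Z [leRHS](bigD1 i)//= lerDl sumr_ge0// => j _; rewrite sumr_ge0// => l _.
  by rewrite !mulr_ge0.
have Zge0 : 0 <= Z.
  by apply: sumr_ge0 => j _; rewrite sumr_ge0// => l _; rewrite !mulr_ge0.
have C10 : 0 <= C1 by exact: lip_bounded_ge0 (HC1 a).
have C20 : 0 <= C2 by exact: lip_bounded_ge0 (HC2 a).
have K0 : 0 <= (M * C2 + C1 * Z) * G.
  by rewrite mulr_ge0 ?expR_ge0// addr_ge0// mulr_ge0.
exists ((M * C2 + C1 * Z) * G) => // i r y; apply: (indic_ybox (r := r)) => // [zM|[k Mk]]; last first.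
  by rewrite (ward_vanishes i Mk) mul0r.
have [w0 w1] := andP (yweight_itv y).
rewrite normrM (ger0_norm w0) -[leRHS]mulr1; apply: ler_pM => //.
rewrite /ward normrM (ger0_norm (expR_ge0 _)); apply: ler_pM => //; last first.
  by apply: gibbs_le => // k; exact/ltW/zM.
have xM k : `|xcoord (cfg r y k)| <= M.
  by apply: le_trans (hyperboloid_x_le (hyperboloid_cfg r y k)) _; exact/ltW/zM.
have zM' k : `|zcoord (cfg r y k)| <= M.
  have [_ z0] := hyperboloid_zx (hyperboloid_cfg r y k).
  by rewrite (gtr0_norm z0); exact/ltW/zM.
apply: le_trans (ler_normB _ _) _; rewrite !normrM; apply: lerD; apply: ler_pM => //.
- by have [h _] := HC2 i; exact: h.
- by have [h _] := HC1 i; exact: h.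
apply: le_trans (Z0 i); apply: le_trans (ler_norm_sum _ _ _) _; apply: ler_sum => l _.
rewrite normrM (ger0_norm (beta_ge0 _ _)) ler_wpM2l//.
apply: le_trans (ler_normB _ _) _; rewrite !normrM mulrDl !mul1r expr2.
by apply: lerD; apply: ler_pM.
Qed.

Lemma measurable_ward d (T : measurableType d) (rho : T -> R) (eta : T -> Y) i :
  measurable_fun setT rho -> measurable_fun setT eta ->
  measurable_fun setT (fun t => ward beta F F' i (cfg (rho t) (eta t)) * yweight (eta t)).
Proof.
move=> mr me; apply: measurable_funM; last exact: measurable_yweight mr me.
apply: measurable_funM; last by apply: measurable_gibbs => k j; exact: measurable_cfg.
apply: measurable_funB; apply: measurable_funM.
- exact: measurable_xcfg.
- exact: measurable_zvec.
- exact: measurable_zvec.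
- apply: measurable_sum => l; apply: measurable_funM => //.
  by apply: measurable_funB; apply: measurable_funM;
    [exact: measurable_zcfg|exact: measurable_xcfg|exact: measurable_xcfg|exact: measurable_zcfg].
Qed.

(** The density 1 / z at [i] supplies the speed of the line, so the integrand is the constant weight
    [W] of the other sites times the derivative in x of [F i (z) * exp(- H)], which is zero at both
    ends of [- M, M]. *)
Lemma ward_line i (ia : i != a) r y :
  let f x := (ward beta F F' i (cfg r (yupd (site ia) y x)) * yweight (yupd (site ia) y x))%:E in
  mu.-integrable setT f /\ (\int[mu]_x f x = 0)%E.
Proof.
pose v := tnth y (site ia); pose gam (x : R) := hyp_point (tupd v ord0 x).
pose u := cfg r y; pose W : R := \prod_(k | (k != a) && (k != i)) (zcoord (cfg 0 y k))^-1.
pose D x := F i (zvec (upd_site u i (gam x))) * expR (- hamiltonian beta (upd_site u i (gam x))).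
pose D' x := (zcoord (gam x))^-1 * ward beta F F' i (upd_site u i (gam x)).
have z0 x : 0 < zcoord (gam x) by have [] := hyperboloid_zx (hyp_point_hyperboloid (tupd v ord0 x)).
have fE x : ward beta F F' i (cfg r (yupd (site ia) y x)) * yweight (yupd (site ia) y x) = W * D' x.
  by rewrite cfg_yupd yweight_yupd -/u -/v -/(gam x) -/W /D'; ring.
have dD (x : R) : is_derive x 1 D (D' x).
  apply: (is_derive_ward beta_sym F_quad (kap := fun x => (zcoord (gam x))^-1)) => //.
  - exact: is_derive_hyp_point_z.
  - exact: is_derive_hyp_point_x.
  - by move=> t k; exact: hyp_point_rest.
have cg j : continuous (fun x => gam x 0 j) by exact: continuous_hyp_line.
have cgz : continuous (fun x => zcoord (gam x)) by exact: cg.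
have cD' : continuous D'.
  move=> x; apply: cvgM; first by apply: cvgV; [rewrite lt0r_neq0|exact: cgz].
  apply: (@continuous_ward _ _ _ _ _ (fun x => upd_site u i (gam x))) => // k j; rewrite /upd_site; case: eqP => _ //.
  exact: cst_continuous.
have big x : ~ - M <= x <= M -> M <= zcoord (gam x).
  move=> xM; have xz : `|x| <= zcoord (gam x).
    by have := hyp_point_coord_le (tupd v ord0 x) ord0; rewrite tnth_tupd eqxx.
  apply: le_trans xz; rewrite leNgt; apply/negP => /ltW.
  by rewrite ler_norml.
have D'0 x : ~ - M <= x <= M -> D' x = 0.
  move=> /big Mz; rewrite /D' (ward_vanishes i (k := i)) ?mulr0//.
  by rewrite /upd_site eqxx.
have patch : (fun x => (W * D' x)%:E) = (fun x => (W * D' x)%:E) \_ `[- M, M].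
  apply/funext => x; rewrite patchE; case: ifPn => // /negP; rewrite in_setE/= in_itv/=.
  by move=> /D'0 ->; rewrite mulr0.
have cWD : continuous (fun x => W * D' x) by move=> x; apply: cvgM; [exact: cvg_cst|exact: cD'].
move=> f; have -> : f = (fun x => (W * D' x)%:E) by apply/funext => x; rewrite /f fE.
have MM : - M <= M by rewrite ge0_cp// ltW.
split.
  by rewrite patch -integrable_mkcond//; exact: (continuous_itv_integrable _ _ cWD).
rewrite patch -integral_mkcond.
have dWD (x : R) : is_derive x 1 (fun x => W * D x) (W * D' x).
  by have := dD x => dDx; apply: is_derive_eq; rewrite /GRing.scale/=; ring.
rewrite (FTC2 dWD)//.
have DM x : M <= `|x| -> D x = 0.
  move=> Mx; rewrite /D (@F_vanishes i) ?mul0r// /zvec /upd_site eqxx.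
  apply: le_trans Mx _.
  by have := hyp_point_coord_le (tupd v ord0 x) ord0; rewrite tnth_tupd eqxx.
by rewrite !DM ?normrN ?ler_norm// mulr0 subrr.
Qed.

Lemma ward_integral0 i : i != a -> forall r, (\int[m]_y (ward beta F F' i (cfg r y) * yweight y)%:E = 0)%E.
Proof.
move=> ia r; have [K K0 HK] := ward_bound.
apply: (config_integral0 (j := site ia)).
- apply: (ybox_integrable _ (HK i r)).
  by apply: (measurable_ward (rho := cst r) (eta := id)).
- by move=> y; have [] := ward_line ia r y.
- by move=> y; have [] := ward_line ia r y.
Qed.

(** A total derivative in r. At r = 1 the pinned spin has z = cosh s, where [F] vanishes; the end r
    = 0 remains with a minus sign. *)
Lemma ward_pinned y : (\int[mu]_(r in `[0%R, 1%R]) (s * (ward beta F F' a (cfg (s * r) y) * yweight y))%:E =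
  (- (F a (zvec (cfg 0 y)) * (expR (- hamiltonian beta (cfg 0 y)) * yweight y)))%:E)%E.
Proof.
pose gam (r : R) : vec := boost (s * r) hyp_origin.
pose u := cfg 0 y.
have uE r : cfg (s * r) y = upd_site u a (gam r) by rewrite (cfg_r _ 0).
pose D x := F a (zvec (upd_site u a (gam x))) * expR (- hamiltonian beta (upd_site u a (gam x))).
have dD (x : R) : is_derive x 1 D (s * ward beta F F' a (upd_site u a (gam x))).
  apply: (is_derive_ward beta_sym F_quad (kap := fun x => s)) => //.
  - exact: is_derive_boost_z.
  - exact: is_derive_boost_x.
  - by move=> t k; rewrite !rest_boost.
  - by rewrite zcoord_boost_origin cosh_gt0.
have cg j : continuous (fun x => gam x 0 j) by exact: continuous_boost_origin.
have dDw (x : R) : is_derive x 1 (fun x => D x * yweight y)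
    (s * (ward beta F F' a (cfg (s * x) y) * yweight y)).
  by have := dD x => dDx; apply: is_derive_eq; rewrite /GRing.scale/= uE; ring.
rewrite (FTC2 dDw)//.
- rewrite /D -!uE !mulr0 mulr1 (_ : F a (zvec (cfg s y)) = 0) ?mul0r ?sub0r ?mulrA//.
  by apply: Fa_vanishes; rewrite /zvec cfg_pinned zcoord_boost_origin.
- move=> x; apply: cvgM; first exact: cvg_cst.
  apply: cvgM; last exact: cvg_cst.
  under eq_fun do rewrite uE; rewrite uE.
  apply: (@continuous_ward _ _ _ _ _ (fun x => upd_site u a (gam x))) => // k j.
  by rewrite /upd_site; case: eqP => _ //; exact: cst_continuous.
Qed.

End ward_identities.

#[local] Arguments power_measure : simpl never.
#[local] Arguments free_site : simpl never.

(** * Green's formula along the orbit of the pinned spin *)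

Section pinned_green_formula.
Context {R : realType} {L : finType} {n : nat}.
Notation vec := ('rV[R]_n.+2).
Variables (beta : L -> L -> R) (a : L).
Hypothesis beta_sym : forall i j, beta i j = beta j i.
Hypothesis beta_ge0 : forall i j, 0 <= beta i j.
Notation Y := (#|free_site a|.-tuple (n.+1.-tuple R)).
Notation mu := (@lebesgue_measure R).
Notation m := (power_measure (power_measure mu n.+1) #|free_site a|).
Implicit Types (y : Y) (r K : R) (p : R * Y).

Definition weight r y := expR (- hamiltonian beta (cfg r y)) * yweight y.

Lemma weight_ge0 r y : 0 <= weight r y.
Proof. by rewrite mulr_ge0 ?expR_ge0//; have /andP[] := yweight_itv y. Qed.

Lemma measurable_weight d (T : measurableType d) (rho : T -> R) (eta : T -> Y) :
  measurable_fun setT rho -> measurable_fun setT eta ->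
  measurable_fun setT (fun t => weight (rho t) (eta t)).
Proof.
by move=> mr me; apply: measurable_funM; [apply: measurable_gibbs => i k; exact: measurable_cfg|exact: measurable_yweight mr me].
Qed.

Variables (s M : R).
Hypothesis M_gt0 : 0 < M.
Hypothesis M_ge : cosh s <= M.

Definition weight_max := expR (4^-1 * \sum_i \sum_j beta i j * M ^+ 2).

Lemma weight_le r y : (forall k, zcoord (cfg r y k) < M) -> weight r y <= weight_max.
Proof.
move=> zM; have /andP[w0 w1] := yweight_itv y.
rewrite -[leRHS]mulr1; apply: ler_pM => //.
by apply: gibbs_le => // k; exact/ltW/zM.
Qed.

Lemma observable_bound C (f : (L -> R) -> R) : (forall l, `|f l| <= C) ->
  (forall l k, M <= l k -> f l = 0) ->
  forall r y, `|f (zvec (cfg r y)) * weight r y| <= C * weight_max * \1_(ybox M) y.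
Proof.
move=> fC f0 r y; have C0 : 0 <= C by exact: le_trans (normr_ge0 (f (fun=> 0))) _.
apply: (indic_ybox (r := r)) => [|zM|[k Mk]].
- by rewrite mulr_ge0 ?expR_ge0.
- rewrite normrM (ger0_norm (weight_ge0 r y)).
  by apply: ler_pM => //; [exact: weight_ge0|exact: weight_le].
- by rewrite (f0 _ k) ?mul0r.
Qed.

Lemma indic_slab r y : \1_(slab M) (r, y) = \1_`[0%R, 1%R] r * \1_(ybox M) y :> R.
Proof. by rewrite /slab indicE in_setX/= !indicE -natrM mulnb. Qed.

Lemma indic01_le1 r : 0 <= (\1_`[0%R, 1%R] r : R) <= 1.
Proof. by rewrite indicE; case: (_ \in _); rewrite /= ?lexx ?ler01. Qed.

Lemma integral_indic01 (f : R -> R) :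
  (\int[mu]_r (\1_`[0%R, 1%R] r * f r)%:E = \int[mu]_(r in `[0%R, 1%R]) (f r)%:E)%E.
Proof.
rewrite [RHS]integral_mkcond; apply: eq_integral => r _.
by rewrite patchE indicE; case: ifPn => _; rewrite ?mul1r ?mul0r.
Qed.

(** [s] is the speed along the orbit and [sinh (s * r)] the x-coordinate of the pinned spin, which
    multiplies the source in the summed Ward identity. *)
Definition source (q0 : (L -> R) -> R) p :=
  \1_`[0%R, 1%R] p.1 * (s * sinh (s * p.1) * (q0 (zvec (cfg (s * p.1) p.2)) * weight (s * p.1) p.2)).

Let msfst : measurable_fun setT (fun p : R * Y => s * p.1).
Proof. by apply: measurable_funM => //; exact: measurable_fst. Qed.

Let mindic : measurable_fun setT (fun p : R * Y => \1_`[0%R, 1%R] p.1 : R).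
Proof. by apply: (measurableT_comp (measurable_indic _)) => //; exact: measurable_fst. Qed.

Lemma measurable_source q0 : blip q0 -> measurable_fun setT (source q0).
Proof.
move=> bq; apply: measurable_funM => //; apply: measurable_funM.
  by apply: measurable_funM => //; exact: (measurableT_comp measurable_sinh).
apply: measurable_funM.
  by apply: measurable_zvec => //; exact: measurable_snd.
by apply: measurable_weight => //; exact: measurable_snd.
Qed.

Section solution.
Variables (q0 : (L -> R) -> R) (eps : R) (F F' : L -> (L -> R) -> R).
Hypothesis q0_blip : blip q0.
Hypothesis q0_vanishes : forall l k, M <= l k -> q0 l = 0.
Hypothesis q0_vanishes_a : forall l, cosh s <= l a -> q0 l = 0.
Hypothesis eps_ge0 : 0 <= eps.
Hypothesis FF' : poisson_solution beta M (fun i l => (i == a)%:R * q0 l) eps F F'.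

Let W i p : R := \1_`[0%R, 1%R] p.1 *
  (s * (ward beta F F' i (cfg (s * p.1) p.2) * yweight p.2)).

Let F_blip i : blip (F i). Proof. by have [h _ _ _ _] := FF'. Qed.
Let F'_blip i : blip (F' i). Proof. by have [_ h _ _ _] := FF'. Qed.
Let F_vanishes k : vanishes_above k M F.
Proof.
have [_ _ h _ _] := FF'; apply: (proj1 (h k M (lexx _) _)) => i l Ml.
by rewrite (q0_vanishes Ml) mulr0.
Qed.
Let F'_vanishes k : vanishes_above k M F'.
Proof.
have [_ _ h _ _] := FF'; apply: (proj2 (h k M (lexx _) _)) => i l Ml.
by rewrite (q0_vanishes Ml) mulr0.
Qed.
Let Fa_vanishes : vanishes_above a (cosh s) F.
Proof.
have [_ _ h _ _] := FF'; apply: (proj1 (h a (cosh s) M_ge _)) => i l Ml.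
by rewrite (q0_vanishes_a Ml) mulr0.
Qed.

Let mW i : measurable_fun setT (W i).
Proof.
apply: measurable_funM => //; apply: measurable_funM => //.
by apply: measurable_ward => //; exact: measurable_snd.
Qed.

Let iward i r : m.-integrable setT (fun y => (ward beta F F' i (cfg r y) * yweight y)%:E).
Proof.
have [K K0 HK] := ward_bound (n := n) a beta_ge0 M_gt0 F_blip F'_blip F_vanishes F'_vanishes.
apply: (ybox_integrable _ (HK i r)).
by apply: (@measurable_ward R L n beta a F F' F_blip F'_blip _ _ (cst r) id i).
Qed.

Let iW i : (mu \x m)%E.-integrable setT (EFin \o W i).
Proof.
have [K K0 HK] := ward_bound (n := n) a beta_ge0 M_gt0 F_blip F'_blip F_vanishes F'_vanishes.
apply: (slab_integrable (M := M) (K := `|s| * K)) => // -[r y].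
have /andP[i0 i1] := indic01_le1 r.
rewrite indic_slab /W/= normrM (ger0_norm i0) [leRHS]mulrCA ler_wpM2l// normrM -(mulrA `|s|).
by rewrite ler_wpM2l// HK.
Qed.

Let WE0 i : i != a -> \int[(mu \x m)%E]_p W i p = 0.
Proof.
move=> ia; rewrite /Rintegral -(integral12_prod_meas1 (iW i)) /fubini_F.
rewrite (eq_integral (cst 0%E)) ?integral0// => r _.
transitivity (\int[m]_y ((\1_`[0%R, 1%R] r * s)%:E *
    (ward beta F F' i (cfg (s * r) y) * yweight y)%:E))%E.
  by apply: eq_integral => y _; rewrite -EFinM -mulrA.
have [C FC] : exists C, forall i l s t, 0 <= s -> 0 <= t ->
  `|F i (upd l i t) - F i (upd l i s) - (t - s) * F' i (upd l i s)| <= C * (t - s) ^+ 2.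
  by have [_ _ _ [C h] _] := FF'; exists C.
rewrite integralZl//; last exact: iward.
by rewrite (ward_integral0 beta_sym beta_ge0 M_gt0 F_blip F'_blip F_vanishes F'_vanishes FC) ?mule0.
Qed.

Let WEa : \int[(mu \x m)%E]_p W a p = - \int[m]_y (F a (zvec (cfg 0 y)) * weight 0 y).
Proof.
have [C FC] : exists C, forall i l s t, 0 <= s -> 0 <= t ->
  `|F i (upd l i t) - F i (upd l i s) - (t - s) * F' i (upd l i s)| <= C * (t - s) ^+ 2.
  by have [_ _ _ [C h] _] := FF'; exists C.
have [C1 [HC1 _]] := F_blip a.
rewrite /Rintegral -(integral21_prod_meas1 (iW a)) /fubini_G.
transitivity (fine (\int[m]_y ((-1)%:E * (F a (zvec (cfg 0 y)) * weight 0 y)%:E))%E).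
  congr fine; apply: eq_integral => y _.
  rewrite /W [LHS]integral_indic01.
  rewrite (ward_pinned beta_sym F_blip F'_blip FC Fa_vanishes).
  by rewrite -EFinM mulN1r.
have iF : m.-integrable setT (fun y => (F a (zvec (cfg 0 y)) * weight 0 y)%:E).
  apply: (ybox_integrable _ (observable_bound HC1 _ 0)) => [|l k Ml]; last first.
    exact: F_vanishes Ml.
  apply: measurable_funM.
    by apply: (measurable_zvec (rho := cst 0) (eta := id)).
  by apply: (measurable_weight (rho := cst 0) (eta := id)).
by rewrite integralZl// fineM ?mulN1r// (integrable_fin_num measurableT iF).
Qed.

(** By [sum_ward] the left-hand side is a sum over sites of x_i times the error of the Poisson
    equation; |x_i| <= z_i < M and the error is at most [eps]. *)
Let defect_bound p : `|source q0 p + \sum_i W i p| <=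
  eps * (`|s| * (#|L|%:R * M * weight_max)) * \1_(slab M) p.
Proof.
case: p => r y; rewrite indic_slab.
have /andP[i0 i1] := indic01_le1 r.
have -> : source q0 (r, y) + \sum_i W i (r, y) = \1_`[0%R, 1%R] r * (s *
   (sinh (s * r) * q0 (zvec (cfg (s * r) y)) * weight (s * r) y +
    (\sum_i ward beta F F' i (cfg (s * r) y)) * yweight y)).
  rewrite /source /W/= -!mulr_sumr -mulr_suml -mulrDr; congr (_ * _).
  by ring.
rewrite normrM (ger0_norm i0) [leRHS]mulrCA ler_wpM2l// normrM.
rewrite (_ : eps * (`|s| * (#|L|%:R * M * weight_max)) * \1_(ybox M) y =
  `|s| * (eps * (#|L|%:R * M * weight_max) * \1_(ybox M) y)); last by ring.
rewrite ler_wpM2l//.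
have M0 := ltW M_gt0.
set u := cfg (s * r) y.
apply: (indic_ybox (r := s * r)) => [|zM|[k Mk]].
- by rewrite !mulr_ge0 ?expR_ge0.
- have -> : sinh (s * r) * q0 (zvec u) * weight (s * r) y + (\sum_i ward beta F F' i u) * yweight y =
    (\sum_i xcoord (u i) * (F' i (zvec u) + \sum_j beta i j * zvec u j * (F j (zvec u) - F i (zvec u)) + (i == a)%:R * q0 (zvec u))) * weight (s * r) y.
    have E : \sum_i xcoord (u i) * ((i == a)%:R * q0 (zvec u)) = sinh (s * r) * q0 (zvec u).
      rewrite (bigD1 a)//= eqxx mul1r big1 ?addr0 => [|i /negbTE ->]; last by rewrite mul0r mulr0.
      by rewrite /u cfg_pinned xcoord_boost_origin.
    under [in RHS]eq_bigr do rewrite mulrDr.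
    rewrite big_split/= E (sum_ward beta_sym) /weight -/u; ring.
  rewrite normrM (ger0_norm (weight_ge0 _ _)).
  rewrite mulrA; apply: ler_pM => //; [exact: weight_ge0| |exact: weight_le].
  apply: le_trans (ler_norm_sum _ _ _) _.
  apply: (@le_trans _ _ (\sum_(i : L) M * eps)); last first.
    by rewrite sumr_const -[_ *+ _]mulr_natl; rewrite le_eqVlt; apply/orP; left; apply/eqP; rewrite (_ : #|_| = #|L|)//; ring.
  apply: ler_sum => i _; rewrite normrM; apply: ler_pM => //.
    by apply: le_trans (hyperboloid_x_le (hyperboloid_cfg _ y i)) _; exact/ltW/zM.
  have [_ _ _ _ h] := FF'; apply: h => k.
  by rewrite /zvec ltW//; have [] := hyperboloid_zx (hyperboloid_cfg (s * r) y k).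
- rewrite (q0_vanishes (l := zvec u) Mk) mulr0 mul0r add0r big1 ?mul0r// => i _.
  exact: (@ward_vanishes R L n beta M F F' F_vanishes F'_vanishes i u k Mk).
Qed.

(** After integration only the term [i = a] of the Ward sum survives, and it equals minus the
    integral of [F a]. *)
Lemma pinned_green : `|\int[(mu \x m)%E]_p source q0 p - \int[m]_y (F a (zvec (cfg 0 y)) * weight 0 y)|
   <= eps * (`|s| * (#|L|%:R * M * weight_max)) * fine (m (ybox M)).
Proof.
have [isum Esum] := Rintegral_sumr (index_enum L) iW.
have mE : measurable_fun setT (fun p => source q0 p + \sum_i W i p).
  apply: measurable_funD; first exact: measurable_source.
  by apply: measurable_sum => i; exact: mW.
have iE := slab_integrable mE defect_bound.
have -> : \int[(mu \x m)%E]_p source q0 p = \int[(mu \x m)%E]_p (source q0 p + \sum_i W i p) - \int[(mu \x m)%E]_p (\sum_i W i p).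
  by rewrite -RintegralB//; apply: eq_Rintegral => p _; rewrite addrK.
have -> : \int[(mu \x m)%E]_p (\sum_i W i p) = - \int[m]_y (F a (zvec (cfg 0 y)) * weight 0 y).
  by rewrite Esum (bigD1 a)// WEa big1 => [|i ia]; [exact: addr0|exact: WE0].
by rewrite opprK addrK; exact: (slab_integral mE defect_bound).
Qed.

End solution.

End pinned_green_formula.

(** * Concentration of the tents *)

Section cosh_tent.
Context {R : realType}.
Notation mu := (@lebesgue_measure R).
Implicit Types (s r x y : R).

Lemma coshN x : cosh (- x) = cosh x.
Proof. by rewrite /cosh opprK addrC. Qed.

Lemma sinhN x : sinh (- x) = - sinh x.
Proof. by rewrite /sinh opprK -mulNr opprB. Qed.

Lemma sinh_ge0 x : 0 <= x -> 0 <= sinh x.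
Proof. by move=> x0; rewrite /sinh divr_ge0// subr_ge0 ler_expR ge0_cp. Qed.

Lemma cosh_le x y : 0 <= x -> x <= y -> cosh x <= cosh y.
Proof.
move=> x0 xy; rewrite -(@ler_pXn2r _ 2)// ?nnegrE ?(ltW (cosh_gt0 _))//.
rewrite !cosh_sqr lerD2l ler_pXn2r// ?nnegrE ?sinh_ge0//; last exact: le_trans xy.
by rewrite /sinh ler_wpM2r ?invr_ge0// lerB// ler_expR// lerN2.
Qed.

Lemma cosh_lt x y : 0 <= x -> x < y -> cosh x < cosh y.
Proof.
move=> x0 xy; rewrite -(@ltr_pXn2r _ 2)// ?nnegrE ?(ltW (cosh_gt0 _))//.
rewrite !cosh_sqr ltrD2l ltr_pXn2r// ?nnegrE ?sinh_ge0//; last exact: le_trans (ltW xy).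
by rewrite /sinh ltr_pM2r ?invr_gt0// ltrB// ?ltr_expR// ltrN2.
Qed.

Lemma cosh_norm x : cosh `|x| = cosh x.
Proof. by have [x0|x0] := ger0P x; rewrite ?coshN. Qed.

Lemma cosh0 : cosh (0 : R) = 1.
Proof. by rewrite /cosh oppr0 expR0; field. Qed.

Lemma cosh_gt1 s : s != 0 -> 1 < cosh s.
Proof. by move=> s0; rewrite -cosh0 -(cosh_norm s) cosh_lt// normr_gt0. Qed.

Variables (s al : R).
Hypothesis al_lt : al < cosh s.
Hypothesis al_ge1 : 1 <= al.

(** The derivative in r of [tent_cdf al (cosh s) (cosh (s * r))], hence a probability density on
    [0, 1]. *)
Definition cosh_tent r := s * sinh (s * r) * tent al (cosh s) (cosh (s * r)).

Lemma cosh_tent_ge0 r : 0 <= r -> 0 <= cosh_tent r.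
Proof.
move=> r0; rewrite /cosh_tent mulr_ge0 ?tent_ge0//.
have [s0|s0] := leP 0 s; first by rewrite mulr_ge0// sinh_ge0// mulr_ge0.
have s0' : 0 <= - s by rewrite oppr_ge0 ltW.
rewrite -(opprK (s * r)) sinhN mulrN -mulNr mulr_ge0//.
by rewrite sinh_ge0// -mulNr mulr_ge0.
Qed.

Lemma continuous_tent : continuous (tent al (cosh s)).
Proof.
(* With a one-point index set, functions of the local times are functions on the line. *)
have := @blip_continuous R unit R _ (fun (x : R) (k : unit) => x) (blip_tent al_lt tt).
by apply=> k x; exact: cvg_id.
Qed.

Lemma continuous_sinhM : continuous (fun r => sinh (s * r)).
Proof.
move=> r; apply: (@continuous_comp _ _ _ (fun r => s * r) (@sinh R)).
  by apply: cvgM; [exact: cvg_cst|exact: cvg_id].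
exact: is_derive_continuous is_derive_sinh _.
Qed.

Lemma continuous_coshM : continuous (fun r => cosh (s * r)).
Proof.
move=> r; apply: (@continuous_comp _ _ _ (fun r => s * r) (@cosh R)).
  by apply: cvgM; [exact: cvg_cst|exact: cvg_id].
exact: is_derive_continuous is_derive_cosh _.
Qed.

Lemma continuous_cosh_tent : continuous cosh_tent.
Proof.
move=> r; apply: cvgM; first by apply: cvgM; [exact: cvg_cst|exact: continuous_sinhM].
apply: (@continuous_comp _ _ _ (fun r => cosh (s * r)) (tent al (cosh s))).
  exact: continuous_coshM.
exact: continuous_tent.
Qed.

Lemma Rintegral_cosh_tent : \int[mu]_(r in `[0, 1]) cosh_tent r = 1.
Proof.
have d (r : R) : is_derive r 1 (fun r => tent_cdf al (cosh s) (cosh (s * r))) (cosh_tent r).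
  have d1 : is_derive r 1 (fun r : R => s * r) s.
    by apply: is_derive_eq; rewrite /GRing.scale/=; ring.
  have d2 := @is_derive1_comp _ (@cosh R) (fun r : R => s * r) r _ _ (is_derive_cosh (s * r)) d1.
  have d3 := @is_derive1_comp _ (tent_cdf al (cosh s)) (fun r : R => cosh (s * r)) r _ _ (is_derive_tent_cdf al_lt (cosh (s * r))) d2.
  by apply: (is_derive_eq d3); rewrite /cosh_tent; ring.
rewrite /Rintegral (FTC2 d)//; last exact: continuous_cosh_tent.
by rewrite mulr0 mulr1 cosh0 tent_cdf1// tent_cdf0// subr0.
Qed.

(** The hypothesis is multiplied by the density so that [f] has to be bounded only where the density
    is nonzero. *)
Lemma cosh_tent_average (f : R -> R) B : continuous f ->
  (forall r, 0 <= r <= 1 -> cosh_tent r * `|f r| <= B * cosh_tent r) ->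
  `|\int[mu]_(r in `[0, 1]) (cosh_tent r * f r)| <= B.
Proof.
move=> cf fB; have ct := continuous_cosh_tent.
have cm (h : R -> R) : continuous h -> continuous (fun r => cosh_tent r * h r).
  by move=> ch r; apply: cvgM; [exact: ct|exact: ch].
have i1 := continuous_itv_integrable 0 1 ct.
apply: le_trans (le_normr_Rintegral _ (continuous_itv_integrable 0 1 (cm _ cf))) _ => //.
rewrite (_ : B = \int[mu]_(r in `[0, 1]) (B * cosh_tent r)); last first.
  by rewrite RintegralZl// Rintegral_cosh_tent mulr1.
apply: le_Rintegral => //.
- have cn : continuous (fun r => `|cosh_tent r * f r|).
    by move=> r; apply: cvg_norm; exact: cm.
  exact: (continuous_itv_integrable 0 1 cn).
- have cB : continuous (fun r => B * cosh_tent r).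
    by move=> r; apply: cvgM; [exact: cvg_cst|exact: ct].
  exact: (continuous_itv_integrable 0 1 cB).
- move=> r; rewrite /= in_itv/= => /andP[r0 r1].
  by rewrite normrM (ger0_norm (cosh_tent_ge0 r0)) fB// r0.
Qed.

End cosh_tent.

Lemma cosh_tent_cvg {R : realType} (s : R) (al : nat -> R) (f : R -> R) :
  (forall k, 1 <= al k < cosh s) -> al k @[k --> \oo] --> cosh s -> continuous f ->
  \int[lebesgue_measure]_(r in `[0, 1]) (cosh_tent s (al k) r * f r) @[k --> \oo] --> f 1.
Proof.
move=> al1 alc cf; apply/cvgrPdist_le => e e0.
have [d d0 Hd] : exists2 d : R, 0 < d & forall r, `|r - 1| < d -> `|f r - f 1| <= e.
  have /cvgrPdist_le/(_ e e0) := cf 1; rewrite near_nbhs => /nbhs_ballP[d d0 H].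
  by exists d => // r rd; rewrite distrC; apply: H; rewrite /ball/= distrC.
pose d' := Num.min d 1.
have d'0 : 0 < d' by rewrite lt_min d0 ltr01.
have d'd : d' <= d by rewrite ge_min lexx.
have d'1 : d' <= 1 by rewrite ge_min lexx orbT.
have s0 : s != 0.
  apply/eqP => s0; have := al1 0%N; rewrite s0 cosh0 => /andP[h1 h2].
  by have := le_lt_trans h1 h2; rewrite ltxx.
(* Once [al k] exceeds this value the density is carried by r > 1 - d'. Taking [d' <= 1] keeps 1 -
   d' nonnegative, where cosh is monotone. *)
have lt1 : cosh (s * (1 - d')) < cosh s.
  rewrite -[ltLHS]cosh_norm -[ltRHS]cosh_norm cosh_lt// normrM.
  rewrite (ger0_norm (_ : 0 <= 1 - d')); last by rewrite subr_ge0.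
  by rewrite -[ltRHS]mulr1 ltr_pM2l ?normr_gt0//; lra.
have /cvgrPdist_lt/(_ (cosh s - cosh (s * (1 - d')))) := alc.
rewrite subr_gt0 => /(_ lt1); apply: filterS => k Hk.
have /andP[k1 k2] := al1 k.
have ak : cosh (s * (1 - d')) < al k.
  by move: Hk; rewrite ltr_norml => /andP[_]; lra.
have ct := continuous_cosh_tent k2.
have cf1 : continuous (fun r => f r - f 1) by move=> r; apply: cvgB; [exact: cf|exact: cvg_cst].
have cm (h : R -> R) : continuous h -> continuous (fun r => cosh_tent s (al k) r * h r).
  by move=> ch r; apply: cvgM; [exact: ct|exact: ch].
rewrite distrC.
have -> : \int[lebesgue_measure]_(r in `[0, 1]) (cosh_tent s (al k) r * f r) - f 1 =
  \int[lebesgue_measure]_(r in `[0, 1]) (cosh_tent s (al k) r * (f r - f 1)).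
  transitivity (\int[lebesgue_measure]_(r in `[0, 1]) (cosh_tent s (al k) r * f r - f 1 * cosh_tent s (al k) r)); last first.
    by apply: eq_Rintegral => r _; ring.
  have cfc : continuous (fun r => f 1 * cosh_tent s (al k) r).
    by move=> r; apply: cvgM; [exact: cvg_cst|exact: ct].
  rewrite RintegralB//; last 2 first.
  - exact: (continuous_itv_integrable 0 1 (cm _ cf)).
  - exact: (continuous_itv_integrable 0 1 cfc).
  rewrite RintegralZl//; last exact: (continuous_itv_integrable 0 1 ct).
  by rewrite Rintegral_cosh_tent// mulr1.
apply: cosh_tent_average => // r /andP[r0 r1].
have [rd|rd] := leP r (1 - d'); last first.
  rewrite mulrC ler_wpM2r ?cosh_tent_ge0//; apply: Hd.
  by rewrite ltr_norml; apply/andP; split; lra.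
rewrite /cosh_tent tent0 ?mulr0 ?mul0r//; left; apply: le_trans (ltW ak).
rewrite -[leLHS]cosh_norm -[leRHS]cosh_norm cosh_le// !normrM.
by rewrite ler_wpM2l// !ger0_norm//; lra.
Qed.

Section source_limit.
Context {R : realType} {L : finType} {n : nat}.
Notation vec := ('rV[R]_n.+2).
Variables (beta : L -> L -> R) (a : L).
Hypothesis beta_ge0 : forall i j, 0 <= beta i j.
Notation Y := (#|free_site a|.-tuple (n.+1.-tuple R)).
Notation mu := (@lebesgue_measure R).
Notation m := (power_measure (power_measure mu n.+1) #|free_site a|).
Implicit Types (y : Y) (r K : R) (p : R * Y).
Variables (s M C : R) (g : (L -> R) -> R).
Hypothesis M_gt0 : 0 < M.
Hypothesis g_lip : lip_bounded C g.
Hypothesis g_vanishes : forall l k, M <= l k -> g l = 0.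

Lemma continuous_cfg y : forall k j, continuous (fun r => cfg (s * r) y k 0 j).
Proof.
move=> k j; have [->|ka] := eqVneq k a; last first.
  by under eq_fun do rewrite cfg_site; exact: cst_continuous.
rewrite (_ : (fun r => _) = fun r => boost (s * r) hyp_origin 0 j).
  exact: continuous_boost_origin.
by apply/funext => r; rewrite cfg_pinned.
Qed.

Let phi y r := g (zvec (cfg (s * r) y)) * weight beta (s * r) y.

Let continuous_phi y : continuous (phi y).
Proof.
have cc := @continuous_cfg y.
move=> r; apply: cvgM.
  apply: (blip_continuous (Z := fun r => zvec (cfg (s * r) y))); first by exists C.
  by move=> k; exact: (@continuous_z _ _ _ _ (fun r => cfg (s * r) y) cc).
apply: cvgM; last exact: cvg_cst.
exact: (@continuous_gibbs _ _ _ _ beta (fun r => cfg (s * r) y) cc).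
Qed.

Let phi_bound y r : `|phi y r| <= C * weight_max beta M * \1_(ybox M) y.
Proof. by have [gC _] := g_lip; exact: observable_bound. Qed.

Variable al : nat -> R.
Hypothesis al_itv : forall k, 1 <= al k < cosh s.
Hypothesis al_cvg : al k @[k --> \oo] --> cosh s.

Definition tent_observable k (l : L -> R) := tent (al k) (cosh s) (l a) * g l.

Lemma blip_tent_observable k : blip (tent_observable k).
Proof.
have /andP[_ k2] := al_itv k.
by apply: blipM; [exact: blip_tent|exists C].
Qed.

Let sourceE k r y : source beta s (tent_observable k) (r, y) =
  \1_`[0%R, 1%R] r * (cosh_tent s (al k) r * phi y r).
Proof.
have Ea : zvec (cfg (s * r) y) a = cosh (s * r).
  by rewrite /zvec cfg_pinned zcoord_boost_origin.
rewrite /source /tent_observable /phi /cosh_tent [(r, y).1]/= [(r, y).2]/= Ea.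
by congr (_ * _); rewrite -!mulrA.
Qed.

Let line k y : (EFin \o (fun r => cosh_tent s (al k) r * phi y r)) \_ `[0%R, 1%R] =
  (fun r => (source beta s (tent_observable k) (r, y))%:E).
Proof.
apply/funext => r; rewrite patchE sourceE indicE.
by case: (r \in _); rewrite ?mul1r ?mul0r.
Qed.

Let continuous_line k y : continuous (fun r => cosh_tent s (al k) r * phi y r).
Proof.
have /andP[_ k2] := al_itv k.
by move=> r; apply: cvgM; [exact: continuous_cosh_tent|exact: continuous_phi].
Qed.

Let source_integrable k : (mu \x m)%E.-integrable setT (EFin \o source beta s (tent_observable k)).
Proof.
have /andP[k1 k2] := al_itv k.
have [C1 C1q] := blip_tent_observable k; have [C1b _] := C1q.
have C10 := lip_bounded_ge0 C1q.
apply: (slab_integrable (M := M) (K := `|s| * (M * C1 * weight_max beta M))).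
  by apply: measurable_source; exact: blip_tent_observable.
move=> [r y]; rewrite indic_slab /source [(r, y).1]/= [(r, y).2]/=.
have /andP[i0 i1] := indic01_le1 r.
rewrite normrM (ger0_norm i0) [leRHS]mulrCA ler_wpM2l// -mulrA normrM -(mulrA `|s|) ler_wpM2l//.
apply: (indic_ybox (r := s * r)) => [|zM|[j Mj]].
- by rewrite !mulr_ge0 ?expR_ge0// ltW.
- rewrite (normrM (sinh _)) (normrM (tent_observable k _)) -(mulrA M); apply: ler_pM => //.
    apply: le_trans (_ : zcoord (cfg (s * r) y a) <= _); last exact/ltW/zM.
    by rewrite -(xcoord_boost_origin (n := n)) -(cfg_pinned (a := a) (s * r) y); exact/hyperboloid_x_le/hyperboloid_cfg.
  apply: ler_pM => //; rewrite ger0_norm; first exact: weight_le.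
  exact: weight_ge0.
- by rewrite /tent_observable (g_vanishes (l := zvec (cfg (s * r) y)) Mj) mulr0 mul0r mulr0.
Qed.

(** Fubini leaves, for each [y], the average of [phi y] against [cosh_tent]; it tends to [phi y 1]
    and is dominated by a multiple of the indicator of the box. *)
Lemma source_cvg : m.-integrable setT (fun y => (g (zvec (cfg s y)) * weight beta s y)%:E) /\
  \int[(mu \x m)%E]_p source beta s (tent_observable k) p @[k --> \oo]
    --> \int[m]_y (g (zvec (cfg s y)) * weight beta s y).
Proof.
pose D k y := \int[mu]_(r in `[0, 1]) (cosh_tent s (al k) r * phi y r).
have iline k y : mu.-integrable setT (fun r => (source beta s (tent_observable k) (r, y))%:E).
  by rewrite -line -integrable_mkcond//; exact: continuous_itv_integrable.
have DE k y : (D k y)%:E = fubini_G mu (EFin \o source beta s (tent_observable k)) y.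
  rewrite /D /Rintegral integral_mkcond line fineK//.
  exact: integrable_fin_num (iline k y).
have [iphi cD] : m.-integrable setT (EFin \o (fun y => phi y 1)) /\
   (\int[m]_y (D k y)%:E @[k --> \oo] --> \int[m]_y (phi y 1)%:E)%E.
  apply: (dominated_cvg (m := m) (f_ := D) (h := fun y => C * weight_max beta M * \1_(ybox M) y)).
  - move=> k; apply/measurable_EFinP.
    rewrite (_ : EFin \o D k = fubini_G mu (EFin \o source beta s (tent_observable k))).
      exact: (measurable_fubini_G (source_integrable k)).
    by apply/funext => y /=; rewrite DE.
  - by move=> y; apply: cosh_tent_cvg.
  - apply: (ybox_integrable (M := M) (K := `|C * weight_max beta M|)).
      apply: measurable_funM => //; apply: (measurable_indic _) => //; exact: measurable_ybox.
    by move=> y; rewrite normrM (ger0_norm (_ : 0 <= \1_(ybox M) y))// indicE.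
  - move=> k y; have /andP[k1 k2] := al_itv k; apply: cosh_tent_average => // r /andP[r0 _].
    by rewrite mulrC ler_wpM2r ?cosh_tent_ge0.
have phi1 y : phi y 1 = g (zvec (cfg s y)) * weight beta s y by rewrite /phi mulr1.
have E1 : EFin \o (fun y => phi y 1) = fun y => (g (zvec (cfg s y)) * weight beta s y)%:E.
  by apply/funext => y; rewrite -phi1.
rewrite E1 in iphi; split; first exact: iphi.
rewrite (_ : (fun k => _) = fine \o (fun k => \int[m]_y (D k y)%:E)%E); last first.
  apply/funext => k /=; rewrite /Rintegral -(integral21_prod_meas1 (source_integrable k)).
  by congr fine; apply: eq_integral => y _; rewrite DE.
apply: fine_cvg; rewrite /Rintegral fineK; last exact: integrable_fin_num iphi.
by under [X in _ --> X]eq_integral do rewrite -phi1.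
Qed.

End source_limit.

(** * Boost invariance *)

Section boost_invariance.
Context {R : realType} {n : nat}.
Notation vec := ('rV[R]_n.+2).
Notation mu := (@lebesgue_measure R).
Implicit Types (v : n.+1.-tuple R) (w : vec) (x s : R).

Lemma boostK s : cancel (@boost R n.+1 s) (boost (- s)).
Proof.
move=> w; have := cosh_sqr s.
have E : cosh s ^+ 2 - sinh s ^+ 2 = 1 by rewrite cosh_sqr addrK.
move=> _; apply/rowP => k; case: (unliftP ord0 k) => [j|] ->; last first.
  rewrite -[LHS]/(zcoord _) -[RHS]/(zcoord w) zcoord_boost xcoord_boost zcoord_boost coshN sinhN.
  rewrite -[RHS]mul1r -E; ring.
case: (unliftP ord0 j) => [l|] ->; first by rewrite !rest_boost.
rewrite -!xcoordE xcoord_boost xcoord_boost zcoord_boost coshN sinhN.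
by rewrite -[RHS]mul1r -E; ring.
Qed.

Definition boost_line s v x := xcoord (boost s (hyp_point (tupd v ord0 x))).

Lemma hyperboloid_eq w w' : hyperboloid w -> hyperboloid w' ->
  (forall j, w 0 (lift ord0 j) = w' 0 (lift ord0 j)) -> w = w'.
Proof.
rewrite -hyp_pointP => -[v _ <-] [v' _ <-] vv; congr hyp_point.
by apply: eq_from_tnth => j; rewrite -!hyp_point_lift.
Qed.

Lemma boost_hyp_line s v x :
  boost s (hyp_point (tupd v ord0 x)) = hyp_point (tupd v ord0 (boost_line s v x)).
Proof.
apply: hyperboloid_eq; [exact/hyperboloid_boost/hyp_point_hyperboloid|exact: hyp_point_hyperboloid|].
move=> j; case: (unliftP ord0 j) => [l|] ->.
  by rewrite rest_boost !hyp_point_lift !tnth_tupd eq_sym (negbTE (neq_lift _ _)).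
by rewrite hyp_point_lift tnth_tupd eqxx /boost_line xcoordE.
Qed.

Lemma boost_lineK s v x : boost_line s v (boost_line (- s) v x) = x.
Proof.
rewrite {1}/boost_line -boost_hyp_line -{1}(opprK s) boostK xcoord_hyp_point.
by rewrite tnth_tupd eqxx.
Qed.

Lemma is_derive_boost_line s v (x : R) : is_derive x 1 (boost_line s v)
  (zcoord (hyp_point (tupd v ord0 (boost_line s v x))) / zcoord (hyp_point (tupd v ord0 x))).
Proof.
have dz := is_derive_hyp_point_z v x; have dx := is_derive_hyp_point_x v x.
rewrite (_ : boost_line s v = fun x => xcoord (hyp_point (tupd v ord0 x)) * cosh s +
  zcoord (hyp_point (tupd v ord0 x)) * sinh s); last first.
  by apply/funext => t; rewrite /boost_line xcoord_boost.
rewrite -xcoord_boost -/(boost_line s v x) -boost_hyp_line zcoord_boost.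
by apply: is_derive_eq; rewrite /GRing.scale/=; ring.
Qed.

(* [du = dx / z] is invariant under the boost along each line. *)
Lemma integral_boost_line s v (Psi : vec -> R) M : 0 < M ->
  (forall w, M <= zcoord w -> Psi w = 0) ->
  continuous (fun x => Psi (hyp_point (tupd v ord0 x))) ->
  (\int[mu]_x (Psi (hyp_point (tupd v ord0 x)) / zcoord (hyp_point (tupd v ord0 x)))%:E =
   \int[mu]_x (Psi (boost s (hyp_point (tupd v ord0 x))) / zcoord (hyp_point (tupd v ord0 x)))%:E)%E.
Proof.
move=> M0 PsiM cPsi; pose z x := zcoord (hyp_point (tupd v ord0 x)).
have z0 x : 0 < z x by have [] := hyperboloid_zx (hyp_point_hyperboloid (tupd v ord0 x)).
have cz : continuous z by exact: continuous_hyp_line.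
have czV : continuous (fun x => (z x)^-1).
  by move=> x; apply: cvgV; [rewrite lt0r_neq0|exact: cz].
have cF := is_derive_continuous (is_derive_boost_line s v).
pose G x := Psi (hyp_point (tupd v ord0 x)) / z x.
(* The Jacobian of the boosted line is the ratio of the z-coordinates, which trades the density at
   the image point for the density at [x]. *)
transitivity (\int[mu]_x (G (boost_line s v x) * (z (boost_line s v x) / z x))%:E)%E; last first.
  apply: eq_integral => x _; rewrite /G -boost_hyp_line; congr EFin.
  rewrite {1 2}/z -boost_hyp_line /z; field.
  rewrite lt0r_neq0 ?z0//=.
  by have [_ /lt0r_neq0 ->] := hyperboloid_zx (hyperboloid_boost s (hyp_point_hyperboloid (tupd v ord0 x))).
apply: (@substitution_compact _ (boost_line s v) _ G (boost_line (- s) v (- M)) (boost_line (- s) v M)).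
- by rewrite !boost_lineK ge0_cp// ltW.
- by move=> x; exact: is_derive_boost_line.
- move=> x; apply: cvgM; last exact: czV.
  by apply: (@continuous_comp _ _ _ (boost_line s v) z); [exact: cF|exact: cz].
- by move=> x; rewrite divr_gt0.
- by move=> x; apply: cvgM; [exact: cPsi|exact: czV].
- move=> x; rewrite !boost_lineK => /negP xM; rewrite /G PsiM ?mul0r//.
  rewrite -ler_norml -ltNge in xM; apply: le_trans (ltW xM) _.
  by have := hyp_point_coord_le (tupd v ord0 x) ord0; rewrite tnth_tupd eqxx.
Qed.

End boost_invariance.

Section partial_boosts.
Context {R : realType} {L : finType} {n : nat}.
Notation vec := ('rV[R]_n.+2).
Variables (beta : L -> L -> R) (a : L).
Notation Y := (#|free_site a|.-tuple (n.+1.-tuple R)).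
Notation mu := (@lebesgue_measure R).
Notation m := (power_measure (power_measure mu n.+1) #|free_site a|).
Implicit Types (y : Y) (A : {set L}) (g : (L -> R) -> R).
Variables (s M : R).
Hypothesis M_gt0 : 0 < M.

(** Hybrid configurations, with the boost applied on [A] only: sites are added to [A] one at a time,
    each by a change of variable on a line. *)
Definition boosted A y : L -> vec :=
  fun i => if i \in A then boost s (cfg s y i) else cfg s y i.

Definition boosted_integrand g A y : R :=
  g (zvec (boosted A y)) * expR (- hamiltonian beta (boosted A y)) * yweight y.

Lemma boosted_yupd A y i (ia : i != a) x : boosted A (yupd (site ia) y x) =
  upd_site (boosted A y) i (if i \in A
    then boost s (hyp_point (tupd (tnth y (site ia)) ord0 x))
    else hyp_point (tupd (tnth y (site ia)) ord0 x)).
Proof.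
apply/funext => k; rewrite /boosted cfg_yupd /upd_site.
by case: eqP => // ->; case: ifP.
Qed.

Lemma measurable_boosted_integrand g A : blip g ->
  measurable_fun setT (boosted_integrand g A).
Proof.
move=> bg.
have mc i k : measurable_fun setT (fun y => cfg s y i 0 k).
  exact: (measurable_cfg (rho := cst s) (eta := id)).
have mb i k : measurable_fun setT (fun y => boosted A y i 0 k).
  have mx : measurable_fun setT (fun y => xcoord (cfg s y i)) by exact: mc.
  have mz : measurable_fun setT (fun y => zcoord (cfg s y i)) by exact: mc.
  have E : (fun y => boosted A y i 0 k) = if i \in A then
      if k == ord0 then fun y => xcoord (cfg s y i) * sinh s + zcoord (cfg s y i) * cosh s
      else if k == inord 1 then fun y => xcoord (cfg s y i) * cosh s + zcoord (cfg s y i) * sinh s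
      else fun y => cfg s y i 0 k
    else fun y => cfg s y i 0 k.
    apply/funext => y; rewrite /boosted; case: (i \in A) => //; rewrite mxE.
    by case: (k == ord0) => //; case: (k == inord 1).
  rewrite E; case: (i \in A); last exact: mc.
  case: (k == ord0); first by apply: measurable_funD; apply: measurable_funM.
  case: (k == inord 1); last exact: mc.
  by apply: measurable_funD; apply: measurable_funM.
apply: measurable_funM; last by apply: (measurable_yweight (rho := cst 0) (eta := id)).
apply: measurable_funM; last exact: measurable_gibbs.
by apply: blip_measurable => // k; exact: mb.
Qed.

Lemma boosted_step g A i : blip g -> (forall l, 0 <= g l) ->
  (forall l k, M <= l k -> g l = 0) -> i != a -> i \notin A ->
  (\int[m]_y (boosted_integrand g A y)%:E = \int[m]_y (boosted_integrand g (i |: A) y)%:E)%E.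
Proof.
move=> bg g0 gM ia iA.
have pos B y : (0 <= (boosted_integrand g B y)%:E)%E.
  have /andP[w0 _] := yweight_itv y.
  by rewrite lee_fin !mulr_ge0 ?expR_ge0.
have meas B : measurable_fun setT (fun y => (boosted_integrand g B y)%:E).
  by apply/measurable_EFinP; exact: measurable_boosted_integrand.
apply: (config_coordinate (j := site ia)) => [||y|y|y]; [exact: meas|exact: meas|exact: pos|exact: pos|].
set v := tnth y (site ia); pose u := boosted A y.
pose W : R := \prod_(k | (k != a) && (k != i)) (zcoord (cfg 0 y k))^-1.
pose Psi w := W * (g (zvec (upd_site u i w)) * expR (- hamiltonian beta (upd_site u i w))).
transitivity (\int[mu]_x (Psi (hyp_point (tupd v ord0 x)) / zcoord (hyp_point (tupd v ord0 x)))%:E)%E.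
  apply: eq_integral => x _; congr EFin.
  by rewrite /boosted_integrand boosted_yupd (negbTE iA) yweight_yupd /Psi -/v -/W; ring.
have cline k j : continuous (fun x => upd_site u i (hyp_point (tupd v ord0 x)) k 0 j).
  by rewrite /upd_site; case: eqP => _; [exact: continuous_hyp_line|exact: cst_continuous].
rewrite (@integral_boost_line R n s v Psi M)//.
- apply: eq_integral => x _; congr EFin.
  rewrite /boosted_integrand boosted_yupd finset.setU11 yweight_yupd -/v -/W.
  have -> : upd_site (boosted (i |: A) y) i (boost s (hyp_point (tupd v ord0 x))) =
     upd_site u i (boost s (hyp_point (tupd v ord0 x))).
    apply/funext => k; rewrite /upd_site; case: eqP => // /eqP ki.
    by rewrite /u /boosted finset.in_setU1 (negbTE ki).
  by rewrite /Psi; ring.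
- by move=> w Mw; rewrite /Psi (gM _ i) ?mul0r ?mulr0// /zvec /upd_site eqxx.
- move=> x; apply: cvgM; first exact: cvg_cst.
  apply: cvgM; last exact: (@continuous_gibbs _ _ _ _ _ (fun x => upd_site u i (hyp_point (tupd v ord0 x)))).
  apply: (blip_continuous (Z := fun x => zvec (upd_site u i (hyp_point (tupd v ord0 x))))) => // k.
  exact: cline.
Qed.

Lemma boosted_integral g A : blip g -> (forall l, 0 <= g l) ->
  (forall l k, M <= l k -> g l = 0) -> a \notin A ->
  (\int[m]_y (boosted_integrand g A y)%:E = \int[m]_y (boosted_integrand g finset.set0 y)%:E)%E.
Proof.
move=> bg g0 gM; have [k Ak] := ubnP #|A|.
elim: k A Ak => [A Ak|k IH A Ak] aA; first by exfalso; rewrite ltn0 in Ak.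
have [->|[i iA]] := set_0Vmem A; first by [].
have ia : i != a by apply: contraNneq aA => <-.
rewrite -(finset.setD1K iA) -(boosted_step bg g0 gM ia); last by rewrite finset.setD11.
apply: IH.
  by move: Ak; rewrite (cardsD1 i A) iA.
by rewrite finset.in_setD1 (negbTE aA) andbF.
Qed.

Lemma hamiltonian_boost (u : L -> vec) : hamiltonian beta (fun i => boost s (u i)) = hamiltonian beta u.
Proof.
congr (_ * _); apply: eq_bigr => i _; apply: eq_bigr => j _.
by rewrite -boostB minkowski_boost.
Qed.

(** The pinned spin of [cfg s] is already the boosted origin, so once all the other sites are
    boosted the whole configuration is, and H is restored by its invariance. *)
Lemma boostedT y : boosted [set~ a]%SET y = fun i => boost s (cfg 0 y i).
Proof.
apply/funext => i; rewrite /boosted finset.in_setC1; have [->|ia] := eqVneq i a.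
  by rewrite !cfg_pinned boost0.
by rewrite !cfg_site.
Qed.

Lemma boosted0 y : boosted finset.set0 y = cfg s y.
Proof. by apply/funext => i; rewrite /boosted finset.in_set0. Qed.

Lemma boost_integral_ge0 g : blip g -> (forall l, 0 <= g l) ->
  (forall l k, M <= l k -> g l = 0) ->
  (\int[m]_y (g (zvec (fun i => boost s (cfg 0 y i))) * weight beta 0 y)%:E =
   \int[m]_y (g (zvec (cfg s y)) * weight beta s y)%:E)%E.
Proof.
move=> bg g0 gM; have := boosted_integral bg g0 gM (A := [set~ a]%SET); rewrite finset.in_setC1 eqxx => /(_ isT) E.
transitivity (\int[m]_y (boosted_integrand g [set~ a]%SET y)%:E)%E.
  apply: eq_integral => y _; rewrite /boosted_integrand boostedT hamiltonian_boost /weight.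
  by rewrite mulrA.
rewrite E; apply: eq_integral => y _; rewrite /boosted_integrand boosted0 /weight.
by rewrite mulrA.
Qed.

(** The positive and negative parts of [g] are treated separately; they are no longer smooth, but
    still bounded and Lipschitz. *)
Lemma boost_integral g : blip g -> (forall l k, M <= l k -> g l = 0) ->
  (\int[m]_y (g (zvec (fun i => boost s (cfg 0 y i))) * weight beta 0 y)%:E =
   \int[m]_y (g (zvec (cfg s y)) * weight beta s y)%:E)%E.
Proof.
move=> [C [gC gL]] gM.
have bpos (h : (L -> R) -> R) : (forall l, `|h l| <= C) ->
    (forall l l', `|h l - h l'| <= C * l1dist l l') -> blip (fun l => pos (h l)).
  move=> hC hL; exists C; split=> [l|l l'].
    by apply: le_trans (hC l); have := pos_lip (h l) 0; rewrite (pos_le (lexx _)) !subr0.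
  by apply: le_trans (hL l l'); exact: pos_lip.
have pos0 h : 0 <= pos h :> R by rewrite /pos le_max lexx orbT.
have posM (x w : R) : 0 <= w -> pos (x * w) = pos x * w.
  by move=> w0; rewrite /pos maxr_pMl// mul0r.
have split_int (f : Y -> R) (w : Y -> R) : (forall y, 0 <= w y) ->
   (\int[m]_y (f y * w y)%:E = \int[m]_y (pos (f y) * w y)%:E - \int[m]_y (pos (- f y) * w y)%:E)%E.
  move=> w0; rewrite integralE; congr (_ - _)%E; apply: eq_integral => y _.
    by rewrite funeposE -posM// /pos EFin_max.
  by rewrite funenegE -posM// /pos EFin_max mulNr.
apply: (etrans (split_int (fun y => g (zvec (fun i => boost s (cfg 0 y i)))) _ (weight_ge0 beta 0))).
apply: (etrans _ (esym (split_int (fun y => g (zvec (cfg s y))) _ (weight_ge0 beta s)))).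
apply: (f_equal2 (fun x y : \bar R => (x - y)%E)).
- apply: (boost_integral_ge0 (g := fun l => pos (g l))); [exact: bpos|by []|].
  by move=> l k /gM ->; rewrite pos_le.
- apply: (boost_integral_ge0 (g := fun l => pos (- g l))); [|by []|].
    apply: bpos => [l|l l']; first by rewrite normrN.
    by rewrite -opprD normrN.
  by move=> l k /gM ->; rewrite oppr0 pos_le.
Qed.

End partial_boosts.

(** * Identification of the two sides *)

Section smooth_compact_support.
Context {R : realType}.

Lemma continuous_compact_bound (T : topologicalType) (K : set T) (f : T -> R) :
  compact K -> continuous f -> exists C, forall x, K x -> `|f x| <= C.
Proof.
move=> cK cf.
have cfK : compact (f @` K) by apply: continuous_compact => //; exact: continuous_subspaceT.
have [M [_ HM]] := @compact_bounded R R^o _ cfK.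
by exists (M + 1) => x Kx; apply: (HM (M + 1)); [rewrite ltrDl|exists x].
Qed.

Context {N : nat}.
Implicit Types (f : 'rV[R]_N -> R) (x v : 'rV[R]_N).

Lemma derive_outside_support f x v : ~ closure [set x | f x != 0] x -> 'D_v f x = 0.
Proof.
move=> xK; rewrite (near_eq_derive (g := cst 0)) ?derive_cst//.
have : nbhs x (~` closure [set x | f x != 0]).
  by apply: open_nbhs_nbhs; split=> //; exact/closed_openC/closed_closure.
apply: filterS => z zK; apply/eqP/negPn/negP => fz.
by apply: zK; exact: subset_closure.
Qed.

Lemma is_derive_line f x v (t : R) : derivable f (x + t *: v) v ->
  is_derive t 1 (fun t => f (x + t *: v)) ('D_v f (x + t *: v)).
Proof.
have E : (fun h : R => h^-1 *: (((fun t => f (x + t *: v)) \o shift t) (h *: 1) - f (x + t *: v))) =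
    (fun h : R => h^-1 *: ((f \o shift (x + t *: v)) (h *: v) - f (x + t *: v))).
  apply/funext => h /=; congr (_ *: (f _ - _)).
  by rewrite (_ : h *: 1 = h) ?[_ *: 1]mulr1// scalerDl addrCA.
by move=> df; split; [rewrite /derivable E|rewrite /derive E].
Qed.

End smooth_compact_support.

Section test_function.
Context {R : realType} {L : finType}.
Implicit Types (g : (L -> R) -> R) (l : L -> R).

Lemma coordinate_lipschitz g C : 0 <= C ->
  (forall l i y, `|g (upd l i y) - g l| <= C * `|y - l i|) ->
  forall l l', `|g l - g l'| <= C * l1dist l l'.
Proof.
move=> C0 gC l l'.
pose h (r : seq L) k := if k \in r then l' k else l k.
have H (r : seq L) : uniq r -> `|g (h r) - g l| <= C * \sum_(k <- r) `|l k - l' k|.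
  elim: r => [_|k r IH /andP[kr ur]].
    by rewrite big_nil mulr0 (_ : h [::] = l) ?subrr ?normr0//.
  have -> : h (k :: r) = upd (h r) k (l' k).
    by apply/funext => i; rewrite /h /upd in_cons; case: eqP => [->|].
  rewrite big_cons mulrDr; apply: le_trans (ler_distD (g (h r)) _ _) _.
  apply: lerD; last exact: IH.
  apply: le_trans (gC _ _ _) _; rewrite ler_wpM2l// /h (negbTE kr).
  by rewrite distrC.
have := H _ (index_enum_uniq L); rewrite distrC (_ : h _ = l')//.
by apply/funext => k; rewrite /h mem_index_enum.
Qed.

Lemma on_rVK g l : on_rV g (\row_j l (enum_val j)) = g l.
Proof.
by rewrite /on_rV; congr g; apply/funext => i; rewrite mxE enum_rankK.
Qed.

(** The partial derivatives are continuous, hence bounded on the compact support, and zero off it;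
    the mean value theorem on coordinate lines gives the Lipschitz bound. *)
Lemma smooth_compact_blip g : smooth g -> compactly_supported g -> blip g.
Proof.
move=> sg cg; have cont : continuous (on_rV g) := sg 0%N.
have [C1 HC1] := continuous_compact_bound cg cont.
have /choice[C2 HC2] : forall i, exists c, forall x,
    closure [set x | on_rV g x != 0] x -> `|'D_(delta_mx 0 i) (on_rV g) x| <= c.
  move=> i; have [_ cD] := sg 1%N i.
  exact: continuous_compact_bound cg cD.
pose C : R := `|C1| + \sum_i `|C2 i|.
have C0 : 0 <= C by rewrite addr_ge0// sumr_ge0.
have DC i x : `|'D_(delta_mx 0 i) (on_rV g) x| <= C.
  have [xK|xK] := pselect (closure [set x | on_rV g x != 0] x); last first.
    by rewrite derive_outside_support// normr0.
  apply: le_trans (HC2 i x xK) _; apply: le_trans (ler_norm _) _.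
  by rewrite /C (bigD1 i)//= addrCA lerDl addr_ge0// sumr_ge0.
exists C; split.
  move=> l; rewrite -on_rVK; set x := \row_j _.
  have [->|gx] := eqVneq (on_rV g x) 0; first by rewrite normr0.
  apply: le_trans (HC1 x _) _; first exact: subset_closure.
  by apply: le_trans (ler_norm _) _; rewrite lerDl sumr_ge0.
apply: coordinate_lipschitz => // l i y.
pose x : 'rV[R]_#|L| := \row_j l (enum_val j).
pose v : 'rV[R]_#|L| := delta_mx 0 (enum_rank i).
pose psi t := on_rV g (x + t *: v).
have psiE t : psi t = g (upd l i (l i + t)).
  rewrite -on_rVK /psi; congr on_rV; apply/rowP => j; rewrite !mxE eqxx/= /upd.
  have -> : (j == enum_rank i) = (enum_val j == i).
    by rewrite -(inj_eq enum_val_inj) enum_rankK.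
  by case: eqP => [->|_]; rewrite ?mulr1// mulr0 addr0.
have dpsi (t : R) : is_derive t 1 psi ('D_v (on_rV g) (x + t *: v)).
  by apply: is_derive_line; have [d _] := sg 1%N (enum_rank i); exact: d.
have cpsi := is_derive_continuous dpsi.
have mvt (p q : R) : p < q -> `|psi q - psi p| <= C * `|q - p|.
  move=> pq; have [c _ ->] := MVT pq (fun t _ => dpsi t) (continuous_subspaceT cpsi).
  by rewrite normrM; apply: ler_wpM2r => //; exact: DC.
have -> : g (upd l i y) = psi (y - l i) by rewrite psiE addrC subrK.
have -> : g l = psi 0 by rewrite psiE addr0 upd_id.
rewrite -[X in C * `|X|]subr0.
have [h|h|->] := ltgtP (y - l i) 0; last by rewrite !subrr normr0 mulr0.
- by rewrite distrC [X in C * X]distrC mvt.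
- exact: mvt.
Qed.

Lemma compact_vanishes g : compactly_supported g ->
  exists M, forall l k, M <= l k -> g l = 0.
Proof.
move=> cg.
have /choice[C HC] : forall k, exists c, forall x,
    closure [set x | on_rV g x != 0] x -> `|x 0 (enum_rank k)| <= c.
  move=> k; apply: (@continuous_compact_bound _ _ _ (fun x : 'rV[R]_#|L| => x 0 (enum_rank k)) cg).
  exact: coord_continuous.
exists (\sum_k `|C k| + 1) => l k lM; apply/eqP/negPn/negP => gl.
have := HC k (\row_j l (enum_val j)); rewrite mxE enum_rankK.
have /[swap]/[apply] : closure [set x | on_rV g x != 0] (\row_j l (enum_val j)).
  by apply: subset_closure => /=; rewrite on_rVK.
apply/negP; rewrite -ltNge; apply: lt_le_trans (ler_norm _); apply: lt_le_trans lM.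
apply: le_lt_trans (ler_norm _) _; rewrite (bigD1 k)//=.
have : 0 <= \sum_(i | i != k) `|C i| by exact: sumr_ge0.
lra.
Qed.

End test_function.

(** * The VRJP expectation integrated over the spins *)

Section vrjp_side.
Context {R : realType} {L : finType} {n : nat}.
Notation vec := ('rV[R]_n.+2).
Variables (beta : L -> L -> R) (a : L).
Hypothesis beta_sym : forall i j, beta i j = beta j i.
Hypothesis beta_ge0 : forall i j, 0 <= beta i j.
Notation Y := (#|free_site a|.-tuple (n.+1.-tuple R)).
Notation mu := (@lebesgue_measure R).
Notation m := (power_measure (power_measure mu n.+1) #|free_site a|).
Implicit Types (y : Y) (r K : R).
Context d (Omega : measurableType d) (X : R -> Omega -> L)
  (P : L -> (L -> R) -> probability Omega R).
Hypothesis X_VRJP : forall v l, (forall i, 0 < l i) -> is_VRJP beta v l (P v l) X.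
Variables (s M : R) (g : (L -> R) -> R).
Hypothesis s_neq0 : s != 0.
Hypothesis M_gt0 : 0 < M.
Hypothesis M_ge : cosh s <= M.
Hypothesis g_blip : blip g.
Hypothesis g_vanishes : forall l k, M <= l k -> g l = 0.

Lemma cvg_harmonic_shift (c e : R) : c - e / k.+1%:R @[k --> \oo] --> c.
Proof.
rewrite -[X in _ --> X](subr0 c) -[X in c - X](mulr0 e); apply: cvgB; first exact: cvg_cst.
by apply: cvgM; [exact: cvg_cst|exact: cvg_harmonic].
Qed.

Lemma bounded_cvg_fin_num (u : nat -> R) (B : R) (l : \bar R) :
  (forall k, `|u k| <= B) -> (u k)%:E @[k --> \oo] --> l -> l \is a fin_num.
Proof.
move=> uB ul; have cu : cvg ((u k)%:E @[k --> \oo]) by apply/cvg_ex; exists l.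
have E : lim ((u k)%:E @[k --> \oo]) = l by exact: cvg_lim.
have h1 : (l <= B%:E)%E.
  rewrite -E; apply: lime_le => //; apply: nearW => k; rewrite lee_fin.
  exact: le_trans (ler_norm _) (uB k).
have h2 : ((- B)%:E <= l)%E.
  rewrite -E; apply: lime_ge => //; apply: nearW => k; rewrite lee_fin.
  by have := uB k; rewrite ler_norml => /andP[].
by rewrite fin_numE; apply/andP; split; apply/eqP => l0; rewrite l0 in h1 h2.
Qed.

(** The integrals [I k] of the approximate solutions have two limits, one from [hitting_limit] and
    one from [pinned_green] with [source_cvg]; uniqueness of the limit identifies them. *)
Lemma vrjp_integral :
  (\int[m]_y ('E_(P a (zvec (cfg 0 y)))[at_hitting_time X (zvec (cfg 0 y)) a (cosh s) g]
     * (weight beta 0 y)%:E) =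
   \int[m]_y (g (zvec (cfg s y)) * weight beta s y)%:E)%E.
Proof.
have [C gC] := g_blip; have C0 := lip_bounded_ge0 gC.
have ga1 := cosh_gt1 s_neq0.
(* The lower end of the tent starts at 1, the initial local time of the pinned site, and increases
   to cosh s. *)
pose al (k : nat) : R := cosh s - (cosh s - 1) / k.+1%:R.
pose eps (k : nat) : R := k.+1%:R^-1.
have eps0 k : 0 < eps k by rewrite invr_gt0.
have eps1 k : eps k <= 1 by rewrite invf_le1// ler1n.
have al_itv k : 1 <= al k < cosh s.
  have := eps0 k; have := eps1 k; rewrite /al -/(eps k) => e1 e0.
  apply/andP; split; last by rewrite gtrBl mulr_gt0// subr_gt0.
  rewrite lerBrDr -lerBrDl; apply: le_trans (_ : (cosh s - 1) * 1 <= _); last by rewrite mulr1.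
  by rewrite ler_wpM2l// subr_ge0 ltW.
have al_cvg : al k @[k --> \oo] --> cosh s by exact: cvg_harmonic_shift.
have eps_cvg : eps k @[k --> \oo] --> 0 by exact: cvg_harmonic.
pose q k := tent_observable a s g al k.
have q_blip k : blip (q k) by apply: (@blip_tent_observable _ _ a s C g gC al al_itv k).
have q_van k l j : M <= l j -> q k l = 0.
  by move=> /g_vanishes gl; rewrite /q /tent_observable gl mulr0.
have q_van_a k l : cosh s <= l a -> q k l = 0.
  move=> cl; have /andP[_ k2] := al_itv k.
  by rewrite /q /tent_observable tent0 ?mul0r//; right.
have /choice[FF HFF] : forall k, exists FF : (L -> (L -> R) -> R) * (L -> (L -> R) -> R),
    poisson_solution beta M (fun i l => (i == a)%:R * q k l) (eps k) FF.1 FF.2.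
  move=> k.
  have [i|j i l Ml|F [F' H]] := @poisson_approx R L beta M M_gt0 (fun i l => (i == a)%:R * q k l) (eps k) _ _ (eps0 k).
  - by apply: blipM => //; exact: blip_cst.
  - by rewrite (q_van _ _ _ Ml) mulr0.
  - by exists (F, F').
pose F k := (FF k).1 a; pose ell y := zvec (cfg 0 y).
have F_van k l j : M <= l j -> F k l = 0.
  have [_ _ h _ _] := HFF k => Ml.
  apply: (proj1 (h j M (lexx _) _) a l Ml) => i l' Ml'.
  by rewrite (q_van _ _ _ Ml') mulr0.
have F_blip k : blip (F k) by have [h _ _ _ _] := HFF k; exact: h.
have ell_ge1 y i : 1 <= ell y i by exact/hyperboloid_z_ge1/hyperboloid_cfg.
have ell_a y : ell y a = 1.
  by rewrite /ell /zvec cfg_pinned zcoord_boost_origin cosh0.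
pose E y := ('E_(P a (ell y))[at_hitting_time X (ell y) a (cosh s) g])%E.
(* The bound of [hitting_limit] with [eps k <= 1]: it is uniform in [k] and in the spins, hence
   integrable over the box. *)
pose B : R := C * 2 + (1 + 1) * (#|L|%:R * M).
have [Fcvg FB] : (forall y, (F k (ell y))%:E @[k --> \oo] --> E y) /\
    (forall k y, `|F k (ell y)| <= B).
  have ell_lt y : ell y a < cosh s by rewrite ell_a.
  have al_itv' y k : ell y a <= al k < cosh s by rewrite ell_a.
  have H y := @hitting_limit R L d Omega (P a (ell y)) beta a (ell y) X
    (X_VRJP a (fun i => lt_le_trans ltr01 (ell_ge1 y i))) (fun i => le_trans ler01 (ell_ge1 y i))
    (cosh s) M C g (ell_lt y) M_gt0 gC g_vanishes al eps (fun k => (FF k).1) (fun k => (FF k).2)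
    (al_itv' y) al_cvg eps0 eps_cvg HFF.
  split=> [y|k y]; first by have [] := H y.
  have [_ h] := H y; apply: le_trans (h k) _; rewrite /B lerD2l ler_wpM2r ?lerD2r//.
  by rewrite mulr_ge0// ltW.
have Efin y : E y \is a fin_num by exact: bounded_cvg_fin_num (FB^~ y) (Fcvg y).
have B0 : 0 <= B by rewrite addr_ge0 ?mulr_ge0 ?addr_ge0// ltW.
pose I k := \int[m]_y (F k (ell y) * weight beta 0 y).
have Fint k : m.-integrable setT (fun y => (F k (ell y) * weight beta 0 y)%:E).
  have [C1 [FC1 _]] := F_blip k.
  apply: (ybox_integrable (f := fun y => F k (ell y) * weight beta 0 y) (M := M) (K := C1 * weight_max beta M)); last first.
    by move=> y; apply: observable_bound => //; exact: F_van.
  apply: measurable_funM.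
    by apply: (measurable_zvec (rho := cst 0) (eta := id)).
  by apply: (measurable_weight beta (rho := cst 0) (eta := id)).
have [iE cE] : m.-integrable setT (EFin \o (fun y => fine (E y) * weight beta 0 y)) /\
   ((\int[m]_y (F k (ell y) * weight beta 0 y)%:E) @[k --> \oo] --> \int[m]_y (fine (E y) * weight beta 0 y)%:E)%E.
  apply: (@dominated_cvg R _ _ m (fun k y => F k (ell y) * weight beta 0 y) _
    (fun y => B * weight_max beta M * \1_(ybox M) y)).
  - by move=> k; apply/measurable_EFinP; exact: measurable_int (Fint k).
  - move=> y; apply: cvgM; last exact: cvg_cst.
    by apply: (@fine_cvg _ _ _ _ (fun k => (F k (ell y))%:E)); rewrite fineK.
  - apply: (ybox_integrable (M := M) (K := `|B * weight_max beta M|)).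
      apply: measurable_funM => //; apply: (measurable_indic _) => //; exact: measurable_ybox.
    by move=> y; rewrite normrM (ger0_norm (_ : 0 <= \1_(ybox M) y))// indicE.
  - move=> k y; apply: (indic_ybox (r := 0)) => [|zM|[j Mj]].
    + by rewrite mulr_ge0 ?expR_ge0.
    + rewrite normrM (ger0_norm (weight_ge0 beta 0 y)).
      by apply: ler_pM => //; [exact: weight_ge0|exact: weight_le].
    + by rewrite (F_van k _ j) ?mul0r.
have [iG cS] := @source_cvg R L n beta a beta_ge0 s M C g M_gt0 gC g_vanishes al al_itv al_cvg.
pose K := `|s| * (#|L|%:R * M * weight_max beta M) * fine (m (ybox M)).
have green k : `|\int[(mu \x m)%E]_p source beta s (q k) p - I k| <= eps k * K.
  have := pinned_green beta_sym beta_ge0 M_gt0 M_ge (q_blip k) (q_van k) (q_van_a k) (ltW (eps0 k)) (HFF k).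
  by move=> /(_ n); rewrite /K !mulrA.
have cI : I k @[k --> \oo] --> \int[m]_y (g (zvec (cfg s y)) * weight beta s y).
  rewrite (_ : I = fun k => \int[(mu \x m)%E]_p source beta s (q k) p -
     (\int[(mu \x m)%E]_p source beta s (q k) p - I k)); last first.
    by apply/funext => k; rewrite opprB addrC subrK.
  rewrite -[X in _ --> X]subr0; apply: cvgB; first exact: cS.
  apply: norm_cvg0; apply: (@squeeze_cvgr _ _ _ _ (cst 0) (fun k => eps k * K)).
  - by apply: nearW => k; rewrite normr_ge0 green.
  - exact: cvg_cst.
  - by rewrite -(mul0r K); apply: cvgM; [exact: eps_cvg|exact: cvg_cst].
have cI' : I k @[k --> \oo] --> \int[m]_y (fine (E y) * weight beta 0 y).
  apply: fine_cvg; rewrite /Rintegral fineK; first exact: cE.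
  exact: integrable_fin_num iE.
have E0 : \int[m]_y (fine (E y) * weight beta 0 y) = \int[m]_y (g (zvec (cfg s y)) * weight beta s y).
  exact: (cvg_unique (@Rhausdorff R) cI' cI).
transitivity (\int[m]_y (fine (E y) * weight beta 0 y)%:E)%E.
  by apply: eq_integral => y _; rewrite EFinM fineK.
apply: (etrans (esym (fineK (integrable_fin_num measurableT iE)))).
apply: (etrans _ (fineK (integrable_fin_num measurableT iG))).
by apply: (f_equal EFin); exact: E0.
Qed.

End vrjp_side.

Lemma hitting_time0 (R : realType) (L : finType) d (Omega : measurableType d)
    (X : R -> Omega -> L) (ell : L -> R) (a : L) w : hitting_time X ell a (ell a) w = 0%:E.
Proof.
apply/eqP; rewrite eq_le; apply/andP; split.
  by apply: ereal_inf_lbound; exists 0 => //=; rewrite local_time0.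
by apply: le_ereal_inf_tmp => _ [t [t0 _] <-]; rewrite lee_fin.
Qed.

Theorem theorem3p4 (R : realType) (n : nat) (n_gt0 : (0 < n)%N)
  (L : finType) (beta : L -> L -> R)
  (beta_sym : forall i j, beta i j = beta j i)
  (beta_ge0 : forall i j, 0 <= beta i j)
  (beta_connected : forall i j, connect [rel i j | 0 < beta i j] i j)
  (d : measure_display) (Omega : measurableType d) (X : R -> Omega -> L)
  (P : L -> (L -> R) -> probability Omega R)
  (X_VRJP : forall v l, (forall i, 0 < l i) -> is_VRJP beta v l (P v l) X)
  (g : (L -> R) -> R) (g_smooth : smooth g)
  (g_compact : compactly_supported g) (a : L) (s : R) :
  @pinned_expectation R L n beta a hyp_origin
    (fun u => (g (fun i => zcoord (boost s (u i))))%:E)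
  = @pinned_expectation R L n beta a hyp_origin
    (fun u => let z := fun i => zcoord (u i) in
       'E_(P a z)[at_hitting_time X z a (cosh s) g])%E.
Proof.
(* The dimension is now a successor, which makes x a genuine coordinate. *)
case: n n_gt0 => // n _.
have cfg0 y : @pinned_config R L n.+1 a hyp_origin y = cfg 0 y by rewrite /cfg boost0.
rewrite /pinned_expectation.
(* For s = 0 the level cosh 0 = 1 is reached at time 0, so no tent fits between the initial local
   time and the level; the integrands agree pointwise. *)
have [s0|s0] := eqVneq s 0.
  apply: eq_integral => y _; rewrite cfg0 s0; congr (_ * _)%E.
  have -> : (fun i => zcoord (boost 0 (cfg 0 y i))) = zvec (cfg 0 y).
    by apply/funext => i; rewrite boost0.
  have za : cosh 0 = zvec (cfg 0 y) a by rewrite /zvec cfg_pinned zcoord_boost_origin.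
  rewrite -/(zvec (cfg 0 y)) za (_ : at_hitting_time _ _ _ _ _ = cst (g (zvec (cfg 0 y)))).
    by rewrite expectation_cst.
  by apply/funext => w; rewrite /at_hitting_time hitting_time0 local_time0.
have g_blip := smooth_compact_blip g_smooth g_compact.
have [M0 gM0] := compact_vanishes g_compact.
(* [cosh s <= M] is needed for the vanishing of the solutions above cosh s at [a], since they are
   built by integrating up to [M]. *)
pose M := Num.max M0 (cosh s).
have M_ge : cosh s <= M by rewrite le_max lexx orbT.
have M_gt0 : 0 < M by exact: lt_le_trans (cosh_gt0 s) M_ge.
have gM l k : M <= l k -> g l = 0.
  by move=> Ml; apply: (gM0 _ k); apply: le_trans Ml; rewrite le_max lexx.
have L1 := boost_integral beta a s M_gt0 g_blip gM (n := n).
have L2 := @vrjp_integral R L n beta a beta_sym beta_ge0 d Omega X P X_VRJP s M g s0 M_gt0 M_ge g_blip gM.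
apply: (etrans _ (etrans L1 (etrans (esym L2) _))); apply: eq_integral => y _; rewrite cfg0.
  by rewrite -EFinM (yweightE 0).
by rewrite (yweightE 0).
Qed.
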